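(* Let $D\subset\mathbb C$ be a bounded convex domain and $p\in D$. There exists a harmonic map $f:\mathbb D\to D$ such that $f(0)=p$, $df_0$ is conformal, and $\|df_0\|=M_D(p)$. Furthermore, \[ M_D(p)\le \frac{\operatorname{Per}(D)}{2\pi}. \]
   Context: $\mathbb D=\{z\in\mathbb C:|z|<1\}$. For a domain $D\subset\mathbb C$ and $p\in D$, $M_D(p)$ denotes the supremum of the operator norms $\|df_0\|$ over all harmonic maps $f:\mathbb D\to D$ with $f(0)=p$ whose differential $df_0:\mathbb R^2\to\mathbb R^2$ at $0$ is conformal (i.e. a nonnegative multiple of an orthogonal linear map, orientation preserving or reversing). $\operatorname{Per}(D)$ denotes the perimeter of $D$. *)

(* Defs.v *)
From Stdlib Require Import Reals Lra.
From Coquelicot Require Import Coquelicot.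
Open Scope R_scope.

Definition dist2 (z w : C) : R := Cmod (Cminus z w).

Definition open_set (U : C -> Prop) : Prop :=
  forall z, U z -> exists eps, 0 < eps /\ forall w, dist2 w z < eps -> U w.

Definition connected_set (D : C -> Prop) : Prop :=
  forall U V : C -> Prop, open_set U -> open_set V ->
    (forall z, D z -> U z \/ V z) ->
    (exists z, D z /\ U z) -> (exists z, D z /\ V z) ->
    exists z, D z /\ U z /\ V z.

Definition is_domain (D : C -> Prop) : Prop :=
  open_set D /\ connected_set D /\ exists z, D z.

Definition bounded_set (D : C -> Prop) : Prop :=
  exists r, forall z, D z -> Cmod z <= r.

Definition convex_set (D : C -> Prop) : Prop :=
  forall z w t, D z -> D w -> 0 <= t <= 1 ->
    D (t * fst z + (1 - t) * fst w, t * snd z + (1 - t) * snd w).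

Definition in_boundary (D : C -> Prop) (z : C) : Prop :=
  ~ D z /\ forall eps, 0 < eps -> exists w, D w /\ dist2 w z < eps.

Definition cross (a b : C) : R := fst a * snd b - snd a * fst b.

(* x 0, ..., x (n-1) are the vertices, in counterclockwise order, of a convex
   polygon: every other vertex lies strictly to the left of each edge. *)
Definition ccw_convex_polygon (n : nat) (x : nat -> C) : Prop :=
  (3 <= n)%nat /\
  forall i k, (i < n)%nat -> (k < n)%nat -> k <> i -> k <> ((i + 1) mod n)%nat ->
    0 < cross (Cminus (x ((i + 1) mod n)%nat) (x i)) (Cminus (x k) (x i)).

Definition polygon_length (n : nat) (x : nat -> C) : R :=
  sum_f_R0 (fun i => dist2 (x ((i + 1) mod n)%nat) (x i)) (n - 1).

(* Perimeter of a (bounded convex) domain = length of its boundary curve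
   = sup of the lengths of closed polygons inscribed in the boundary with
   vertices in (counterclockwise) cyclic order. *)
Definition Per (D : C -> Prop) : Rbar :=
  Lub_Rbar (fun L => exists n x, ccw_convex_polygon n x /\
                      (forall i, (i < n)%nat -> in_boundary D (x i)) /\
                      L = polygon_length n x).

Definition unit_disk (z : C) : Prop := Cmod z < 1.

Definition dx (u : R -> R -> R) : R -> R -> R := fun a b => Derive (fun t => u t b) a.
Definition dy (u : R -> R -> R) : R -> R -> R := fun a b => Derive (fun t => u a t) b.

Definition harmonic_on (U : C -> Prop) (u : R -> R -> R) : Prop :=
  forall x y, U (x, y) ->
    ex_derive (fun t => u t y) x /\ ex_derive (fun t => u x t) y /\
    ex_derive (fun t => dx u t y) x /\ ex_derive (fun t => dx u x t) y /\
    ex_derive (fun t => dy u t y) x /\ ex_derive (fun t => dy u x t) y /\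
    continuity_2d_pt u x y /\
    continuity_2d_pt (dx u) x y /\ continuity_2d_pt (dy u) x y /\
    continuity_2d_pt (dx (dx u)) x y /\ continuity_2d_pt (dy (dx u)) x y /\
    continuity_2d_pt (dx (dy u)) x y /\ continuity_2d_pt (dy (dy u)) x y /\
    dx (dx u) x y + dy (dy u) x y = 0.

Definition re_part (f : C -> C) : R -> R -> R := fun x y => fst (f (x, y)).
Definition im_part (f : C -> C) : R -> R -> R := fun x y => snd (f (x, y)).

Definition harmonic_map (f : C -> C) : Prop :=
  harmonic_on unit_disk (re_part f) /\ harmonic_on unit_disk (im_part f).

Record mat2 := Mat2 { m11 : R; m12 : R; m21 : R; m22 : R }.

Definition df0 (f : C -> C) : mat2 :=
  Mat2 (dx (re_part f) 0 0) (dy (re_part f) 0 0)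
       (dx (im_part f) 0 0) (dy (im_part f) 0 0).

Definition conformal (M : mat2) : Prop :=
  exists s o11 o12 o21 o22, 0 <= s /\
    o11 * o11 + o21 * o21 = 1 /\ o12 * o12 + o22 * o22 = 1 /\
    o11 * o12 + o21 * o22 = 0 /\
    m11 M = s * o11 /\ m12 M = s * o12 /\ m21 M = s * o21 /\ m22 M = s * o22.

Definition opnorm (M : mat2) : Rbar :=
  Lub_Rbar (fun r => exists v1 v2, v1 * v1 + v2 * v2 = 1 /\
     r = sqrt ((m11 M * v1 + m12 M * v2) ^ 2 + (m21 M * v1 + m22 M * v2) ^ 2)).

Definition admissible (D : C -> Prop) (p : C) (f : C -> C) : Prop :=
  harmonic_map f /\ (forall z, unit_disk z -> D (f z)) /\ f (0, 0) = p /\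
  conformal (df0 f).

Definition M_D (D : C -> Prop) (p : C) : Rbar :=
  Lub_Rbar (fun m => exists f, admissible D p f /\ opnorm (df0 f) = Finite m).

(* Main.v *)
Require Import Defs.
From Stdlib Require Import Reals Lra Lia Classical ClassicalEpsilon List Permutation Sorted.
From Coquelicot Require Import Coquelicot.
Open Scope R_scope.

(** The components of a harmonic map of the disk are real parts of power series
    [sum c_n z^n], [sum d_n z^n] (via the Cauchy formula for [u_x - i u_y]).  Its differential at 0
    is read off [c_1, d_1]: it is conformal iff [c_1^2 + d_1^2 = 0], and its norm is then [|c_1|].
    A bound on the map bounds all coefficients, so a maximizing sequence has a coefficientwise
    limit, whose values lie in the closure of [D]; Harnack's inequality keeps them inside the open
    convex set [D].

    For the bound, averaging [f] over the vertices [w_j] of a regular polygon inscribed in the circle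
    [|z| = r] against the unit vectors [u_j] = (rotated or reflected) [w_j / r] gives [r |c_1|] up to
    a vanishing error.  Since [u_(j+m) = - u_j], this is an average of widths of a
    polygon inscribed in the boundary of [D] whose hull contains the values of [f]; the mean width
    of a convex curve is its length over [pi]. *)

(** * Real parts of power series *)

(** Power series are reached through the dilations [f(r z)] with [r < 1]: they keep the value at 0,
    take values in [D], and have differential [r] times that of [f], still conformal, so letting [r]
    tend to 1 loses nothing. The function [u_x - i u_y] is used because its Cauchy-Riemann equations
    are just Laplace's equation and the symmetry of second derivatives; no harmonic conjugate has to
    be built first. Means over circles are taken as averages over N-th roots of unity. The perimeter
    suggests it: it is a supremum over inscribed polygons, and only finitely many values of [f] can
    be enclosed by one of them. Harnack's inequality then becomes a statement about finite convex
    combinations, to which the convexity of [D] applies directly. The obstacle to compactness is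
    that a limit of maps into [D] might touch the boundary. Harnack gives each value a fixed share
    of [p], the same for all maps, and openness at [p] absorbs the error. The constant: with [2 m]
    directions and an inscribed polygon of length [L], the average is at most
    [L / (4 m sin (PI / (2 m)))], which tends to [L / (2 PI)]. *)

Definition hser (c : nat -> C) (z : C) : R := Series (fun n => Re (c n * z ^ n)%C).

Lemma Series_nonneg a : (forall n, 0 <= a n) -> ex_series a -> 0 <= Series a.
Proof.
  intros H Ha. replace 0 with (Series (fun n => 0 * a n)).
  - apply Series_le; auto. intro n. specialize (H n). lra.
  - rewrite Series_scal_l. ring.
Qed.

(** The radius is taken for the real series of moduli; it is that of the complex series, and it
    yields absolute convergence of [hser] on every smaller disk. *)
Definition conv_disk (c : nat -> C) : Prop := Rbar_le 1 (CV_radius (fun n => Cmod (c n))).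

Definition cderiv (c : nat -> C) (n : nat) : C := (INR (S n) * c (S n))%C.

Lemma conv_disk_summable c r :
  conv_disk c -> 0 <= r < 1 -> ex_series (fun n => Cmod (c n) * r ^ n).
Proof.
  intros Hc Hr.
  apply ex_series_ext with (fun n => Rabs (Cmod (c n) * r ^ n)).
  - intro n. apply Rabs_pos_eq. apply Rmult_le_pos. apply Cmod_ge_0. apply pow_le; lra.
  - apply CV_disk_inside. apply Rbar_lt_le_trans with 1; [|exact Hc].
    simpl. rewrite Rabs_pos_eq; lra.
Qed.

Lemma conv_disk_ext_Cmod c d :
  (forall n, Cmod (d n) = Cmod (c n)) -> conv_disk c -> conv_disk d.
Proof.
  intros H. unfold conv_disk. intro Hc.
  rewrite (CV_radius_ext _ (fun n => Cmod (c n))); auto.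
Qed.

Lemma Cmod_cderiv c n : Cmod (cderiv c n) = PS_derive (fun n => Cmod (c n)) n.
Proof.
  unfold cderiv, PS_derive. rewrite Cmod_mult, Cmod_R, Rabs_pos_eq; auto using pos_INR.
Qed.

Lemma conv_disk_cderiv c : conv_disk c -> conv_disk (cderiv c).
Proof.
  unfold conv_disk. intro Hc.
  rewrite (CV_radius_ext _ (PS_derive (fun n => Cmod (c n)))) by apply Cmod_cderiv.
  now rewrite CV_radius_derive.
Qed.

Lemma Cmod_Ci_mult z : Cmod (Ci * z) = Cmod z.
Proof.
  rewrite Cmod_mult. replace (Cmod Ci) with 1. lra.
  unfold Cmod, Ci; simpl. replace (0 * (0 * 1) + 1 * (1 * 1)) with 1 by ring. now rewrite sqrt_1.
Qed.

Lemma conv_disk_Ci c : conv_disk c -> conv_disk (fun n => Ci * c n)%C.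
Proof. apply conv_disk_ext_Cmod. intro; apply Cmod_Ci_mult. Qed.

Lemma Re_term_le (c z : C) n r : Cmod z <= r -> Rabs (Re (c * z ^ n)%C) <= Cmod c * r ^ n.
Proof.
  intro H. eapply Rle_trans; [apply re_le_Cmod|].
  rewrite Cmod_mult, Cmod_pow.
  apply Rmult_le_compat_l; [apply Cmod_ge_0|]. apply pow_incr. split; auto using Cmod_ge_0.
Qed.

Lemma ex_hser c z : conv_disk c -> Cmod z < 1 -> ex_series (fun n => Re (c n * z ^ n)%C).
Proof.
  intros Hc Hz.
  apply (ex_series_le (K:=R_AbsRing) (V:=R_CompleteNormedModule) _ (fun n => Cmod (c n) * Cmod z ^ n)).
  - intro n. change (Rabs (Re (c n * z ^ n)%C) <= Cmod (c n) * Cmod z ^ n).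
    apply Re_term_le; lra.
  - apply conv_disk_summable; auto. split; [apply Cmod_ge_0|auto].
Qed.

(** The remainder of degree [n + 1] is [z + h] times that of degree [n], plus a multiple of [h ^ 2].
    The factor is twice the optimal one; in this form it is the factor in [cderiv (cderiv c)]. *)
Lemma Cpow_taylor_remainder (z h : C) r n : Cmod z <= r -> Cmod (z + h)%C <= r ->
  Cmod ((z + h) ^ S (S n) - z ^ S (S n) - INR (S (S n)) * h * z ^ S n)%C
    <= INR (S (S n)) * INR (S n) * r ^ n * Cmod h ^ 2.
Proof.
  intros Hz Hzh.
  assert (Hr : 0 <= r) by (eapply Rle_trans; [apply Cmod_ge_0|apply Hz]).
  induction n.
  - replace ((z + h) ^ 2 - z ^ 2 - INR 2 * h * z ^ 1)%C with (h ^ 2)%C.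
    + rewrite Cmod_pow. pose proof (pow2_ge_0 (Cmod h)). change (INR 2) with (1+1). change (INR 1) with 1. change (r ^ 0) with 1. lra.
    + simpl. unfold RtoC. 
      replace ((1 + 1, 0) : C) with (RtoC 1 + RtoC 1)%C by (unfold RtoC, Cplus; simpl; f_equal; ring).
      ring.
  - replace ((z + h) ^ S (S (S n)) - z ^ S (S (S n)) - INR (S (S (S n))) * h * z ^ S (S n))%C
      with ((z + h) * ((z + h) ^ S (S n) - z ^ S (S n) - INR (S (S n)) * h * z ^ S n)
            + INR (S (S n)) * (h ^ 2 * z ^ S n))%C.
    2:{ rewrite (S_INR (S (S n))), RtoC_plus. simpl Cpow. ring. }
    eapply Rle_trans; [apply Cmod_triangle|].
    rewrite !Cmod_mult, !Cmod_pow, Cmod_R, (Rabs_pos_eq (INR _)) by apply pos_INR.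
    assert (H1 : Cmod (z + h) * Cmod ((z + h) ^ S (S n) - z ^ S (S n) - INR (S (S n)) * h * z ^ S n)
       <= r * (INR (S (S n)) * INR (S n) * r ^ n * Cmod h ^ 2)).
    { apply Rmult_le_compat; auto using Cmod_ge_0. }
    assert (H2 : INR (S (S n)) * (Cmod h ^ 2 * Cmod z ^ S n) <= INR (S (S n)) * (Cmod h ^ 2 * r ^ S n)).
    { apply Rmult_le_compat_l; [apply pos_INR|]. apply Rmult_le_compat_l; [apply pow2_ge_0|].
      apply pow_incr; split; auto using Cmod_ge_0. }
    assert (H3 : 0 <= r ^ S n * Cmod h ^ 2).
    { apply Rmult_le_pos; [apply pow_le; auto|apply pow2_ge_0]. }
    rewrite (S_INR (S (S n))), (S_INR (S n)) in *. simpl pow in *.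
    pose proof (pos_INR (S n)) as H4.
    generalize dependent (INR (S n)). intros m; intros.
    assert (0 <= (m + 1) * (r * r ^ n * (Cmod h * (Cmod h * 1)))).
    { apply Rmult_le_pos; lra. }
    nra.
Qed.

Lemma Cmod_le_2max (h : C) : Cmod h <= 2 * Rmax (Rabs (fst h)) (Rabs (snd h)).
Proof.
  eapply Rle_trans; [apply Cmod_2Rmax|].
  apply Rmult_le_compat_r.
  - eapply Rle_trans; [|apply Rmax_l]. apply Rabs_pos.
  - replace 2 with (sqrt (2 ^ 2)) at 2 by (apply sqrt_pow2; lra). apply sqrt_le_1_alt. lra.
Qed.

(** The gradient of [Re g] is [(Re g', Re (i g'))], because [Re (h a) = Re a * h1 + Re (i a) * h2].
    The Taylor remainders are summed against the majorant of the second derivative on [|z| <= r], so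
    the constant does not depend on [h]. *)
Lemma hser_quadratic_remainder c (z h : C) r : conv_disk c -> r < 1 -> Cmod z <= r -> Cmod (z + h)%C <= r ->
  Rabs (hser c (z + h)%C - hser c z
     - (hser (cderiv c) z * fst h + hser (fun n => Ci * cderiv c n)%C z * snd h))
   <= Series (fun n => Cmod (cderiv (cderiv c) n) * r ^ n) * Cmod h ^ 2.
Proof.
  intros Hc Hr Hz Hzh.
  assert (Hr0 : 0 <= r) by (eapply Rle_trans; [apply Cmod_ge_0|apply Hz]).
  assert (Hc1 := conv_disk_cderiv _ Hc).
  assert (Hc2 := conv_disk_Ci _ Hc1).
  (* The linear part is shifted by one index, so that its term sits beside the power [z ^ n] that it
     comes from. *)
  set (b := fun n => match n with O => 0 | S m => Re (h * (cderiv c m * z ^ m))%C end).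
  assert (Hb' : ex_series (fun m => Re (h * (cderiv c m * z ^ m))%C) /\
      Series (fun m => Re (h * (cderiv c m * z ^ m))%C) =
    hser (cderiv c) z * fst h + hser (fun n => Ci * cderiv c n)%C z * snd h).
  { assert (E : forall m, Re (h * (cderiv c m * z ^ m))%C =
       Re (cderiv c m * z ^ m)%C * fst h + Re (Ci * cderiv c m * z ^ m)%C * snd h).
    { intro m. destruct h as [h1 h2]. rewrite <- Cmult_assoc.
      generalize (cderiv c m * z ^ m)%C. intros [a1 a2]. simpl. ring. }
    split.
    - eapply ex_series_ext; [intro m; symmetry; apply E|].
      apply (ex_series_plus (V := R_NormedModule)).
      + apply ex_series_scal_r. apply ex_hser; auto; lra.
      + apply ex_series_scal_r. apply (ex_hser (fun n => Ci * cderiv c n)%C); auto; lra.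
    - rewrite (Series_ext _ _ E). rewrite Series_plus.
      + rewrite !Series_scal_r. reflexivity.
      + apply ex_series_scal_r. apply ex_hser; auto; lra.
      + apply ex_series_scal_r. apply (ex_hser (fun n => Ci * cderiv c n)%C); auto; lra. }
  destruct Hb' as [Hb1 Hb2].
  assert (Hb : ex_series b). { apply ex_series_incr_1. exact Hb1. }
  rewrite <- Hb2.
  replace (Series (fun m => Re (h * (cderiv c m * z ^ m))%C)) with (Series b).
  2:{ rewrite (Series_incr_1 b Hb). simpl. ring. }
  unfold hser at 1 2.
  assert (E1 := ex_hser c (z + h)%C Hc ltac:(lra)).
  assert (E2 := ex_hser c z Hc ltac:(lra)).
  rewrite <- Series_minus by auto.
  rewrite <- Series_minus; [|apply (ex_series_minus (V:=R_NormedModule)); auto|auto].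
  (* Degrees 0 and 1 are affine and leave no remainder. *)
  rewrite (Series_incr_n_aux _ 2).
  2:{ intros k Hk. destruct k as [|[|k]]; [| |lia].
      - simpl. ring.
      - unfold b, cderiv. simpl. destruct h, z, (c 1%nat). simpl. ring. }
  assert (Hd : ex_series (fun n => Cmod (cderiv (cderiv c) n) * r ^ n)).
  { apply conv_disk_summable; [|lra]. now apply conv_disk_cderiv. }
  assert (Hle : forall n, Rabs (Re (c (2 + n)%nat * (z + h) ^ (2 + n))%C - Re (c (2 + n)%nat * z ^ (2 + n))%C - b (2 + n)%nat) <=
     Cmod (cderiv (cderiv c) n) * r ^ n * Cmod h ^ 2).
  { intro n. unfold b. change (2 + n)%nat with (S (S n)). cbv iota beta.
    replace (Re (c (S (S n)) * (z + h) ^ S (S n))%C - Re (c (S (S n)) * z ^ S (S n))%C -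
      Re (h * (cderiv c (S n) * z ^ S n))%C)
     with (Re (c (S (S n)) * ((z + h) ^ S (S n) - z ^ S (S n) - INR (S (S n)) * h * z ^ S n))%C).
    - eapply Rle_trans; [apply re_le_Cmod|]. rewrite Cmod_mult.
      eapply Rle_trans. apply Rmult_le_compat_l; [apply Cmod_ge_0|].
      apply Cpow_taylor_remainder; eauto.
      rewrite !Cmod_cderiv. unfold PS_derive. rewrite Cmod_cderiv. unfold PS_derive.
      apply Req_le. ring.
    - unfold cderiv.
      unfold Rminus. rewrite <- !re_opp, <- !re_plus. f_equal. ring. }
  eapply Rle_trans; [apply Series_Rabs|].
  - apply (ex_series_le (K:=R_AbsRing) (V:=R_CompleteNormedModule) _ (fun n => Cmod (cderiv (cderiv c) n) * r ^ n * Cmod h ^ 2)).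
    + intro n. change (Rabs (Rabs (Re (c (2 + n)%nat * (z + h) ^ (2 + n))%C - Re (c (2 + n)%nat * z ^ (2 + n))%C - b (2 + n)%nat)) <=
     Cmod (cderiv (cderiv c) n) * r ^ n * Cmod h ^ 2). rewrite Rabs_Rabsolu. apply Hle.
    + now apply ex_series_scal_r.
  - rewrite <- Series_scal_r. apply Series_le.
    + intro n. split; [apply Rabs_pos|apply Hle].
    + now apply ex_series_scal_r.
Qed.

Lemma hser_differentiable c x y : conv_disk c -> Cmod (x, y) < 1 ->
  differentiable_pt_lim (fun u v => hser c (u, v)) x y
    (hser (cderiv c) (x, y)) (hser (fun n => Ci * cderiv c n)%C (x, y)).
Proof.
  intros Hc Hz eps.
  set (r := (1 + Cmod (x, y)) / 2).
  set (K := Series (fun n => Cmod (cderiv (cderiv c) n) * r ^ n)).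
  assert (Hr : Cmod (x,y) < r < 1) by (unfold r; lra).
  assert (HK : 0 <= K).
  { unfold K. apply Series_nonneg.
    - intro n. apply Rmult_le_pos; [apply Cmod_ge_0|]. apply pow_le.
      pose proof (Cmod_ge_0 (x,y)). lra.
    - apply conv_disk_summable. now apply conv_disk_cderiv, conv_disk_cderiv.
      pose proof (Cmod_ge_0 (x,y)). lra. }
  (* The first bound keeps [z + h] in the disk of radius [r], as [|h| <= 2 m]; the second makes
     [K (2 m)^2 <= eps m]. *)
  assert (Hd : 0 < Rmin ((r - Cmod (x,y)) / 2) (eps / (4 * (K + 1)))).
  { apply Rmin_pos; [lra|]. apply Rdiv_lt_0_compat; [apply cond_pos|lra]. }
  exists (mkposreal _ Hd). simpl. intros u v Hu Hv.
  set (m := Rmax (Rabs (u - x)) (Rabs (v - y))).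
  assert (Hm : m < Rmin ((r - Cmod (x,y)) / 2) (eps / (4 * (K + 1)))) by (now apply Rmax_lub_lt).
  assert (Hm0 : 0 <= m). { unfold m. eapply Rle_trans; [apply Rabs_pos|apply Rmax_l]. }
  assert (Hm1 : m < (r - Cmod (x,y)) / 2) by (eapply Rlt_le_trans; [apply Hm|apply Rmin_l]).
  assert (Hm2 : m < eps / (4 * (K + 1))) by (eapply Rlt_le_trans; [apply Hm|apply Rmin_r]).
  set (h := (u - x, v - y) : C).
  assert (Hh : Cmod h <= 2 * m) by apply Cmod_le_2max.
  replace ((u, v) : C) with ((x, y) + h)%C by (unfold h, Cplus; simpl; f_equal; ring).
  eapply Rle_trans.
  { apply (hser_quadratic_remainder c (x, y) h r); auto; try lra.
    eapply Rle_trans; [apply Cmod_triangle|]. lra. }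
  fold K. fold m.
  apply Rle_trans with (K * (2 * m) ^ 2).
  - apply Rmult_le_compat_l; auto. apply pow_incr. split; auto using Cmod_ge_0.
  - replace (K * (2 * m) ^ 2) with (4 * K * m * m) by ring.
    apply Rmult_le_compat_r; auto.
    apply Rle_trans with (4 * (K + 1) * m); [nra|].
    apply Rlt_le. apply Rmult_lt_reg_r with (/ (4 * (K + 1))).
    + apply Rinv_0_lt_compat; lra.
    + replace (4 * (K + 1) * m * / (4 * (K + 1))) with m by (field; lra). exact Hm2.
Qed.

Lemma differentiable_pt_lim_is_derive_x f x y lx ly :
  differentiable_pt_lim f x y lx ly -> is_derive (fun t => f t y) x lx.
Proof.
  intro H. apply is_derive_Reals.
  replace lx with (lx * 1 + ly * 0) by ring.
  apply (derivable_pt_lim_comp_2d f (fun t => t) (fun _ => y)); auto.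
  - apply derivable_pt_lim_id.
  - apply derivable_pt_lim_const.
Qed.

Lemma differentiable_pt_lim_is_derive_y f x y lx ly :
  differentiable_pt_lim f x y lx ly -> is_derive (fun t => f x t) y ly.
Proof.
  intro H. apply is_derive_Reals.
  replace ly with (lx * 0 + ly * 1) by ring.
  apply (derivable_pt_lim_comp_2d f (fun _ => x) (fun t => t)); auto.
  - apply derivable_pt_lim_const.
  - apply derivable_pt_lim_id.
Qed.

Lemma differentiable_pt_lim_continuity f x y lx ly :
  differentiable_pt_lim f x y lx ly -> continuity_2d_pt f x y.
Proof.
  intro H. apply differentiable_continuity_pt. now exists lx, ly.
Qed.

Lemma locally_2d_disk x y r : Cmod (x, y) < r -> locally_2d (fun u v => Cmod (u, v) < r) x y.
Proof.
  intro H.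
  assert (Hd : 0 < (r - Cmod (x, y)) / 2) by lra.
  exists (mkposreal _ Hd). simpl. intros u v Hu Hv.
  replace ((u, v) : C) with ((x, y) + ((u - x)%R, (v - y)%R))%C by (unfold Cplus; simpl; f_equal; ring).
  eapply Rle_lt_trans; [apply Cmod_triangle|].
  pose proof (Cmod_le_2max ((u - x)%R, (v - y)%R)) as H1. simpl in H1.
  assert (Rmax (Rabs (u - x)) (Rabs (v - y)) < (r - Cmod (x, y)) / 2) by (now apply Rmax_lub_lt).
  lra.
Qed.

Section PartialsNear.
Variables (f g h : R -> R -> R) (x y : R).
Hypothesis Hloc : locally_2d (fun u v => differentiable_pt_lim f u v (g u v) (h u v)) x y.

(** The equality holds on a neighbourhood, not just at the point, so that it can be differentiated
    once more. *)
Lemma dx_near : locally_2d (fun u v => dx f u v = g u v) x y.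
Proof.
  eapply locally_2d_impl; [|exact Hloc]. apply locally_2d_forall. intros u v H.
  apply is_derive_unique. exact (differentiable_pt_lim_is_derive_x _ _ _ _ _ H).
Qed.

Lemma dy_near : locally_2d (fun u v => dy f u v = h u v) x y.
Proof.
  eapply locally_2d_impl; [|exact Hloc]. apply locally_2d_forall. intros u v H.
  apply is_derive_unique. exact (differentiable_pt_lim_is_derive_y _ _ _ _ _ H).
Qed.
End PartialsNear.

Lemma differentiable_pt_lim_eq_near f g x y lx ly :
  locally_2d (fun u v => f u v = g u v) x y ->
  differentiable_pt_lim g x y lx ly -> differentiable_pt_lim f x y lx ly.
Proof.
  intros H. apply differentiable_pt_lim_ext. eapply locally_2d_impl; [|exact H].
  apply locally_2d_forall. auto.
Qed.

Definition hmap (c d : nat -> C) (z : C) : C := (hser c z, hser d z).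

Lemma hser_differentiable_near c x y : conv_disk c -> Cmod (x, y) < 1 ->
  locally_2d (fun u v => differentiable_pt_lim (fun u v => hser c (u, v)) u v
    (hser (cderiv c) (u, v)) (hser (fun n => Ci * cderiv c n)%C (u, v))) x y.
Proof.
  intros Hc Hz. eapply locally_2d_impl; [|apply locally_2d_disk, Hz].
  apply locally_2d_forall. intros u v H. now apply hser_differentiable.
Qed.

Lemma cderiv_Ci c n : cderiv (fun n => Ci * c n)%C n = (Ci * cderiv c n)%C.
Proof. unfold cderiv. ring. Qed.

Lemma hser_ext c d z : (forall n, c n = d n) -> hser c z = hser d z.
Proof. intro H. apply Series_ext. intro n. now rewrite H. Qed.

(** Applying the gradient formula twice gives [u_xx = Re g''] and
    [u_yy = Re (i i g'') = - Re g'']. *)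
Lemma hser_harmonic c : conv_disk c -> harmonic_on unit_disk (fun x y => hser c (x, y)).
Proof.
  intros Hc x y Hz. unfold unit_disk in Hz.
  set (u := fun x y : R => hser c (x, y)).
  assert (Hc1 := conv_disk_cderiv _ Hc).
  assert (Hc2 := conv_disk_Ci _ Hc1).
  assert (D0 := hser_differentiable_near _ _ _ Hc Hz). fold u in D0.
  assert (D1 := hser_differentiable_near _ _ _ Hc1 Hz).
  assert (D2 := hser_differentiable_near _ _ _ Hc2 Hz).
  assert (X0 := dx_near _ _ _ _ _ D0). assert (Y0 := dy_near _ _ _ _ _ D0).
  assert (D1' : locally_2d (fun a b => differentiable_pt_lim (dx u) a b (hser (cderiv (cderiv c)) (a, b))
     (hser (fun n => Ci * cderiv (cderiv c) n)%C (a, b))) x y).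
  { eapply locally_2d_impl_strong; [|exact X0].
    eapply locally_2d_impl; [|exact D1].
    apply locally_2d_forall. intros a b H1 H2.
    eapply differentiable_pt_lim_eq_near; [exact H2|exact H1]. }
  assert (D2' : locally_2d (fun a b => differentiable_pt_lim (dy u) a b
     (hser (cderiv (fun n => Ci * cderiv c n)%C) (a, b))
     (hser (fun n => Ci * cderiv (fun n => Ci * cderiv c n) n)%C (a, b))) x y).
  { eapply locally_2d_impl_strong; [|exact Y0].
    eapply locally_2d_impl; [|exact D2].
    apply locally_2d_forall. intros a b H1 H2.
    eapply differentiable_pt_lim_eq_near; [exact H2|exact H1]. }
  assert (E0 := locally_2d_singleton _ _ _ D0).
  assert (E1 := locally_2d_singleton _ _ _ D1').
  assert (E2 := locally_2d_singleton _ _ _ D2').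
  assert (C2 : forall d f, conv_disk d -> locally_2d (fun a b => f a b = hser d (a, b)) x y ->
     continuity_2d_pt f x y).
  { intros d f Hd Hf. apply (continuity_2d_pt_ext_loc (fun a b => hser d (a, b))).
    - eapply locally_2d_impl; [|exact Hf]. apply locally_2d_forall; auto.
    - eapply differentiable_pt_lim_continuity, hser_differentiable; auto. }
  assert (XX := dx_near _ _ _ _ _ D1'). assert (YX := dy_near _ _ _ _ _ D1').
  assert (XY := dx_near _ _ _ _ _ D2'). assert (YY := dy_near _ _ _ _ _ D2').
  split; [exact (ex_intro _ _ (differentiable_pt_lim_is_derive_x _ _ _ _ _ E0))|].
  split; [exact (ex_intro _ _ (differentiable_pt_lim_is_derive_y _ _ _ _ _ E0))|].
  split; [exact (ex_intro _ _ (differentiable_pt_lim_is_derive_x _ _ _ _ _ E1))|].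
  split; [exact (ex_intro _ _ (differentiable_pt_lim_is_derive_y _ _ _ _ _ E1))|].
  split; [exact (ex_intro _ _ (differentiable_pt_lim_is_derive_x _ _ _ _ _ E2))|].
  split; [exact (ex_intro _ _ (differentiable_pt_lim_is_derive_y _ _ _ _ _ E2))|].
  split; [eapply differentiable_pt_lim_continuity, E0|].
  split; [eapply differentiable_pt_lim_continuity, E1|].
  split; [eapply differentiable_pt_lim_continuity, E2|].
  split; [eapply C2; [|exact XX]|].
  { now apply conv_disk_cderiv. }
  split; [eapply C2; [|exact YX]|].
  { now apply (conv_disk_Ci (cderiv (cderiv c))), conv_disk_cderiv. }
  split; [eapply C2; [|exact XY]|].
  { now apply conv_disk_cderiv. }
  split; [eapply C2; [|exact YY]|].
  { now apply (conv_disk_Ci (cderiv (fun n => (Ci * cderiv c n)%C))), conv_disk_cderiv. }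
  rewrite (locally_2d_singleton _ _ _ XX), (locally_2d_singleton _ _ _ YY).
  rewrite (hser_ext (fun n => Ci * cderiv (fun n => Ci * cderiv c n) n)%C (fun n => - cderiv (cderiv c) n)%C).
  - unfold hser. rewrite (Series_ext (fun n => Re (- cderiv (cderiv c) n * (x, y) ^ n)%C)
      (fun n => - Re (cderiv (cderiv c) n * (x, y) ^ n)%C)).
    + rewrite Series_opp. ring.
    + intro n. rewrite <- re_opp. f_equal. ring.
  - intro n. rewrite cderiv_Ci. unfold Ci. 
    generalize (cderiv (cderiv c) n). intros [a b]. unfold Cmult, Copp; simpl. f_equal; ring.
Qed.

Lemma hser_0 c : hser c 0 = Re (c 0%nat).
Proof.
  unfold hser. replace (Series _) with (Series (fun n => Re (c 0%nat) * (0 ^ n))).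
  - rewrite Series_scal_l. rewrite Series_geom by (rewrite Rabs_R0; lra). field.
  - apply Series_ext. intros [|n].
    + unfold Re; simpl; ring.
    + rewrite Cpow_S, Cmult_0_l, Cmult_0_r. unfold Re; simpl; ring.
Qed.

Lemma df0_hmap c d : conv_disk c -> conv_disk d ->
  df0 (hmap c d) = Mat2 (Re (c 1%nat)) (- Im (c 1%nat)) (Re (d 1%nat)) (- Im (d 1%nat)).
Proof.
  assert (H : forall c, conv_disk c -> dx (fun x y => hser c (x, y)) 0 0 = Re (c 1%nat) /\
      dy (fun x y => hser c (x, y)) 0 0 = - Im (c 1%nat)).
  { intros c' Hc'.
    assert (H0 : Cmod (0, 0) < 1). { change (0,0) with (RtoC 0). rewrite Cmod_0. lra. }
    pose proof (hser_differentiable c' 0 0 Hc' H0) as D0.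
    split; apply is_derive_unique.
    - apply differentiable_pt_lim_is_derive_x in D0.
      replace (Re (c' 1%nat)) with (hser (cderiv c') (0,0)); [exact D0|].
      change (0,0) with (RtoC 0). rewrite hser_0. unfold cderiv, Re, Im; simpl; ring.
    - apply differentiable_pt_lim_is_derive_y in D0.
      replace (- Im (c' 1%nat)) with (hser (fun n => Ci * cderiv c' n)%C (0,0)); [exact D0|].
      change (0,0) with (RtoC 0). rewrite hser_0. unfold cderiv, Re, Im; simpl; ring. }
  intros Hc Hd. unfold df0. unfold re_part, im_part. simpl.
  destruct (H c Hc) as [-> ->]. destruct (H d Hd) as [-> ->]. reflexivity.
Qed.

(** * Averages over roots of unity *)

(** Here [n] counts the terms, so the empty sum is available, contrary to [sum_f_R0]; splittings and
    inductions start from it. *)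
Fixpoint psum (f : nat -> R) (n : nat) : R :=
  match n with O => 0 | S m => psum f m + f m end.

Lemma psum_ext f g n : (forall j, (j < n)%nat -> f j = g j) -> psum f n = psum g n.
Proof.
  induction n; simpl; intro H; auto. rewrite IHn, H; auto.
Qed.

Lemma psum_plus f g n : psum (fun j => f j + g j) n = psum f n + psum g n.
Proof. induction n; simpl; [ring|rewrite IHn; ring]. Qed.

Lemma psum_scal_l a f n : psum (fun j => a * f j) n = a * psum f n.
Proof. induction n; simpl; [ring|rewrite IHn; ring]. Qed.

Lemma psum_scal_r a f n : psum (fun j => f j * a) n = psum f n * a.
Proof. induction n; simpl; [ring|rewrite IHn; ring]. Qed.

Lemma psum_const a n : psum (fun _ => a) n = INR n * a.
Proof. induction n; [simpl; ring|]. rewrite S_INR. simpl. rewrite IHn; ring. Qed.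

Lemma psum_le f g n : (forall j, (j < n)%nat -> f j <= g j) -> psum f n <= psum g n.
Proof.
  induction n; simpl; intro H; [lra|]. apply Rplus_le_compat; auto.
Qed.

Lemma psum_nonneg f n : (forall j, (j < n)%nat -> 0 <= f j) -> 0 <= psum f n.
Proof.
  induction n; simpl; intro H; [lra|]. apply Rplus_le_le_0_compat; auto.
Qed.

Lemma psum_Rabs f n : Rabs (psum f n) <= psum (fun j => Rabs (f j)) n.
Proof.
  induction n; simpl. rewrite Rabs_R0; lra.
  eapply Rle_trans; [apply Rabs_triang|]. lra.
Qed.

Lemma psum_swap (f : nat -> nat -> R) n m :
  psum (fun i => psum (fun j => f i j) m) n = psum (fun j => psum (fun i => f i j) n) m.
Proof.
  induction n; simpl.
  - rewrite psum_const; ring.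
  - rewrite IHn, psum_plus. reflexivity.
Qed.

Lemma psum_add f n m : psum f (n + m) = psum f n + psum (fun j => f (n + j)%nat) m.
Proof.
  induction m; simpl.
  - rewrite Nat.add_0_r; ring.
  - rewrite Nat.add_succ_r. simpl. rewrite IHm. ring.
Qed.

Lemma psum_single f n k : (k < n)%nat ->
  (forall j, (j < n)%nat -> j <> k -> f j = 0) -> psum f n = f k.
Proof.
  induction n; intros Hk H; [lia|]. simpl.
  destruct (Nat.eq_dec k n) as [->|Hn].
  - rewrite (psum_ext _ (fun _ => 0)).
    + rewrite psum_const; ring.
    + intros j Hj. apply H; lia.
  - rewrite IHn, (H n); auto; try lia. ring. 
Qed.

Lemma psum_sum_f_R0 f n : psum f (S n) = sum_f_R0 f n.
Proof. induction n; simpl; [ring|]. rewrite <- IHn. reflexivity. Qed.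

Lemma Cpow_0 (z : C) : (z ^ 0)%C = 1%C.
Proof. reflexivity. Qed.

Definition cis (t : R) : C := (cos t, sin t).

Lemma cis_plus a b : cis (a + b) = (cis a * cis b)%C.
Proof. unfold cis, Cmult; simpl. rewrite cos_plus, sin_plus. f_equal; ring. Qed.

Lemma cis_0 : cis 0 = 1%C.
Proof. unfold cis. rewrite cos_0, sin_0. reflexivity. Qed.

Lemma cis_pow t n : (cis t ^ n)%C = cis (INR n * t).
Proof.
  induction n.
  - simpl. rewrite Rmult_0_l, cis_0. reflexivity.
  - rewrite Cpow_S, IHn, S_INR, <- cis_plus. f_equal. ring.
Qed.

Lemma Cmod_cis t : Cmod (cis t) = 1.
Proof.
  unfold Cmod, cis; simpl. replace (_ + _) with (sin t ^ 2 + cos t ^ 2) by ring.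
  rewrite <- !Rsqr_pow2, sin2_cos2. apply sqrt_1.
Qed.

Lemma Cconj_cis t : Cconj (cis t) = cis (- t).
Proof. unfold cis, Cconj; simpl. now rewrite cos_neg, sin_neg. Qed.

(** Telescoping: [2 sin (h/2) cos x = sin (x + h/2) - sin (x - h/2)]. *)
Lemma cos_arith_sum phi h n :
  2 * sin (h / 2) * psum (fun j => cos (phi + INR j * h)) n =
  sin (phi + INR n * h - h / 2) - sin (phi - h / 2).
Proof.
  induction n.
  - simpl. replace (phi + 0 * h - h / 2) with (phi - h / 2) by ring. ring.
  - simpl psum. rewrite Rmult_plus_distr_l, IHn, S_INR.
    replace (phi + (INR n + 1) * h - h / 2) with ((phi + INR n * h) + h / 2) by field.
    rewrite sin_plus, (sin_minus (phi + INR n * h)). ring.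
Qed.

(** The telescoped sum vanishes because [N] steps make up a multiple of [2 PI], and [0 < m < N]
    makes the factor [sin (PI m / N)] nonzero. *)
Lemma cis_roots_sum (a : C) N m : (0 < m < N)%nat ->
  psum (fun j => Re (a * cis (INR j * (2 * PI / INR N)) ^ m)%C) N = 0.
Proof.
  intro Hm.
  assert (HN : 0 < INR N) by (apply lt_0_INR; lia).
  assert (HM : 0 < INR m < INR N) by (split; [apply lt_0_INR|apply lt_INR]; lia).
  pose proof PI_RGT_0 as Hpi.
  set (h := INR m * (2 * PI / INR N)).
  assert (Hs : 0 < sin (h / 2)).
  { replace (h / 2) with (INR m / INR N * PI) by (unfold h; field; lra).
    assert (0 < INR m / INR N) by (apply Rdiv_lt_0_compat; lra).
    assert (INR m / INR N < 1).
    { apply Rmult_lt_reg_r with (INR N); [lra|]. unfold Rdiv. rewrite Rmult_assoc, Rinv_l; lra. }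
    apply sin_gt_0; nra. }
  assert (Hz : forall phi, psum (fun j => cos (phi + INR j * h)) N = 0).
  { intro phi. apply Rmult_eq_reg_l with (2 * sin (h / 2)); [|lra].
    rewrite cos_arith_sum.
    replace (phi + INR N * h - h / 2) with ((phi - h / 2) + 2 * INR m * PI) by (unfold h; field; lra).
    rewrite sin_period. ring. }
  (* Writing [- sin] as a cosine shifted by [PI / 2] reduces both components of [a] to the same
     cosine sum. *)
  rewrite (psum_ext _ (fun j => fst a * cos (0 + INR j * h) + snd a * cos (PI / 2 + INR j * h))).
  - rewrite psum_plus, !psum_scal_l, !Hz. ring.
  - intros j _. rewrite cis_pow.
    replace (INR m * (INR j * (2 * PI / INR N))) with (INR j * h) by (unfold h; ring).
    rewrite Rplus_0_l.
    rewrite (cos_plus (PI/2)), cos_PI2, sin_PI2. unfold cis, Re, Cmult. cbn [fst snd]. ring.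
Qed.

Lemma Re_mult_Re (a b : C) : Re a * Re b = Re (a * b)%C / 2 + Re (a * Cconj b)%C / 2.
Proof. destruct a, b; unfold Re, Cconj; simpl. field. Qed.

(* The value of the average of [Re (a w^n) * Re (b / w^n)] over the unit circle. *)
Definition circle_pairing (n : nat) (a b : C) : R :=
  match n with O => Re a * Re b | _ => Re (a * b)%C / 2 end.

Lemma cis_mult_conj_pow t n m : (n <= m)%nat ->
  (cis t ^ m * Cconj (cis t) ^ n = cis t ^ (m - n))%C.
Proof.
  intro H. rewrite Cconj_cis, !cis_pow, <- cis_plus. f_equal. rewrite minus_INR by auto. ring.
Qed.

Lemma Re_conj_mult (a b : C) : Re (a * Cconj b)%C = Re (Cconj a * b)%C.
Proof. destruct a, b; unfold Re, Cconj; simpl. ring. Qed.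

(** A product of two real parts has the frequencies [m - n] and [m + n]. Since [m + n < N], neither
    is a nonzero multiple of [N], so only frequency 0 survives. For [n = 0] the two frequencies
    coincide, which is why [circle_pairing] has no factor 1/2 there. *)
Lemma roots_orthogonality (a b : C) N m n : (m + n < N)%nat ->
  psum (fun j => Re (a * cis (INR j * (2 * PI / INR N)) ^ m)%C *
                 Re (b * Cconj (cis (INR j * (2 * PI / INR N))) ^ n)%C) N =
  if Nat.eq_dec m n then INR N * circle_pairing n a b else 0.
Proof.
  intro H. destruct n as [|n].
  - rewrite (psum_ext _ (fun j => Re b * Re (a * cis (INR j * (2 * PI / INR N)) ^ m)%C)).
    2:{ intros j _. rewrite Cpow_0, Cmult_1_r. ring. }
    rewrite psum_scal_l. destruct (Nat.eq_dec m 0) as [->|Hm].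
    + rewrite (psum_ext _ (fun _ => Re a)). rewrite psum_const. simpl. ring.
      intros j _. now rewrite Cpow_0, Cmult_1_r.
    + rewrite cis_roots_sum by lia. ring.
  - set (w := fun j => cis (INR j * (2 * PI / INR N))).
    change (psum (fun j => Re (a * w j ^ m)%C * Re (b * Cconj (w j) ^ S n)%C) N =
       if Nat.eq_dec m (S n) then INR N * circle_pairing (S n) a b else 0).
    assert (E : forall j, Re (a * w j ^ m)%C * Re (b * Cconj (w j) ^ S n)%C =
       /2 * Re (a * b * (w j ^ m * Cconj (w j) ^ S n))%C + / 2 * Re (a * Cconj b * w j ^ (m + S n))%C).
    { intro j. rewrite Re_mult_Re.
      rewrite Cmult_conj, Cpow_conj, Cconj_conj, Cpow_add_r.
      unfold Rdiv. rewrite !(Rmult_comm _ (/ 2)). f_equal; f_equal; f_equal; ring. }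
    rewrite (psum_ext _ _ N (fun j _ => E j)).
    assert (Hw : forall a k, (0 < k < N)%nat -> psum (fun j => Re (a * w j ^ k)%C) N = 0)
      by exact (fun a k => cis_roots_sum a N k).
    rewrite psum_plus, !psum_scal_l.
    rewrite (Hw _ (m + S n)%nat) by lia.
    destruct (Nat.eq_dec m (S n)) as [->|Hm].
    + rewrite (psum_ext _ (fun _ => Re (a * b)%C)).
      * rewrite psum_const. simpl. field.
      * intros j _. unfold w. rewrite cis_mult_conj_pow, Nat.sub_diag by lia. now rewrite Cpow_0, Cmult_1_r.
    + destruct (Nat.lt_trichotomy m (S n)) as [Hlt|[->|Hlt]]; [|easy|].
      (* The frequency [m - n] is negative here; conjugation inside the real part makes it
         positive. *)
      * rewrite (psum_ext _ (fun j => Re (Cconj (a * b) * w j ^ (S n - m))%C)).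
        { rewrite Hw by lia. ring. }
        intros j _. rewrite <- Re_conj_mult. f_equal. f_equal.
        unfold w. rewrite <- cis_mult_conj_pow, Cmult_conj, !Cpow_conj, Cconj_conj by lia. ring.
      * rewrite (psum_ext _ (fun j => Re (a * b * w j ^ (m - S n))%C)).
        { rewrite Hw by lia. ring. }
        intros j _. unfold w. now rewrite cis_mult_conj_pow by lia.
Qed.

Lemma Series_tail_small (a : nat -> R) eps : ex_series a -> (forall n, 0 <= a n) -> 0 < eps ->
  exists M, forall m, (M <= m)%nat -> 0 <= Series a - psum a m < eps.
Proof.
  intros Ha Hp He.
  assert (H := Series_correct _ Ha).
  assert (Hmono : forall m k, psum a m <= psum a (m + k)).
  { intros m k. rewrite psum_add. assert (0 <= psum (fun j => a (m + j)%nat) k); [|lra].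
    apply psum_nonneg; auto. }
  assert (Hs : forall n, sum_n a n = psum a (S n)).
  { intro n. rewrite sum_n_Reals. symmetry. apply psum_sum_f_R0. }
  assert (Hl : is_lim_seq (fun n => psum a (S n)) (Series a)).
  { eapply is_lim_seq_ext; [intro n; apply Hs|]. exact H. }
  assert (Hup : forall m, psum a m <= Series a).
  { intro m. apply (is_lim_seq_le_loc (fun _ => psum a m) (fun n => psum a (S n)) (psum a m) (Series a)).
    - exists m. intros n Hn. replace (S n) with (m + (S n - m))%nat by lia. apply Hmono.
    - apply is_lim_seq_const.
    - exact Hl. }
  apply is_lim_seq_spec in Hl. destruct (Hl (mkposreal _ He)) as [M HM]. cbn [pos] in HM.
  exists (S M). intros m Hm. split.
  - specialize (Hup m). lra.
  - specialize (HM M (le_n _)). apply Rabs_def2 in HM.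
    assert (psum a (S M) <= psum a m); [|lra].
    replace m with (S M + (m - S M))%nat by lia. apply Hmono.
Qed.

Lemma Series_psum_split (a : nat -> R) m : ex_series a ->
  Series a - psum a m = Series (fun k => a (m + k)%nat).
Proof.
  intro H. destruct m as [|m].
  - simpl. rewrite Rminus_0_r. now apply Series_ext.
  - rewrite (Series_incr_n a (S m)) by (auto; lia). simpl pred.
    rewrite psum_sum_f_R0. ring.
Qed.

Lemma hser_tail_le c z r m : conv_disk c -> Cmod z <= r -> r < 1 ->
  Rabs (hser c z - psum (fun k => Re (c k * z ^ k)%C) m) <=
  Series (fun k => Cmod (c k) * r ^ k) - psum (fun k => Cmod (c k) * r ^ k) m.
Proof.
  intros Hc Hz Hr. pose proof (Cmod_ge_0 z) as H0.
  assert (E1 := ex_hser c z Hc ltac:(lra)).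
  assert (E2 := conv_disk_summable c r Hc ltac:(lra)).
  unfold hser. rewrite !Series_psum_split by auto.
  assert (E3 : ex_series (fun k => Cmod (c (m + k)%nat) * r ^ (m + k))).
  { now apply (ex_series_incr_n (fun k => Cmod (c k) * r ^ k)). }
  eapply Rle_trans; [apply Series_Rabs|].
  - apply (ex_series_le (K:=R_AbsRing) (V:=R_CompleteNormedModule) _ (fun k => Cmod (c (m + k)%nat) * r ^ (m + k))); auto.
    intro n. change (Rabs (Rabs (Re (c (m + n)%nat * z ^ (m + n))%C)) <= Cmod (c (m + n)%nat) * r ^ (m + n)).
    rewrite Rabs_Rabsolu. now apply Re_term_le.
  - apply Series_le; auto. intro n. split; [apply Rabs_pos|now apply Re_term_le].
Qed.

Definition circle_pt (r : R) (N j : nat) : C := (r * cis (INR j * (2 * PI / INR N)))%C.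

Lemma Cmod_circle_pt r N j : 0 <= r -> Cmod (circle_pt r N j) = r.
Proof. intro H. unfold circle_pt. rewrite Cmod_mult, Cmod_cis, Cmod_R, Rabs_pos_eq; lra. Qed.

(* The average of [hser c * trigonometric monomial] over the N-th roots of unity picks out a
   coefficient of [c], up to an aliasing error that vanishes as N grows. *)
Lemma hser_average c r n b : conv_disk c -> 0 <= r < 1 ->
  is_lim_seq (fun N => / INR (S N) * psum (fun j => hser c (circle_pt r (S N) j) *
      Re (b * Cconj (cis (INR j * (2 * PI / INR (S N)))) ^ n)%C) (S N))
   (circle_pairing n (c n * r ^ n)%C b).
Proof.
  intros Hc Hr. apply is_lim_seq_spec. intros eps.
  pose proof (cond_pos eps) as He. pose proof (Cmod_ge_0 b) as Hb0.
  assert (Ea := conv_disk_summable c r Hc Hr).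
  assert (Hpos : forall k, 0 <= Cmod (c k) * r ^ k).
  { intro k. apply Rmult_le_pos; [apply Cmod_ge_0|apply pow_le; lra]. }
  (* The tail is multiplied by test values of size at most [|b|]; the [+ 1] covers [b = 0]. *)
  assert (He' : 0 < eps / (Cmod b + 1)) by (apply Rdiv_lt_0_compat; lra).
  destruct (Series_tail_small _ _ Ea Hpos He') as [M0 HM0].
  (* The head must contain the index [n]; below, [N >= M + n] keeps every frequency of the head
     under the number of roots. *)
  set (M := S (M0 + n)). specialize (HM0 M ltac:(unfold M; lia)).
  set (T := Series (fun k => Cmod (c k) * r ^ k) - psum (fun k => Cmod (c k) * r ^ k) M) in *.
  exists (M + n)%nat. intros N HN.
  set (w := fun j => cis (INR j * (2 * PI / INR (S N)))).
  assert (HN0 : 0 < INR (S N)) by (apply lt_0_INR; lia).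
  set (u := fun j => Re (b * Cconj (w j) ^ n)%C).
  change (Rabs (/ INR (S N) * psum (fun j => hser c (circle_pt r (S N) j) * u j) (S N)
     - circle_pairing n (c n * r ^ n) b) < eps).
  assert (Hu : forall j, Rabs (u j) <= Cmod b).
  { intro j. unfold u. eapply Rle_trans; [apply re_le_Cmod|].
    rewrite Cmod_mult, Cmod_pow. unfold w. rewrite Cconj_cis, Cmod_cis, pow1. lra. }
  assert (Hfin : psum (fun j => psum (fun k => Re (c k * circle_pt r (S N) j ^ k)%C) M * u j) (S N)
     = INR (S N) * circle_pairing n (c n * r ^ n) b).
  { rewrite (psum_ext _ (fun j => psum (fun k => Re (c k * r ^ k * w j ^ k)%C * u j) M)).
    2:{ intros j _. rewrite <- psum_scal_r. apply psum_ext. intros k _. f_equal. f_equal.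
        unfold circle_pt. rewrite Cpow_mult_l. unfold w. ring. }
    rewrite psum_swap.
    rewrite (psum_ext _ (fun k => if Nat.eq_dec k n then INR (S N) * circle_pairing n (c k * r ^ k) b else 0)).
    2:{ intros k Hk. apply (roots_orthogonality (c k * r ^ k) b (S N) k n). lia. }
    rewrite (psum_single _ M n); [|unfold M; lia|].
    - destruct (Nat.eq_dec n n); easy.
    - intros j _ Hj. destruct (Nat.eq_dec j n); easy. }
  replace (/ INR (S N) * psum (fun j => hser c (circle_pt r (S N) j) * u j) (S N)
     - circle_pairing n (c n * r ^ n) b)
   with (/ INR (S N) * psum (fun j => (hser c (circle_pt r (S N) j) - psum (fun k => Re (c k * circle_pt r (S N) j ^ k)%C) M) * u j) (S N)).
  2:{ rewrite (psum_ext (fun j => (_ - _) * u j) (fun j => hser c (circle_pt r (S N) j) * u j + (-1) * (psum (fun k => Re (c k * circle_pt r (S N) j ^ k)%C) M * u j))).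
      2:{ intros; ring. }
      rewrite psum_plus, psum_scal_l, Hfin. field. lra. }
  rewrite Rabs_mult, (Rabs_pos_eq (/ _)) by (apply Rlt_le, Rinv_0_lt_compat; auto).
  apply Rle_lt_trans with (T * Cmod b).
  - apply Rmult_le_reg_l with (INR (S N)); auto.
    rewrite <- Rmult_assoc, Rinv_r, Rmult_1_l by lra.
    eapply Rle_trans; [apply psum_Rabs|].
    rewrite <- psum_const. apply psum_le. intros j _. rewrite Rabs_mult.
    apply Rmult_le_compat; auto using Rabs_pos.
    apply hser_tail_le; auto; [|lra]. rewrite Cmod_circle_pt; lra.
  - apply Rle_lt_trans with (T * (Cmod b + 1)); [nra|].
    replace (pos eps) with (eps / (Cmod b + 1) * (Cmod b + 1)) by (field; lra).
    apply Rmult_lt_compat_r; lra.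
Qed.

(** * Coefficient bounds and compactness *)

(** Estimates on circles of radius [r < 1] lose a power of [r], which continuity restores at 1. *)
Lemma continuity_le_left1 f B : continuity_pt f 1 ->
  (forall r, 0 < r < 1 -> f r <= B) -> f 1 <= B.
Proof.
  intros Hf H.
  (* The shift by 2 keeps the radius strictly between 0 and 1 already at [k = 0]. *)
  assert (Hu : is_lim_seq (fun k => 1 - / (INR k + 2)) 1).
  { replace (Finite 1) with (Finite (1 - 0)) by (f_equal; ring).
    apply is_lim_seq_minus'; [apply is_lim_seq_const|].
    assert (Hp : is_lim_seq (fun k => INR k + 2) p_infty).
    { eapply is_lim_seq_plus; [apply is_lim_seq_INR|apply is_lim_seq_const|reflexivity]. }
    apply (is_lim_seq_inv _ _ Hp). discriminate. }
  assert (Hfu := is_lim_seq_continuous f _ 1 Hf Hu).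
  apply (is_lim_seq_le (fun k => f (1 - / (INR k + 2))) (fun _ => B) (f 1) B); auto.
  - intro k. apply H. pose proof (pos_INR k).
    assert (0 < / (INR k + 2) < 1); [|lra]. split.
    + apply Rinv_0_lt_compat; lra.
    + rewrite <- Rinv_1. apply Rinv_lt_contravar; lra.
  - apply is_lim_seq_const.
Qed.

(** Testing against [Cconj (c n)] gives [r^n |c n|^2 / 2 <= B |c n|]; then [r] tends to 1 and
    [|c n|] is cancelled. *)
Lemma hser_coef_bound c B n : conv_disk c -> (forall z, Cmod z < 1 -> Rabs (hser c z) <= B) ->
  (0 < n)%nat -> Cmod (c n) <= 2 * B.
Proof.
  intros Hc HB Hn.
  assert (HB0 : 0 <= B). { eapply Rle_trans; [apply Rabs_pos|apply (HB 0)]. rewrite Cmod_0; lra. }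
  pose proof (Cmod_ge_0 (c n)) as H0.
  assert (H : forall r, 0 < r < 1 -> r ^ n * Cmod (c n) ^ 2 <= 2 * B * Cmod (c n)).
  { intros r Hr.
    assert (L := hser_average c r n (Cconj (c n)) Hc ltac:(lra)).
    replace (circle_pairing n (c n * r ^ n) (Cconj (c n))) with (r ^ n * Cmod (c n) ^ 2 / 2) in L.
    2:{ destruct n; [lia|]. unfold circle_pairing.
        rewrite Cmod2_alt, <- RtoC_pow. destruct (c (S n)) as [a b]. unfold Re, Im, Cconj, Cmult, RtoC.
        cbn [fst snd]. field. }
    assert (r ^ n * Cmod (c n) ^ 2 / 2 <= B * Cmod (c n)); [|lra].
    change (Rbar_le (r ^ n * Cmod (c n) ^ 2 / 2) (B * Cmod (c n))).
    refine (is_lim_seq_le _ (fun _ => B * Cmod (c n)) _ _ _ L (is_lim_seq_const _)).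
    intro N. assert (HN : 0 < INR (S N)) by (apply lt_0_INR; lia).
    apply Rmult_le_reg_l with (INR (S N)); auto.
    rewrite <- Rmult_assoc, Rinv_r, Rmult_1_l by lra.
    rewrite <- psum_const. apply psum_le. intros j _.
    eapply Rle_trans; [apply Rle_abs|]. rewrite Rabs_mult.
    apply Rmult_le_compat; auto using Rabs_pos.
    - apply HB. rewrite Cmod_circle_pt; lra.
    - eapply Rle_trans; [apply re_le_Cmod|].
      rewrite Cmod_mult, Cmod_pow, Cconj_cis, Cmod_cis, pow1, Cmod_conj. lra. }
  assert (H1 : 1 ^ n * Cmod (c n) ^ 2 <= 2 * B * Cmod (c n)).
  { apply (continuity_le_left1 (fun r => r ^ n * Cmod (c n) ^ 2)); auto.
    apply continuity_pt_mult; [apply derivable_continuous_pt, derivable_pt_pow|].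
    apply continuity_pt_const. now intros ? ?. }
  rewrite pow1 in H1. destruct (Rle_lt_dec (Cmod (c n)) (2 * B)); auto. nra.
Qed.

Lemma conv_disk_bounded c B : (forall n, Cmod (c n) <= B) -> conv_disk c.
Proof.
  intro H. apply (CV_radius_bounded (fun n => Cmod (c n))).
  exists B. intro n. rewrite pow1, Rmult_1_r, Rabs_pos_eq; auto. apply Cmod_ge_0.
Qed.

Lemma Series_geom_psum r m : 0 <= r < 1 -> Series (fun k => r ^ k) - psum (fun k => r ^ k) m = r ^ m / (1 - r).
Proof.
  intro Hr. rewrite Series_geom by (rewrite Rabs_pos_eq; lra).
  induction m; simpl.
  - field; lra.
  - unfold Rminus. rewrite Ropp_plus_distr, <- Rplus_assoc.
    unfold Rminus in IHm. rewrite IHm. field; lra.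
Qed.

(** The estimate depends on [c] only through [B], so it is uniform along a sequence of maps. *)
Lemma hser_tail_bounded c z B r m : (forall n, Cmod (c n) <= B) -> Cmod z <= r -> r < 1 ->
  Rabs (hser c z - psum (fun k => Re (c k * z ^ k)%C) m) <= B * (r ^ m / (1 - r)).
Proof.
  intros HB Hz Hr. pose proof (Cmod_ge_0 z) as H0.
  assert (Hc := conv_disk_bounded _ _ HB).
  eapply Rle_trans; [apply (hser_tail_le c z r); auto|].
  assert (G : ex_series (fun k => r ^ k)).
  { exists (/ (1 - r)). apply is_series_geom. rewrite Rabs_pos_eq; lra. }
  rewrite <- Series_geom_psum by lra.
  rewrite !Series_psum_split; auto; [|apply conv_disk_summable; auto; lra].
  rewrite <- Series_scal_l. apply Series_le.
  - intro n. split.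
    + apply Rmult_le_pos; [apply Cmod_ge_0|apply pow_le; lra].
    + apply Rmult_le_compat_r; auto. apply pow_le; lra.
  - apply ex_series_ext with (fun k => r ^ (m + k) * B); [intro; apply Rmult_comm|].
    apply ex_series_scal_r. now apply (ex_series_incr_n (fun k => r ^ k)).
Qed.

Definition coef_lim (c : nat -> nat -> C) (l : nat -> C) : Prop := forall n,
  is_lim_seq (fun k => Re (c k n)) (Re (l n)) /\ is_lim_seq (fun k => Im (c k n)) (Im (l n)).

Lemma is_lim_seq_psum (f : nat -> nat -> R) (l : nat -> R) m :
  (forall n, is_lim_seq (fun k => f k n) (l n)) -> is_lim_seq (fun k => psum (f k) m) (psum l m).
Proof.
  intro H. induction m; simpl; [apply is_lim_seq_const|]. now apply is_lim_seq_plus'.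
Qed.

Lemma is_lim_seq_Cmod (a : nat -> C) (l : C) :
  is_lim_seq (fun k => Re (a k)) (Re l) -> is_lim_seq (fun k => Im (a k)) (Im l) ->
  is_lim_seq (fun k => Cmod (a k)) (Cmod l).
Proof.
  intros H1 H2. unfold Cmod.
  apply (is_lim_seq_continuous sqrt (fun k => fst (a k) ^ 2 + snd (a k) ^ 2)).
  - apply continuity_pt_sqrt. pose proof (pow2_ge_0 (fst l)). pose proof (pow2_ge_0 (snd l)). lra.
  - simpl. apply is_lim_seq_plus'; apply is_lim_seq_mult'; auto; apply is_lim_seq_mult'; auto; apply is_lim_seq_const.
Qed.

(** Two tails, uniformly small by the common bound, and a finite head that converges term by term
    each receive a third of [eps]. *)
Lemma hser_lim c l B z : coef_lim c l -> (forall k n, Cmod (c k n) <= B) -> Cmod z < 1 ->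
  (forall n, Cmod (l n) <= B) /\ is_lim_seq (fun k => hser (c k) z) (hser l z).
Proof.
  intros Hl HB Hz. pose proof (Cmod_ge_0 z) as H0.
  assert (HBl : forall n, Cmod (l n) <= B).
  { intro n. destruct (Hl n) as [L1 L2].
    apply (is_lim_seq_le (fun k => Cmod (c k n)) (fun _ => B) (Cmod (l n)) B); auto.
    - now apply is_lim_seq_Cmod.
    - apply is_lim_seq_const. }
  split; auto.
  set (r := Cmod z) in *.
  apply is_lim_seq_spec. intro eps. pose proof (cond_pos eps) as He.
  assert (HB0 : 0 <= B) by (eapply Rle_trans; [apply Cmod_ge_0|apply (HBl O)]).
  assert (Htail : exists M, B * (r ^ M / (1 - r)) < eps / 3).
  { destruct (pow_lt_1_zero r ltac:(rewrite Rabs_pos_eq; lra) (eps / 3 * (1 - r) / (B + 1))) as [M HM].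
    - apply Rdiv_lt_0_compat; [|lra]. apply Rmult_lt_0_compat; lra.
    - exists M. specialize (HM M (le_n _)). rewrite Rabs_pos_eq in HM by (apply pow_le; lra).
      assert (0 <= r ^ M) by (apply pow_le; lra).
      apply Rmult_lt_reg_r with (1 - r); [lra|].
      replace (B * (r ^ M / (1 - r)) * (1 - r)) with (B * r ^ M) by (field; lra).
      apply Rle_lt_trans with ((B + 1) * r ^ M); [nra|].
      replace (eps / 3 * (1 - r)) with ((B + 1) * (eps / 3 * (1 - r) / (B + 1))) by (field; lra).
      apply Rmult_lt_compat_l; lra. }
  destruct Htail as [M HM].
  assert (L : is_lim_seq (fun k => psum (fun n => Re (c k n * z ^ n)%C) M) (psum (fun n => Re (l n * z ^ n)%C) M)).
  { apply (is_lim_seq_psum (fun k n => Re (c k n * z ^ n)%C)). intro n. destruct (Hl n) as [L1 L2].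
    rewrite re_mult. eapply is_lim_seq_ext; [intro k; symmetry; apply re_mult|].
    apply is_lim_seq_minus'; apply is_lim_seq_mult'; auto; apply is_lim_seq_const. }
  apply is_lim_seq_spec in L. destruct (L (mkposreal (eps / 3) ltac:(lra))) as [N HN].
  exists N. intros k Hk. specialize (HN k Hk). cbn [pos] in HN.
  assert (T1 := hser_tail_bounded (c k) z B r M (HB k) (Rle_refl _) Hz).
  assert (T2 := hser_tail_bounded l z B r M HBl (Rle_refl _) Hz).
  revert HN T1 T2. unfold Rabs. repeat destruct Rcase_abs; intros; lra.
Qed.

(* Diagonal extraction, one coordinate at a time: [good x N l] says that the first [N]
   coordinates of [l] are simultaneously approached along arbitrarily late indices. *)
Definition good (x : nat -> nat -> R) (N : nat) (l : nat -> R) : Prop :=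
  forall eps I, 0 < eps -> exists i, (I <= i)%nat /\ forall n, (n < N)%nat -> Rabs (x i n - l n) < eps.

Lemma good_ext x N l l' : (forall n, (n < N)%nat -> l n = l' n) -> good x N l -> good x N l'.
Proof.
  intros H G eps I He. destruct (G eps I He) as [i [Hi Hn]]. exists i; split; auto.
  intros n Hlt. rewrite <- H by auto. auto.
Qed.

(** Choose indices along which the first [N] coordinates approach [l], and let [v] be the upper
    limit of coordinate [N] along them: values above [v - eps] recur infinitely often, values above
    [v + eps] eventually stop. *)
Lemma good_step x N l B : (forall i, Rabs (x i N) <= B) -> good x N l ->
  exists v, good x (S N) (fun n => if Nat.eq_dec n N then v else l n).
Proof.
  intros HB G.
  assert (Hch : forall k, exists i, (k <= i)%nat /\ forall n, (n < N)%nat -> Rabs (x i n - l n) < / (INR k + 1)).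
  { intro k. apply G. apply Rinv_0_lt_compat. pose proof (pos_INR k). lra. }
  set (phi := fun k => proj1_sig (constructive_indefinite_description _ (Hch k))).
  assert (Hphi : forall k, (k <= phi k)%nat /\ forall n, (n < N)%nat -> Rabs (x (phi k) n - l n) < / (INR k + 1)).
  { intro k. exact (proj2_sig (constructive_indefinite_description _ (Hch k))). }
  set (y := fun k => x (phi k) N).
  destruct (ex_LimSup_seq y) as [v Hv].
  assert (Hfin : exists v', v = Finite v').
  { destruct v as [v'| |]; [eauto| |]; exfalso.
    - destruct (Hv B 0%nat) as [k [_ Hk]]. specialize (HB (phi k)). apply Rabs_le_between in HB. unfold y in Hk. lra.
    - destruct (Hv (- B)) as [k0 Hk]. specialize (Hk k0 (le_n _)). specialize (HB (phi k0)). apply Rabs_le_between in HB. unfold y in Hk. lra. }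
  destruct Hfin as [v' ->]. exists v'. intros eps I He.
  destruct (Hv (mkposreal _ He)) as [H1 [K0 H2]]. cbn [pos] in H1, H2.
  destruct (nfloor_ex (/ eps)) as [K1 HK1]; [apply Rlt_le, Rinv_0_lt_compat; auto|].
  (* One index beyond [I], beyond the point where the upper estimate holds, and with
     [1 / (k + 1) < eps]. *)
  destruct (H1 (I + K0 + K1)%nat) as [k [Hk Hlow]]. specialize (H2 k ltac:(lia)).
  exists (phi k). destruct (Hphi k) as [Hp Hn]. split; [lia|].
  intros n Hlt. destruct (Nat.eq_dec n N) as [->|Hne].
  - change (x (phi k) N) with (y k). apply Rabs_def1; lra.
  - eapply Rlt_trans; [apply Hn; lia|].
    assert (INR K1 <= INR k) by (apply le_INR; lia).
    rewrite <- (Rinv_inv eps). apply Rinv_lt_contravar; [|lra].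
    pose proof (Rinv_0_lt_compat _ He). pose proof (pos_INR k). apply Rmult_lt_0_compat; lra.
Qed.

(** Coordinate [n] is fixed at stage [n + 1] and never changed afterwards, so the stages glue to one
    [l]; then [phi k] is chosen to be within [1 / (k + 1)] of [l] on the first [k] coordinates. The
    condition [k <= phi k] replaces monotonicity: it suffices for passing limits along [phi]. *)
Lemma diagonal_extraction (x : nat -> nat -> R) (B : nat -> R) :
  (forall i n, Rabs (x i n) <= B n) ->
  exists (phi : nat -> nat) (l : nat -> R), (forall k, (k <= phi k)%nat) /\
    forall n, is_lim_seq (fun k => x (phi k) n) (l n).
Proof.
  intro HB.
  assert (Hstep : forall N (s : {l | good x N l}), exists v,
     good x (S N) (fun n => if Nat.eq_dec n N then v else proj1_sig s n)).
  { intros N [l Hl]. apply (good_step x N l (B N)); auto. }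
  assert (H0 : good x 0 (fun _ => 0)).
  { intros eps I _. exists I. split; auto. intros n Hn. lia. }
  set (F := fix F (N : nat) : {l | good x N l} :=
    match N with
    | O => exist _ _ H0
    | S N' => let s := F N' in
       let v := constructive_indefinite_description _ (Hstep N' s) in
       exist (good x (S N')) _ (proj2_sig v)
    end).
  set (L := fun N => proj1_sig (F N)).
  assert (HL : forall N n, n <> N -> L (S N) n = L N n).
  { intros N n Hn. unfold L. simpl. destruct (Nat.eq_dec n N); easy. }
  assert (Hst : forall N n, (n < N)%nat -> L N n = L (S n) n).
  { induction N; intros n Hn; [lia|]. destruct (Nat.eq_dec n N) as [->|Hne]; auto.
    rewrite HL by auto. apply IHN; lia. }
  set (l := fun n => L (S n) n).
  assert (Hl : forall N, good x N l).
  { intro N. apply good_ext with (L N). { intros n Hn. now apply Hst. } exact (proj2_sig (F N)). }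
  assert (Hch : forall k, exists i, (k <= i)%nat /\ forall n, (n < k)%nat -> Rabs (x i n - l n) < / (INR k + 1)).
  { intro k. apply Hl. apply Rinv_0_lt_compat. pose proof (pos_INR k). lra. }
  set (phi := fun k => proj1_sig (constructive_indefinite_description _ (Hch k))).
  assert (Hphi : forall k, (k <= phi k)%nat /\ forall n, (n < k)%nat -> Rabs (x (phi k) n - l n) < / (INR k + 1)).
  { intro k. exact (proj2_sig (constructive_indefinite_description _ (Hch k))). }
  exists phi, l. split; [intro k; apply Hphi|].
  intro n. apply is_lim_seq_spec. intros eps.
  destruct (nfloor_ex (/ eps)) as [K1 HK1]; [apply Rlt_le, Rinv_0_lt_compat, cond_pos|].
  exists (S (n + K1))%nat. intros k Hk. destruct (Hphi k) as [_ Hn].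
  eapply Rlt_trans; [apply Hn; lia|].
  assert (INR K1 <= INR k) by (apply le_INR; lia).
  rewrite <- (Rinv_inv eps). pose proof (cond_pos eps) as He. apply Rinv_lt_contravar; [|lra].
  pose proof (Rinv_0_lt_compat _ He). pose proof (pos_INR k). apply Rmult_lt_0_compat; lra.
Qed.

Lemma coef_diagonal (c d : nat -> nat -> C) B :
  (forall k n, Cmod (c k n) <= B) -> (forall k n, Cmod (d k n) <= B) ->
  exists phi lc ld, (forall k, (k <= phi k)%nat) /\
    coef_lim (fun k => c (phi k)) lc /\ coef_lim (fun k => d (phi k)) ld.
Proof.
  intros Hc Hd.
  (* The four real coordinates of [c n] and [d n] are interleaved modulo 4, so that one subsequence
     serves them all. *)
  set (x := fun i m => let n := (m / 4)%nat in
    match (m mod 4)%nat with O => Re (c i n) | 1%nat => Im (c i n) | 2%nat => Re (d i n) | _ => Im (d i n) end).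
  assert (HIm : forall z, Rabs (Im z) <= Cmod z).
  { intros z. eapply Rle_trans; [apply Rmax_r|apply (Rmax_Cmod z)]. }
  destruct (diagonal_extraction x (fun _ => B)) as [phi [l [Hphi Hl]]].
  { intros i m. unfold x. cbv zeta.
    destruct (m mod 4)%nat as [|[|[|?]]]; eapply Rle_trans; eauto using re_le_Cmod. }
  assert (Hx : forall n r, (r < 4)%nat -> is_lim_seq (fun k => match r with O => Re (c (phi k) n) | 1%nat => Im (c (phi k) n)
     | 2%nat => Re (d (phi k) n) | _ => Im (d (phi k) n) end) (l (4 * n + r)%nat)).
  { intros n r Hr. eapply is_lim_seq_ext; [|apply Hl]. intro k. unfold x. cbv zeta.
    replace ((4 * n + r) / 4)%nat with n by (apply Nat.div_unique with r; lia).
    replace ((4 * n + r) mod 4)%nat with r by (apply Nat.mod_unique with n; lia). reflexivity. }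
  exists phi, (fun n => (l (4 * n + 0)%nat, l (4 * n + 1)%nat)), (fun n => (l (4 * n + 2)%nat, l (4 * n + 3)%nat)).
  split; auto. split; intro n; split.
  - exact (Hx n 0%nat ltac:(lia)).
  - exact (Hx n 1%nat ltac:(lia)).
  - exact (Hx n 2%nat ltac:(lia)).
  - exact (Hx n 3%nat ltac:(lia)).
Qed.

(** * Truncated Poisson kernel and Harnack's inequality *)

Lemma convex_combination (D : C -> Prop) (l : nat -> R) (f : nat -> C) N : convex_set D ->
  (forall j, (j < N)%nat -> 0 <= l j) -> (forall j, (j < N)%nat -> D (f j)) -> 0 < psum l N ->
  D (psum (fun j => l j * fst (f j)) N / psum l N, psum (fun j => l j * snd (f j)) N / psum l N).
Proof.
  intros HD. induction N; intros Hl Hf Hs; [simpl in Hs; lra|].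
  assert (Hp : 0 <= psum l N) by (apply psum_nonneg; auto).
  assert (Hj := Hl N ltac:(lia)).
  simpl in Hs |- *. destruct (Rle_lt_or_eq_dec 0 (psum l N) Hp) as [Hlt|Heq].
  - assert (H := HD _ _ (psum l N / (psum l N + l N)) (IHN ltac:(auto) ltac:(auto) Hlt) (Hf N ltac:(lia))).
    simpl in H.
    match type of H with _ -> D ?a => match goal with |- D ?b => replace b with a; [apply H|] end end.
    + split.
      * apply Rmult_le_pos; [lra|]. apply Rlt_le, Rinv_0_lt_compat; lra.
      * apply Rmult_le_reg_r with (psum l N + l N); [lra|]. unfold Rdiv. rewrite Rmult_assoc, Rinv_l; lra.
    + f_equal; field; lra.
  (* All earlier weights vanish, and the combination is the last point alone. *)
  - assert (Hz : forall g : nat -> R, psum (fun j => l j * g j) N = 0).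
    { intro g. assert (Hz : forall j, (j < N)%nat -> l j = 0).
      { assert (X : forall n, (n <= N)%nat -> psum l n = 0).
        { intros n Hn. assert (0 <= psum l n) by (apply psum_nonneg; intros; apply Hl; lia).
          replace N with (n + (N - n))%nat in Heq by lia. rewrite psum_add in Heq.
          assert (0 <= psum (fun j => l (n + j)%nat) (N - n)) by (apply psum_nonneg; intros; apply Hl; lia).
          lra. }
        intros j Hlt. pose proof (X j ltac:(lia)). pose proof (X (S j) ltac:(lia)) as H2. simpl in H2. lra. }
      rewrite (psum_ext _ (fun _ => 0)); [rewrite psum_const; ring|].
      intros j Hlt. rewrite Hz by auto. ring. }
    rewrite <- Heq in *. rewrite !Hz.
    replace ((0 + l N * fst (f N)) / (0 + l N), (0 + l N * snd (f N)) / (0 + l N)) with (f N).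
    + apply Hf; lia.
    + rewrite (surjective_pairing (f N)) at 1. f_equal; field; lra.
Qed.

(** A partial sum of the Poisson kernel [Re ((1 + z) / (1 - z))]. It is truncated because the N-th
    roots of unity separate only finitely many frequencies. *)
Definition poisson_trunc (K : nat) (z : C) : R := 1 + 2 * psum (fun n => Re (z ^ S n)%C) K.

(** The finite form of [P(z) |1 - z|^2 = 1 - |z|^2], with the remainder of the geometric sum kept
    explicitly. *)
Lemma poisson_trunc_identity K (z : C) :
  poisson_trunc K z * Cmod (1 - z)%C ^ 2 = 1 - Cmod z ^ 2 - 2 * Re (z ^ S K * (1 - Cconj z))%C.
Proof.
  unfold poisson_trunc. rewrite !Cmod2_alt. induction K.
  - simpl psum. rewrite Cpow_1_r. destruct z as [a b]. unfold Re, Im, Cconj, Cminus, Cplus, Copp, Cmult, RtoC.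
    cbn [fst snd]. ring.
  - cbn [psum]. set (A := psum _ K) in *.
    replace (1 + 2 * (A + Re (z ^ S K)%C)) with (1 + 2 * A + 2 * Re (z ^ S K)%C) by ring.
    rewrite Rmult_plus_distr_r, IHK.
    rewrite (Cpow_S z (S K)). generalize (z ^ S K)%C. intros [e f].
    destruct z as [a b]. unfold Re, Im, Cconj, Cminus, Cplus, Copp, Cmult, RtoC.
    cbn [fst snd]. ring.
Qed.

(** As [|1 - z| <= 1 + q], the full kernel is at least [(1 - q) / (1 + q)]. Half of that is given up
    to absorb the truncation, whose error term is at most [4 q ^ S K]. *)
Lemma poisson_trunc_lower K z q : Cmod z = q -> q < 1 -> 4 * q ^ S K <= (1 - q ^ 2) / 2 ->
  (1 - q) / (2 * (1 + q)) <= poisson_trunc K z.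
Proof.
  intros Hz Hq HK. pose proof (Cmod_ge_0 z) as H0. rewrite Hz in H0.
  assert (Hup : Cmod (1 - z)%C <= 1 + q).
  { eapply Rle_trans; [apply Cmod_triangle|]. rewrite Cmod_opp, Cmod_1, Hz. lra. }
  assert (Hlow : 1 - q <= Cmod (1 - z)%C).
  { pose proof (Cmod_triangle (1 - z)%C z) as H. replace (1 - z + z)%C with (RtoC 1) in H by ring.
    rewrite Cmod_1, Hz in H. lra. }
  assert (Hre : Re (z ^ S K * (1 - Cconj z))%C <= q ^ S K * 2).
  { eapply Rle_trans; [apply Rle_abs|]. eapply Rle_trans; [apply re_le_Cmod|].
    rewrite Cmod_mult, Cmod_pow, Hz. apply Rmult_le_compat_l; [apply pow_le; lra|].
    eapply Rle_trans; [apply Cmod_triangle|]. rewrite Cmod_opp, Cmod_conj, Cmod_1, Hz. lra. }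
  pose proof (poisson_trunc_identity K z) as Hid. rewrite Hz in Hid.
  set (X := Cmod (1 - z)%C) in *. set (P := poisson_trunc K z) in *.
  assert (HP : (1 - q ^ 2) / 2 <= P * X ^ 2) by lra.
  apply Rnot_lt_le. intro Hc.
  assert (Hd : 0 < (1 - q) / (2 * (1 + q))) by (apply Rdiv_lt_0_compat; lra).
  assert (H1 : P * X ^ 2 < (1 - q) / (2 * (1 + q)) * X ^ 2) by (apply Rmult_lt_compat_r; [apply pow_lt; lra|auto]).
  assert (H2 : (1 - q) / (2 * (1 + q)) * X ^ 2 <= (1 - q) / (2 * (1 + q)) * (1 + q) ^ 2).
  { apply Rmult_le_compat_l; [lra|]. apply pow_incr. lra. }
  replace ((1 - q) / (2 * (1 + q)) * (1 + q) ^ 2) with ((1 - q ^ 2) / 2) in H2 by (field; lra).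
  lra.
Qed.

(** The kernel reproduces the partial sum at [r b]: its coefficients 2 compensate for the 1/2 of
    [circle_pairing] at positive frequencies, its constant term 1 handles frequency 0. *)
Lemma hser_poisson_average c r K b : conv_disk c -> 0 <= r < 1 ->
  is_lim_seq (fun N => / INR (S N) * psum (fun j => hser c (circle_pt r (S N) j) *
      poisson_trunc K (b * Cconj (cis (INR j * (2 * PI / INR (S N)))))%C) (S N))
   (psum (fun n => Re (c n * (r * b) ^ n)%C) (S K)).
Proof.
  intros Hc Hr.
  assert (L0 := hser_average c r 0 1 Hc Hr).
  assert (L1 := fun n => hser_average c r (S n) (b ^ S n)%C Hc Hr).
  assert (L2 := is_lim_seq_psum _ _ K L1).
  apply (is_lim_seq_scal_l _ 2) in L2.
  assert (L3 := is_lim_seq_plus' _ _ _ _ L0 L2).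
  replace (psum (fun n => Re (c n * (r * b) ^ n)%C) (S K)) with
   (circle_pairing 0 (c 0%nat * r ^ 0) 1 + 2 * psum (fun n => circle_pairing (S n) (c (S n) * r ^ S n) (b ^ S n)%C) K).
  - eapply is_lim_seq_ext; [|exact L3].
    intro N. cbv beta. rewrite psum_scal_l. rewrite psum_swap.
    match goal with |- ?iv * ?a + 2 * (?iv * ?b) = _ =>
      replace (iv * a + 2 * (iv * b)) with (iv * (a + b * 2)) by ring end. f_equal.
    rewrite <- psum_scal_r, <- psum_plus. apply psum_ext. intros j _.
    rewrite psum_scal_l, Cpow_0, Cmult_1_r. unfold poisson_trunc.
    rewrite (psum_ext (fun n => Re (b ^ S n * _)%C) (fun n => Re ((b * Cconj (cis (INR j * (2 * PI / INR (S N))))) ^ S n)%C)).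
    + change (Re 1) with 1. ring.
    + intros n _. now rewrite Cpow_mult_l.
  - rewrite (psum_add _ 1 K : psum _ (S K) = _). f_equal.
    + unfold circle_pairing, Re. simpl. ring.
    + rewrite <- psum_scal_l. apply psum_ext. intros n _. unfold circle_pairing. cbn [Nat.add].
      rewrite Cpow_mult_l. rewrite <- Cmult_assoc. field.
Qed.

Lemma poisson_trunc_mean N K b : (K < N)%nat ->
  psum (fun j => poisson_trunc K (b * Cconj (cis (INR j * (2 * PI / INR N))))%C) N = INR N.
Proof.
  intro H. unfold poisson_trunc.
  rewrite psum_plus, psum_const, psum_scal_l, psum_swap.
  rewrite (psum_ext _ (fun _ => 0)); [rewrite psum_const; ring|].
  intros n Hn.
  assert (O := roots_orthogonality 1 (b ^ S n)%C N 0 (S n) ltac:(lia)). simpl Nat.eq_dec in O. 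
  rewrite <- O. apply psum_ext. intros j _. rewrite Cpow_mult_l, Cpow_0, Cmult_1_l.
  change (Re 1) with 1. ring.
Qed.

(* Harnack: the value at z0 is a convex combination, with a weight on the value at 0 that does
   not depend on the map, of the value at 0 and (up to eps) a point of [D]. *)
Lemma hmap_harnack (D : C -> Prop) z0 : convex_set D -> Cmod z0 < 1 ->
  exists delta, 0 < delta < 1 /\ forall c d, conv_disk c -> conv_disk d ->
   (forall z, Cmod z < 1 -> D (hmap c d z)) -> forall eps, 0 < eps ->
   exists w, D w /\ Cmod (hmap c d z0 - (delta * hmap c d 0 + (1 - delta) * w))%C < eps.
Proof.
  intros HD Hz0. pose proof (Cmod_ge_0 z0) as H0.
  (* Values are sampled on a circle strictly between [z0] and the unit circle; [q] is then the
     relative radius of [z0], and [delta] half the classical Harnack constant. *)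
  set (r := (1 + Cmod z0) / 2). assert (Hr : 0 < r < 1) by (unfold r; lra).
  assert (Hr0 : Cmod z0 < r) by (unfold r; lra).
  set (q := Cmod z0 / r).
  assert (Hq : 0 <= q < 1).
  { unfold q. split. apply Rmult_le_pos; [lra|apply Rlt_le, Rinv_0_lt_compat; lra].
    apply Rmult_lt_reg_r with r; [lra|]. unfold Rdiv. rewrite Rmult_assoc, Rinv_l; lra. }
  set (delta := (1 - q) / (2 * (1 + q))).
  assert (Hd : 0 < delta < 1).
  { unfold delta. split. apply Rdiv_lt_0_compat; lra.
    apply Rmult_lt_reg_r with (2 * (1 + q)); [lra|]. unfold Rdiv. rewrite Rmult_assoc, Rinv_l; lra. }
  exists delta. split; auto. intros c d Hc Hdd HDm eps He.
  set (b := (z0 / r)%C).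
  assert (Hrb : (r * b = z0)%C). { unfold b. field. intro E; apply RtoC_inj in E; lra. }
  assert (Hb : Cmod b = q).
  { unfold b, Cdiv. rewrite Cmod_mult, Cmod_inv, Cmod_R, Rabs_pos_eq; [reflexivity|lra|].
    intro E; apply RtoC_inj in E; lra. }
  assert (Htail : forall c, conv_disk c -> exists K0, forall K, (K0 <= K)%nat ->
     Rabs (hser c z0 - psum (fun n => Re (c n * z0 ^ n)%C) (S K)) < eps / 4).
  { intros c' Hc'. assert (Ea := conv_disk_summable c' (Cmod z0) Hc' ltac:(lra)).
    destruct (Series_tail_small _ (eps / 4) Ea) as [M HM]; [|lra|].
    { intro k. apply Rmult_le_pos; [apply Cmod_ge_0|apply pow_le; lra]. }
    exists M. intros K HK. eapply Rle_lt_trans; [apply (hser_tail_le c' z0 (Cmod z0)); auto; lra|].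
    apply HM. lia. }
  destruct (Htail c Hc) as [K1 HK1]. destruct (Htail d Hdd) as [K2 HK2].
  destruct (pow_lt_1_zero q ltac:(rewrite Rabs_pos_eq; lra) ((1 - q ^ 2) / 8)) as [K3 HK3]; [nra|].
  set (K := (K1 + K2 + K3)%nat). specialize (HK1 K ltac:(unfold K; lia)). specialize (HK2 K ltac:(unfold K; lia)).
  assert (HK : 4 * q ^ S K <= (1 - q ^ 2) / 2).
  { specialize (HK3 (S K) ltac:(unfold K; lia)). rewrite Rabs_pos_eq in HK3 by (apply pow_le; lra). lra. }
  (* Lowering the kernel by [delta] leaves nonnegative weights and splits off [delta] times the mean
     over the circle, which is the value at 0. *)
  set (lam := fun N j => poisson_trunc K (b * Cconj (cis (INR j * (2 * PI / INR (S N)))))%C - delta).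
  assert (Hlam : forall N j, 0 <= lam N j).
  { intros N j. unfold lam. assert (X := poisson_trunc_lower K (b * Cconj (cis (INR j * (2 * PI / INR (S N)))))%C q).
    rewrite Cmod_mult, Cconj_cis, Cmod_cis, Hb, Rmult_1_r in X. specialize (X eq_refl ltac:(lra) HK).
    rewrite Cconj_cis. fold delta in X. lra. }
  assert (Hlim : forall c, conv_disk c -> is_lim_seq (fun N => / INR (S N) * psum (fun j => lam N j * hser c (circle_pt r (S N) j)) (S N))
     (psum (fun n => Re (c n * z0 ^ n)%C) (S K) - delta * hser c 0)).
  { intros c' Hc'.
    assert (L1 := hser_poisson_average c' r K b Hc' ltac:(lra)). rewrite Hrb in L1.
    assert (L2 := hser_average c' r 0 1 Hc' ltac:(lra)).
    apply (is_lim_seq_scal_l _ delta) in L2.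
    assert (L3 := is_lim_seq_minus' _ _ _ _ L1 L2).
    replace (circle_pairing 0 (c' 0%nat * r ^ 0) 1) with (hser c' 0) in L3.
    2:{ rewrite hser_0. unfold circle_pairing. rewrite Cpow_0, !Cmult_1_r. change (Re 1) with 1. ring. }
    eapply is_lim_seq_ext; [|exact L3]. intro N. cbv beta.
    rewrite <- Rmult_assoc, (Rmult_comm delta), Rmult_assoc, <- Rmult_minus_distr_l. f_equal.
    rewrite <- psum_scal_l. unfold Rminus.
    replace (- psum (fun j => delta * _) (S N)) with (psum (fun j => - 1 * (delta * (hser c' (circle_pt r (S N) j) * Re (1 * Cconj (cis (INR j * (2 * PI / INR (S N)))) ^ 0)%C))) (S N)) by (rewrite psum_scal_l; ring).
    rewrite ?Rmult_1_l. rewrite <- psum_plus. apply psum_ext. intros j _. unfold lam.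
    rewrite Cpow_0, Cmult_1_r. change (Re 1) with 1. ring. }
  assert (L1 := Hlim c Hc). assert (L2 := Hlim d Hdd).
  apply is_lim_seq_spec in L1. apply is_lim_seq_spec in L2.
  destruct (L1 (mkposreal (eps / 4) ltac:(lra))) as [N1 HN1]. destruct (L2 (mkposreal (eps / 4) ltac:(lra))) as [N2 HN2].
  set (N := (N1 + N2 + K)%nat).
  specialize (HN1 N ltac:(unfold N; lia)). specialize (HN2 N ltac:(unfold N; lia)). cbn [pos] in HN1, HN2.
  assert (HN0 : 0 < INR (S N)) by (apply lt_0_INR; lia).
  assert (Hsum : psum (lam N) (S N) = INR (S N) * (1 - delta)).
  { unfold lam. rewrite (psum_ext _ (fun j => poisson_trunc K (b * Cconj (cis (INR j * (2 * PI / INR (S N)))))%C + - delta)) by (intros; ring).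
    rewrite psum_plus, psum_const, poisson_trunc_mean by (unfold N; lia). ring. }
  (* The witness is the mean of sampled values of the map with weights [lam], whose total is
     [1 - delta] per root. *)
  exists (psum (fun j => lam N j * hser c (circle_pt r (S N) j)) (S N) / psum (lam N) (S N),
          psum (fun j => lam N j * hser d (circle_pt r (S N) j)) (S N) / psum (lam N) (S N)).
  split.
  - apply (convex_combination D (lam N) (fun j => hmap c d (circle_pt r (S N) j)) (S N)); auto.
    + intros j _. apply HDm. rewrite Cmod_circle_pt; lra.
    + rewrite Hsum. apply Rmult_lt_0_compat; lra.
  - rewrite Hsum.
    set (P1 := psum _ (S N)) in *. set (P2 := psum (fun j => lam N j * hser d _) (S N)) in *.
    eapply Rle_lt_trans; [apply Cmod_le_2max|].
    replace eps with (2 * (eps / 2)) by field. apply Rmult_lt_compat_l; [lra|].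
    unfold hmap, Cminus, Cplus, Copp, Cmult, RtoC. cbn [fst snd].
    apply Rmax_lub_lt.
    + replace (hser c z0 + - (delta * hser c (0, 0) - 0 * hser d (0, 0) + ((1 + - delta) * (P1 / (INR (S N) * (1 - delta))) - (0 + - 0) * (P2 / (INR (S N) * (1 - delta))))))
       with (hser c z0 - delta * hser c (0,0) - / INR (S N) * P1) by (field; lra).
      change (0,0) with (RtoC 0).
      revert HN1 HK1. unfold Rabs. repeat destruct Rcase_abs; intros; lra.
    + replace (hser d z0 + - (delta * hser d (0, 0) + 0 * hser c (0, 0) + ((1 + - delta) * (P2 / (INR (S N) * (1 - delta))) + (0 + - 0) * (P1 / (INR (S N) * (1 - delta))))))
       with (hser d z0 - delta * hser d (0,0) - / INR (S N) * P2) by (field; lra).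
      change (0,0) with (RtoC 0).
      revert HN2 HK2. unfold Rabs. repeat destruct Rcase_abs; intros; lra.
Qed.

(** The error is moved onto [p]: [x = delta p' + (1 - delta) w] exactly, where [p'] differs from [p]
    by the error divided by [delta]. Hence the tolerance [e * delta]. *)
Lemma convex_open_absorb (D : C -> Prop) (p x : C) delta : Defs.open_set D -> convex_set D -> D p -> 0 < delta < 1 ->
  (forall eps, 0 < eps -> exists w, D w /\ Cmod (x - (delta * p + (1 - delta) * w))%C < eps) -> D x.
Proof.
  intros HO HC Hp Hd H. destruct (HO p Hp) as [e [He HDe]].
  destruct (H (e * delta)) as [w [Hw Hlt]]; [apply Rmult_lt_0_compat; lra|].
  set (p' := (p + (x - (delta * p + (1 - delta) * w)) / delta)%C).
  assert (Hdn : RtoC delta <> 0) by (intro E; apply RtoC_inj in E; lra).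
  assert (Hp' : D p').
  { apply HDe. unfold dist2, p'. replace (p + (x - (delta * p + (1 - delta) * w)) / delta - p)%C with ((x - (delta * p + (1 - delta) * w)) / delta)%C by (field; auto).
    unfold Cdiv. rewrite Cmod_mult, Cmod_inv, Cmod_R, Rabs_pos_eq by (auto; lra).
    apply Rmult_lt_reg_r with delta; [lra|]. rewrite Rmult_assoc, Rinv_l by lra. lra. }
  assert (X := HC p' w delta Hp' Hw ltac:(lra)).
  replace x with (delta * fst p' + (1 - delta) * fst w, delta * snd p' + (1 - delta) * snd w); auto.
  transitivity (delta * p' + (1 - delta) * w)%C.
  - unfold Cplus, Cmult, Cminus, Copp, RtoC. cbn [fst snd]. f_equal; simpl; ring.
  - unfold p'. change (@eq C (delta * (p + (x - (delta * p + (1 - delta) * w)) / delta) + (1 - delta) * w)%C x). field; auto.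
Qed.

(* Coefficients of the admissible maps; [c 1 ^ 2 + d 1 ^ 2 = 0] says that the differential at 0
   is conformal. *)
Definition adm_coef (D : C -> Prop) (p : C) (c d : nat -> C) : Prop :=
  conv_disk c /\ conv_disk d /\ (forall z, Cmod z < 1 -> D (hmap c d z)) /\ hmap c d 0 = p /\
  (c 1%nat * c 1%nat + d 1%nat * d 1%nat = 0)%C /\ Im (c 0%nat) = 0 /\ Im (d 0%nat) = 0.

Lemma adm_coef_bound D p B c d : (forall z, D z -> Cmod z <= B) -> adm_coef D p c d ->
  forall n, Cmod (c n) <= 2 * B /\ Cmod (d n) <= 2 * B.
Proof.
  intros HB (Hc & Hd & HD & H0 & _ & I1 & I2).
  assert (Hcomp : forall z, Cmod z < 1 -> Rabs (hser c z) <= B /\ Rabs (hser d z) <= B).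
  { intros z Hz. specialize (HB _ (HD z Hz)). pose proof (Rmax_Cmod (hmap c d z)) as HM.
    pose proof (Rmax_l (Rabs (fst (hmap c d z))) (Rabs (snd (hmap c d z)))).
    pose proof (Rmax_r (Rabs (fst (hmap c d z))) (Rabs (snd (hmap c d z)))).
    unfold hmap in *. cbn [fst snd] in *. split; lra. }
  (* The map does not see [Im (c 0)]. Normalising it to 0 bounds the coefficient of index 0, which
     the averaging estimate leaves out. *)
  assert (HR : forall z, Im z = 0 -> Cmod z = Rabs (Re z)).
  { intros [a b]. unfold Im, Re. cbn. intros ->. apply Cmod_R. }
  intros [|n].
  - rewrite !HR, <- !hser_0 by auto. destruct (Hcomp 0) as [X1 X2]; [rewrite Cmod_0; lra|].
    pose proof (Rabs_pos (hser c 0)). split; lra.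
  - split; (apply hser_coef_bound; [assumption|intros z Hz; apply (Hcomp z Hz)|apply Nat.lt_0_succ]).
Qed.

Lemma adm_coef_compact D p (c d : nat -> nat -> C) (m : R) : Defs.open_set D -> bounded_set D -> convex_set D -> D p ->
  (forall k, adm_coef D p (c k) (d k)) -> is_lim_seq (fun k => Cmod (c k 1%nat)) m ->
  exists lc ld, adm_coef D p lc ld /\ Cmod (lc 1%nat) = m.
Proof.
  intros HO [B HB] HC Hp Hadm Hm.
  assert (Hbd := fun k => adm_coef_bound D p B _ _ HB (Hadm k)).
  destruct (coef_diagonal c d (2 * B)) as [phi [lc [ld [Hphi [Lc Ld]]]]]; [intros; apply Hbd|intros; apply Hbd|].
  assert (Hbc : forall n, Cmod (lc n) <= 2 * B).
  { apply (hser_lim _ _ (2 * B) 0 Lc); [intros; apply Hbd|rewrite Cmod_0; lra]. }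
  assert (Hbdd : forall n, Cmod (ld n) <= 2 * B).
  { apply (hser_lim _ _ (2 * B) 0 Ld); [intros; apply Hbd|rewrite Cmod_0; lra]. }
  assert (Hlc : forall z, Cmod z < 1 -> is_lim_seq (fun k => hser (c (phi k)) z) (hser lc z)).
  { intros z Hz. apply (hser_lim _ _ (2 * B) z Lc); auto. intros; apply Hbd. }
  assert (Hld : forall z, Cmod z < 1 -> is_lim_seq (fun k => hser (d (phi k)) z) (hser ld z)).
  { intros z Hz. apply (hser_lim _ _ (2 * B) z Ld); auto. intros; apply Hbd. }
  assert (Huniq : forall (u : nat -> R) a b, is_lim_seq u (Finite a) -> (forall k, u k = b) -> a = b).
  { intros u a b Hu Hk. assert (X : Finite a = Finite b); [|now injection X].
    rewrite <- (is_lim_seq_unique _ _ Hu). rewrite <- (Lim_seq_const b). now apply Lim_seq_ext. }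
  assert (H0 : Cmod 0 < 1) by (rewrite Cmod_0; lra).
  exists lc, ld. split.
  - split; [|split; [|split; [|split; [|split; [|split]]]]].
    + now apply conv_disk_bounded with (2 * B).
    + now apply conv_disk_bounded with (2 * B).
    (* The limit value is only known to be a limit of points of [D]. The weight [delta] depends on
       [z] but not on [k], so the share of [p] survives the limit. *)
    + intros z Hz. destruct (hmap_harnack D z HC Hz) as [delta [Hd Hh]].
      apply (convex_open_absorb D p _ delta); auto. intros eps He.
      assert (L1 := Hlc z Hz). assert (L2 := Hld z Hz).
      apply is_lim_seq_spec in L1. apply is_lim_seq_spec in L2.
      destruct (L1 (mkposreal (eps / 4) ltac:(lra))) as [N1 HN1]. destruct (L2 (mkposreal (eps / 4) ltac:(lra))) as [N2 HN2].
      set (k := (N1 + N2)%nat). specialize (HN1 k ltac:(unfold k; lia)). specialize (HN2 k ltac:(unfold k; lia)).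
      cbn [pos] in HN1, HN2. destruct (Hadm (phi k)) as (A1 & A2 & A3 & A4 & _).
      destruct (Hh _ _ A1 A2 A3 (eps / 2) ltac:(lra)) as [w [Hw Hlt]]. rewrite A4 in Hlt.
      exists w. split; auto.
      replace (hmap lc ld z - (delta * p + (1 - delta) * w))%C with
        ((hmap lc ld z - hmap (c (phi k)) (d (phi k)) z) + (hmap (c (phi k)) (d (phi k)) z - (delta * p + (1 - delta) * w)))%C by ring.
      eapply Rle_lt_trans; [apply Cmod_triangle|].
      assert (Cmod (hmap lc ld z - hmap (c (phi k)) (d (phi k)) z)%C < eps / 2); [|lra].
      eapply Rle_lt_trans; [apply Cmod_le_2max|].
      replace (eps / 2) with (2 * (eps / 4)) by field. apply Rmult_lt_compat_l; [lra|].
      unfold hmap, Cminus, Cplus, Copp. cbn [fst snd].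
      rewrite Rabs_minus_sym in HN1, HN2. now apply Rmax_lub_lt.
    + destruct p as [p1 p2]. unfold hmap. f_equal.
      * apply (Huniq _ _ _ (Hlc 0 H0)). intro k. destruct (Hadm (phi k)) as (_ & _ & _ & E & _).
        now apply (f_equal fst) in E.
      * apply (Huniq _ _ _ (Hld 0 H0)). intro k. destruct (Hadm (phi k)) as (_ & _ & _ & E & _).
        now apply (f_equal snd) in E.
    + destruct (Lc 1%nat) as [c1 c2]. destruct (Ld 1%nat) as [d1 d2].
      assert (E : forall k, (c (phi k) 1%nat * c (phi k) 1%nat + d (phi k) 1%nat * d (phi k) 1%nat = 0)%C)
        by (intro k; apply (Hadm (phi k))).
      (* Conformality is a polynomial equation in the real and imaginary parts of the coefficients,
         so it passes to the limit. *)
      assert (E1 := is_lim_seq_plus' _ _ _ _ (is_lim_seq_minus' _ _ _ _ (is_lim_seq_mult' _ _ _ _ c1 c1) (is_lim_seq_mult' _ _ _ _ c2 c2))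
         (is_lim_seq_minus' _ _ _ _ (is_lim_seq_mult' _ _ _ _ d1 d1) (is_lim_seq_mult' _ _ _ _ d2 d2))).
      assert (E2 := is_lim_seq_plus' _ _ _ _ (is_lim_seq_mult' _ _ _ _ c1 c2) (is_lim_seq_mult' _ _ _ _ d1 d2)).
      apply (Huniq _ _ 0) in E1.
      2:{ intro k. specialize (E k). apply (f_equal fst) in E. exact E. }
      apply (Huniq _ _ 0) in E2.
      2:{ intro k. specialize (E k). apply (f_equal snd) in E. unfold Re, Im.
          unfold Cplus, Cmult in E. cbn [fst snd] in E. change (snd (RtoC 0)) with 0 in E. lra. }
      destruct (lc 1%nat) as [a1 a2], (ld 1%nat) as [b1 b2]. unfold Re, Im in E1, E2. cbn [fst snd] in E1, E2.
      unfold Cmult, Cplus, RtoC. cbn [fst snd]. f_equal; lra.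
    + apply (Huniq _ _ _ (proj2 (Lc 0%nat))). intro k. apply (Hadm (phi k)).
    + apply (Huniq _ _ _ (proj2 (Ld 0%nat))). intro k. apply (Hadm (phi k)).
  - destruct (Lc 1%nat) as [c1 c2]. assert (L := is_lim_seq_Cmod _ _ c1 c2).
    assert (L' : is_lim_seq (fun k => Cmod (c (phi k) 1%nat)) m).
    { apply (is_lim_seq_subseq (fun k => Cmod (c k 1%nat))); auto.
      intros P [N HN]. exists N. intros k Hk. apply HN. specialize (Hphi k). lia. }
    assert (X : Finite (Cmod (lc 1%nat)) = Finite m); [|now injection X].
    rewrite <- (is_lim_seq_unique _ _ L), <- (is_lim_seq_unique _ _ L'). reflexivity.
Qed.

(** * Cauchy's formula *)

Definition ccont (h : R -> C) : Prop :=
  forall t, continuous (fun t => Re (h t)) t /\ continuous (fun t => Im (h t)) t.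

Lemma ccont_const a : ccont (fun _ => a).
Proof. intro t; split; apply continuous_const. Qed.

Lemma ccont_mult g h : ccont g -> ccont h -> ccont (fun t => g t * h t)%C.
Proof.
  intros Hg Hh t. destruct (Hg t) as [g1 g2]. destruct (Hh t) as [h1 h2]. split.
  - apply continuous_ext with (fun t => Re (g t) * Re (h t) - Im (g t) * Im (h t)); [intro; symmetry; apply re_mult|].
    apply (continuous_minus (V := R_NormedModule)); now apply (continuous_mult (K := R_AbsRing)).
  - apply continuous_ext with (fun t => Re (g t) * Im (h t) + Im (g t) * Re (h t)); [intro; symmetry; apply im_mult|].
    apply (continuous_plus (V := R_NormedModule)); now apply (continuous_mult (K := R_AbsRing)).
Qed.

Lemma ccont_minus g h : ccont g -> ccont h -> ccont (fun t => g t - h t)%C.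
Proof.
  intros Hg Hh t. destruct (Hg t) as [g1 g2]. destruct (Hh t) as [h1 h2].
  split; now apply (continuous_minus (V := R_NormedModule)).
Qed.

Lemma ccont_cis a : ccont (fun t => cis (a * t)).
Proof.
  intro t. split; apply (ex_derive_continuous (K := R_AbsRing) (V := R_NormedModule)); unfold cis, Re, Im; cbn [fst snd]; auto_derive; auto.
Qed.

Lemma ccont_inv h : ccont h -> (forall t, h t <> 0%C) -> ccont (fun t => / h t)%C.
Proof.
  intros Hh Hn t. destruct (Hh t) as [h1 h2].
  assert (Hd : Re (h t) * Re (h t) + Im (h t) * Im (h t) <> 0).
  { specialize (Hn t). destruct (h t) as [a b]. unfold Re, Im; cbn [fst snd]. intro E. apply Hn.
    assert (a = 0) by nra. assert (b = 0) by nra. subst. reflexivity. }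
  assert (C1 : continuous (fun t => / (Re (h t) * Re (h t) + Im (h t) * Im (h t))) t).
  { apply continuous_Rinv_comp; auto.
    apply (continuous_plus (V := R_NormedModule)); now apply (continuous_mult (K := R_AbsRing)). }
  split.
  - apply continuous_ext with (fun t => Re (h t) * / (Re (h t) * Re (h t) + Im (h t) * Im (h t))).
    { intro s. unfold Cinv, Re, Im, Rdiv; simpl. now rewrite !Rmult_1_r. }
    now apply (continuous_mult (K := R_AbsRing)).
  - apply continuous_ext with (fun t => - Im (h t) * / (Re (h t) * Re (h t) + Im (h t) * Im (h t))).
    { intro s. unfold Cinv, Re, Im, Rdiv; simpl. now rewrite !Rmult_1_r. }
    apply (continuous_mult (K := R_AbsRing)); auto. now apply (continuous_opp (V := R_NormedModule)).
Qed.

Lemma ccont_Cmod h : ccont h -> forall t, continuous (fun t => Cmod (h t)) t.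
Proof.
  intros Hh t. destruct (Hh t) as [h1 h2]. unfold Cmod.
  apply (continuous_comp (fun t => fst (h t) ^ 2 + snd (h t) ^ 2) sqrt); [|apply continuous_sqrt].
  apply (continuous_plus (V := R_NormedModule)).
  - apply continuous_ext with (fun t => Re (h t) * Re (h t)); [intro; unfold Re; simpl; ring|now apply (continuous_mult (K := R_AbsRing))].
  - apply continuous_ext with (fun t => Im (h t) * Im (h t)); [intro; unfold Im; simpl; ring|now apply (continuous_mult (K := R_AbsRing))].
Qed.

Lemma ccont_ex_RInt h a b : ccont h -> ex_RInt (fun t => Re (h t)) a b /\ ex_RInt (fun t => Im (h t)) a b.
Proof.
  intro Hh. split; apply (ex_RInt_continuous (V := R_CompleteNormedModule)); intros; apply Hh.
Qed.

Definition cint (h : R -> C) : C :=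
  (RInt (fun t => Re (h t)) 0 (2 * PI), RInt (fun t => Im (h t)) 0 (2 * PI)).

Lemma cint_scal_Re a h : ccont h ->
  Re (a * cint h)%C = RInt (fun t => Re (a * h t)%C) 0 (2 * PI).
Proof.
  intro Hh. destruct (ccont_ex_RInt h 0 (2 * PI) Hh) as [I1 I2].
  rewrite (RInt_ext _ (fun t => minus (scal (Re a) (Re (h t))) (scal (Im a) (Im (h t))))).
  - rewrite (RInt_minus (V := R_CompleteNormedModule)); try apply (ex_RInt_scal (V := R_CompleteNormedModule)); auto.
    rewrite !(RInt_scal (V := R_CompleteNormedModule)) by auto. reflexivity.
  - intros t _. apply re_mult.
Qed.

Lemma Cmod_r_cis r t : 0 < r -> Cmod (r * cis t)%C = r.
Proof. intro Hr. rewrite Cmod_mult, Cmod_cis, Cmod_R, Rabs_pos_eq; lra. Qed.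

Lemma Cmod_circle_minus z0 r t : 0 < r -> r - Cmod z0 <= Cmod (r * cis t - z0)%C.
Proof.
  intro Hr. pose proof (Cmod_triangle (r * cis t - z0)%C z0) as H.
  replace (r * cis t - z0 + z0)%C with (r * cis t)%C in H by ring.
  rewrite Cmod_r_cis in H by auto. lra.
Qed.

Lemma circle_minus_neq0 z0 r t : 0 < r -> Cmod z0 < r -> (r * cis t - z0)%C <> 0%C.
Proof.
  intros Hr Hz E. pose proof (Cmod_circle_minus z0 r t Hr) as H. rewrite E, Cmod_0 in H. lra.
Qed.

(** This is [dz / (z - z0)] divided by [i dt] on [z = r e^(it)]. The angle is written [1 * t] to be
    an instance of [ccont_cis]. *)
Definition cauchy_kernel (z0 : C) (r t : R) : C := (r * cis (1 * t) / (r * cis (1 * t) - z0))%C.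

Lemma ccont_cauchy_kernel z0 r : 0 < r -> Cmod z0 < r -> ccont (cauchy_kernel z0 r).
Proof.
  intros Hr Hz. unfold cauchy_kernel, Cdiv.
  assert (H : ccont (fun t => r * cis (1 * t))%C).
  { apply (ccont_mult (fun _ => RtoC r)); [apply ccont_const|apply ccont_cis]. }
  apply ccont_mult; auto. apply ccont_inv.
  - apply (ccont_minus _ (fun _ => z0)); auto. apply ccont_const.
  - intro t. now apply circle_minus_neq0.
Qed.

(* Expand [z / (z - z0) = sum (z0 / z)^n] on the circle [|z| = r]; after N terms the remainder is the
   same integral with [(z0 / z)^N] inserted. *)
Lemma cauchy_kernel_series g z0 r : ccont g -> 0 < r -> Cmod z0 < r ->
  is_series (fun n => Re ((z0 / r) ^ n * cint (fun t => g t * cis (- INR n * t)))%C)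
   (RInt (fun t => Re (g t * cauchy_kernel z0 r t)%C) 0 (2 * PI)).
Proof.
  intros Hg Hr Hz. pose proof (Cmod_ge_0 z0) as H0.
  set (k := cauchy_kernel z0 r).
  set (q := Cmod z0 / r).
  assert (Hrn : RtoC r <> 0) by (intro E; apply RtoC_inj in E; lra).
  assert (Hq : 0 <= q < 1).
  { unfold q. split. apply Rmult_le_pos; [lra|apply Rlt_le, Rinv_0_lt_compat; lra].
    apply Rmult_lt_reg_r with r; [lra|]. unfold Rdiv. rewrite Rmult_assoc, Rinv_l; lra. }
  assert (Hnz := fun t => circle_minus_neq0 z0 r (1 * t) Hr Hz).
  assert (Hcz : forall t, cis t <> 0%C).
  { intros t E. pose proof (Cmod_cis t) as X. rewrite E, Cmod_0 in X. lra. }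
  assert (Hk : ccont k) by now apply ccont_cauchy_kernel.
  assert (Hkb : forall t, Cmod (k t) <= / (1 - q)).
  { intro t. unfold k, cauchy_kernel, Cdiv. rewrite Cmod_mult, Cmod_inv, Cmod_r_cis by auto.
    replace (/ (1 - q)) with (r * / (r - Cmod z0)) by (unfold q; field; lra).
    apply Rmult_le_compat_l; [lra|]. apply Rinv_le_contravar; [lra|now apply Cmod_circle_minus]. }
  set (h := fun n t => (g t * cis (- INR n * t))%C).
  assert (Hh : forall n, ccont (h n)) by (intro n; apply ccont_mult; auto; apply ccont_cis).
  set (Rem := fun n => RInt (fun t => Re ((z0 / r) ^ n * (h n t * k t))%C) 0 (2 * PI)).
  (* The kernel [k = z / (z - z0)] satisfies [k = 1 + (z0 / z) k], which peels off one term of the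
     series. *)
  assert (Hsplit : forall n, Rem n = Re ((z0 / r) ^ n * cint (h n))%C + Rem (S n)).
  { intro n. rewrite cint_scal_Re by auto.
    transitivity (RInt (fun t => plus (Re ((z0 / r) ^ n * h n t)%C) (Re ((z0 / r) ^ S n * (h (S n) t * k t))%C)) 0 (2 * PI)).
    - apply RInt_ext. intros t _. change plus with Rplus. rewrite <- re_plus. f_equal.
      unfold h. replace (- INR n * t) with (1 * t + - INR (S n) * t) by (rewrite S_INR; ring).
      rewrite cis_plus, Cpow_S. unfold k, cauchy_kernel. specialize (Hnz t). specialize (Hcz (1 * t)). field. auto.
    - rewrite (RInt_plus (V := R_CompleteNormedModule)); [reflexivity| |].
      + apply (ccont_ex_RInt (fun t => (z0 / r) ^ n * h n t)%C). apply (ccont_mult (fun _ => ((z0 / r) ^ n)%C)); auto. apply ccont_const.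
      + apply (ccont_ex_RInt (fun t => (z0 / r) ^ S n * (h (S n) t * k t))%C).
        apply (ccont_mult (fun _ => ((z0 / r) ^ S n)%C)); [apply ccont_const|]. apply ccont_mult; auto. }
  assert (HR0 : RInt (fun t => Re (g t * k t)%C) 0 (2 * PI) = Rem 0%nat).
  { apply RInt_ext. intros t _. f_equal. unfold h. simpl INR. replace (- 0 * t) with 0 by ring.
    rewrite cis_0. simpl. ring. }
  change (is_series (fun n => Re ((z0 / r) ^ n * cint (h n))%C) (RInt (fun t => Re (g t * k t)%C) 0 (2 * PI))).
  rewrite HR0.
  assert (Hpart : forall n, psum (fun n => Re ((z0 / r) ^ n * cint (h n))%C) n = Rem 0%nat - Rem n).
  { induction n; cbn [psum]; [ring|]. rewrite IHn, (Hsplit n). ring. }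
  set (K := RInt (fun t => Cmod (g t)) 0 (2 * PI)).
  assert (HRem : forall n, Rabs (Rem n) <= q ^ n * (/ (1 - q) * K)).
  { intro n. unfold Rem. pose proof PI_RGT_0.
    assert (Hc : ccont (fun t => (z0 / r) ^ n * (h n t * k t))%C).
    { apply (ccont_mult (fun _ => ((z0 / r) ^ n)%C)); [apply ccont_const|]. apply ccont_mult; auto. }
    eapply Rle_trans; [apply abs_RInt_le; [lra|apply (ccont_ex_RInt _ _ _ Hc)]|].
    unfold K. rewrite <- Rmult_assoc.
    assert (Eg : ex_RInt (fun t => Cmod (g t)) 0 (2 * PI)).
    { apply (ex_RInt_continuous (V := R_CompleteNormedModule)). intros; now apply ccont_Cmod. }
    change (q ^ n * / (1 - q) * RInt (fun t => Cmod (g t)) 0 (2 * PI)) with (scal (q ^ n * / (1 - q)) (RInt (fun t => Cmod (g t)) 0 (2 * PI))).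
    rewrite <- (RInt_scal (V := R_CompleteNormedModule)) by auto.
    apply RInt_le; [lra| | |].
    - apply (ex_RInt_continuous (V := R_CompleteNormedModule)). intros t _.
      exact (continuous_comp _ Rabs t (proj1 (Hc t)) (continuous_Rabs _)).
    - now apply (ex_RInt_scal (V := R_CompleteNormedModule)).
    - intros t _. eapply Rle_trans; [apply re_le_Cmod|]. unfold h.
      rewrite !Cmod_mult, Cmod_pow, Cmod_cis. unfold Cdiv. rewrite Cmod_mult, Cmod_inv, Cmod_R, (Rabs_pos_eq r) by (auto; lra).
      change (Cmod z0 * / r) with q. change scal with Rmult.
      rewrite Rmult_1_r, (Rmult_assoc (q ^ n)), (Rmult_comm (/ (1 - q))).
      apply Rmult_le_compat_l; [apply pow_le; lra|]. apply Rmult_le_compat_l; [apply Cmod_ge_0|auto]. }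
  assert (Hl : is_lim_seq (fun n => psum (fun n => Re ((z0 / r) ^ n * cint (h n))%C) (S n)) (Rem 0%nat)).
  { apply is_lim_seq_ext with (fun n => Rem 0%nat - Rem (S n)); [intro; now rewrite Hpart|].
    replace (Finite (Rem 0%nat)) with (Finite (Rem 0%nat - 0)) by (f_equal; ring).
    apply is_lim_seq_minus'; [apply is_lim_seq_const|].
    apply (is_lim_seq_incr_1 Rem). apply is_lim_seq_abs_0.
    apply (is_lim_seq_le_le (fun _ => 0) _ (fun n => q ^ n * (/ (1 - q) * K))).
    - intro n. split; [apply Rabs_pos|apply HRem].
    - apply is_lim_seq_const.
    - replace (Finite 0) with (Finite (0 * (/ (1 - q) * K))) by (f_equal; ring).
      apply is_lim_seq_mult'; [|apply is_lim_seq_const]. apply is_lim_seq_geom. rewrite Rabs_pos_eq; lra. }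
  eapply is_lim_seq_ext in Hl. 2:{ intro n. rewrite psum_sum_f_R0, <- sum_n_Reals. reflexivity. }
  exact Hl.
Qed.

Lemma RInt_cis_Re (a : C) n : (0 < n)%nat -> Re (cint (fun t => a * cis (- INR n * t)))%C = 0 /\
  Im (cint (fun t => a * cis (- INR n * t)))%C = 0.
Proof.
  intro Hn. assert (HN : 0 < INR n) by (now apply lt_0_INR).
  assert (Hper : cos (INR n * (2 * PI)) = 1 /\ sin (INR n * (2 * PI)) = 0).
  { replace (INR n * (2 * PI)) with (0 + 2 * INR n * PI) by ring.
    rewrite cos_period, sin_period, cos_0, sin_0. auto. }
  destruct Hper as [P1 P2].
  assert (Hint : forall b c, RInt (fun t => b * cos (INR n * t) + c * sin (INR n * t)) 0 (2 * PI) = 0).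
  { intros b c. set (F := fun t => (b * sin (INR n * t) - c * cos (INR n * t)) / INR n).
    assert (I : is_RInt (fun t => b * cos (INR n * t) + c * sin (INR n * t)) 0 (2 * PI) (minus (F (2 * PI)) (F 0))).
    { apply (is_RInt_derive (V := R_CompleteNormedModule)); unfold F.
      - intros t _. auto_derive; [lra|]. field. lra.
      - intros t _. apply (ex_derive_continuous (K := R_AbsRing) (V := R_NormedModule)). auto_derive; auto. }
    rewrite (is_RInt_unique _ _ _ _ I).
    unfold minus, plus, opp, F; simpl. rewrite P1, P2, (Rmult_0_r (INR n)), sin_0, cos_0. field. lra. }
  assert (E : forall t, cis (- INR n * t) = (cos (INR n * t), - sin (INR n * t))).
  { intro t. unfold cis. replace (- INR n * t) with (- (INR n * t)) by ring. now rewrite cos_neg, sin_neg. }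
  split; unfold cint; [change (Re (?x, _)) with x | change (Im (_, ?y)) with y].
  - etransitivity; [|apply (Hint (Re a) (Im a))]. apply RInt_ext. intros t _. rewrite E. destruct a; unfold Re, Im; simpl. ring.
  - etransitivity; [|apply (Hint (Im a) (- Re a))]. apply RInt_ext. intros t _. rewrite E. destruct a; unfold Re, Im; simpl. ring.
Qed.

(** For a constant, every term of the kernel series but the one of index 0 vanishes. This is the
    Cauchy integral at the end of the contraction, where [g] is frozen at [z0]. *)
Lemma cauchy_kernel_mean a z0 r : 0 < r -> Cmod z0 < r ->
  RInt (fun t => Re (a * cauchy_kernel z0 r t)%C) 0 (2 * PI) = 2 * PI * Re a.
Proof.
  intros Hr Hz. assert (H := cauchy_kernel_series (fun _ => a) z0 r (ccont_const a) Hr Hz).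
  apply is_series_unique in H. rewrite <- H.
  rewrite (Series_ext _ (fun n => 2 * PI * Re a * 0 ^ n)).
  - rewrite Series_scal_l, Series_geom by (rewrite Rabs_R0; lra). match goal with |- @eq _ ?x ?y => change (@eq R x y) end. field.
  - intros [|n].
    + unfold cint. rewrite Cpow_0, Cmult_1_l. change (Re (?x, _)) with x.
      rewrite (RInt_ext _ (fun _ => Re a)).
      * rewrite RInt_const. unfold scal; simpl. unfold mult; simpl. ring.
      * intros t _. simpl INR. replace (- 0 * t) with 0 by ring. now rewrite cis_0, Cmult_1_r.
    + destruct (RInt_cis_Re a (S n) ltac:(lia)) as [E1 E2].
      rewrite re_mult, E1, E2. simpl. ring.
Qed.

Lemma continuity_2d_pt_comp f g h x y : continuity_2d_pt f (g x y) (h x y) ->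
  continuity_2d_pt g x y -> continuity_2d_pt h x y -> continuity_2d_pt (fun u v => f (g u v) (h u v)) x y.
Proof.
  intros Hf Hg Hh eps. destruct (Hf eps) as [d Hd].
  eapply locally_2d_impl; [|exact (Hg d)]. eapply locally_2d_impl; [|exact (Hh d)].
  apply locally_2d_forall. intros u v H1 H2. now apply Hd.
Qed.

Lemma continuity_2d_pt_snd (f : R -> R) x y : continuous f y -> continuity_2d_pt (fun _ v => f v) x y.
Proof.
  intro Hf. apply (continuity_1d_2d_pt_comp f (fun _ v => v)).
  - now apply continuity_pt_filterlim.
  - apply continuity_2d_pt_id2.
Qed.

(* [g = A + i B] satisfies the Cauchy-Riemann equations on the unit disk, with [g' = p - i q]. *)
Definition cr_pair (A B p q : R -> R -> R) : Prop := forall x y, Cmod (x, y) < 1 ->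
  differentiable_pt_lim A x y (p x y) (q x y) /\ differentiable_pt_lim B x y (- q x y) (p x y) /\
  continuity_2d_pt p x y /\ continuity_2d_pt q x y.

Section CauchyHomotopy.
Variables (A B p q : R -> R -> R) (z0 : C) (r : R).
Hypothesis (Hcr : cr_pair A B p q) (Hr : 0 < r < 1) (Hz : Cmod z0 < r).

Let X s t := fst z0 + s * (r * cos (1 * t) - fst z0).
Let Y s t := snd z0 + s * (r * sin (1 * t) - snd z0).
Let G s t := p (X s t) (Y s t) * (r * cos (1 * t)) + q (X s t) (Y s t) * (r * sin (1 * t)).

(** The margin beyond [[0, 1]] provides two-sided neighbourhoods at both ends of the homotopy; a
    point overshoots to modulus at most [r (1 + 2 eta)], which is below 1. *)
Lemma segment_in_disk : exists eta : posreal, forall s t, - eta < s < 1 + eta -> Cmod (X s t, Y s t) < 1.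
Proof.
  assert (He : 0 < (1 - r) / 3) by lra.
  exists (mkposreal _ He). cbn [pos]. intros s t Hs.
  pose proof (Cmod_ge_0 z0) as H0.
  replace ((X s t, Y s t) : C) with ((1 - s)%R * z0 + s * (r * cis (1 * t)))%C.
  2:{ unfold X, Y, cis, Cplus, Cmult, RtoC; simpl. f_equal; ring. }
  eapply Rle_lt_trans; [apply Cmod_triangle|].
  rewrite !(Cmod_mult (RtoC _)), Cmod_cis, !Cmod_R, (Rabs_pos_eq r) by lra.
  unfold Rabs. repeat destruct Rcase_abs; nra.
Qed.

Lemma segment_derive_s f fx fy s t : differentiable_pt_lim f (X s t) (Y s t) fx fy ->
  is_derive (fun s => f (X s t) (Y s t)) s (fx * (r * cos (1 * t) - fst z0) + fy * (r * sin (1 * t) - snd z0)).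
Proof.
  intro H. apply is_derive_Reals. apply (derivable_pt_lim_comp_2d f (fun s => X s t) (fun s => Y s t)); auto;
  apply is_derive_Reals; unfold X, Y; auto_derive; auto; ring.
Qed.

Lemma segment_derive_t f fx fy s t : differentiable_pt_lim f (X s t) (Y s t) fx fy ->
  is_derive (fun t => f (X s t) (Y s t)) t (fx * (- s * r * sin (1 * t)) + fy * (s * r * cos (1 * t))).
Proof.
  intro H. apply is_derive_Reals. apply (derivable_pt_lim_comp_2d f (fun t => X s t) (fun t => Y s t)); auto;
  apply is_derive_Reals; unfold X, Y; auto_derive; auto; ring.
Qed.

Let F s t := Re ((A (X s t) (Y s t), B (X s t) (Y s t)) * cauchy_kernel z0 r t)%C.

(** The derivative in [s] is [g' (z - z0)] times [z / (z - z0)]: the denominator cancels, and [G] is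
    the real part of [g' z]. *)
Lemma homotopy_derive s t : Cmod (X s t, Y s t) < 1 -> is_derive (fun s => F s t) s (G s t).
Proof.
  intro Hd. destruct (Hcr _ _ Hd) as (HA & HB & _).
  assert (D1 := segment_derive_s _ _ _ _ _ HA). assert (D2 := segment_derive_s _ _ _ _ _ HB).
  set (k := cauchy_kernel z0 r t) in *.
  assert (Hk : (((r * cos (1 * t) - fst z0)%R, (r * sin (1 * t) - snd z0)%R) * k = r * cis (1 * t))%C).
  { unfold k, cauchy_kernel.
    replace ((r * cos (1 * t) - fst z0)%R, (r * sin (1 * t) - snd z0)%R) with (r * cis (1 * t) - z0)%C.
    - pose proof (circle_minus_neq0 z0 r (1 * t) ltac:(lra) Hz). field. auto.
    - unfold cis, Cminus, Cplus, Copp, Cmult, RtoC; simpl. f_equal; ring. }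
  assert (K1 := f_equal fst Hk). assert (K2 := f_equal snd Hk).
  unfold cis, Cmult, RtoC in K1, K2. cbn [fst snd] in K1, K2.
  set (w1 := r * cos (1 * t) - fst z0) in *. set (w2 := r * sin (1 * t) - snd z0) in *.
  assert (D3 := is_derive_plus (K := R_AbsRing) (V := R_NormedModule) _ _ _ _ _ (is_derive_scal _ _ (fst k) _ D1) (is_derive_scal _ _ (- snd k) _ D2)).
  eapply is_derive_ext in D3.
  2:{ intro s'. instantiate (1 := fun s => F s t). unfold F, plus, Re, Cmult; simpl. fold k. ring. }
  replace (G s t) with (plus (fst k * (p (X s t) (Y s t) * w1 + q (X s t) (Y s t) * w2))
     (- snd k * (- q (X s t) (Y s t) * w1 + p (X s t) (Y s t) * w2))); [exact D3|].
  change plus with Rplus. unfold G.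
  replace (r * cos (1 * t)) with (w1 * fst k - w2 * snd k) by lra.
  replace (r * sin (1 * t)) with (w1 * snd k + w2 * fst k) by lra.
  match goal with |- @eq _ ?x ?y => change (@eq R x y) end. ring.
Qed.

(** The derivative of [g] along the contracted circle is [i s z g'], so [s G] is the derivative in
    [t] of the imaginary part [B] and integrates to 0 over a period. Dividing by [s] requires
    [s > 0], which is enough for the mean value theorem on [(0, 1)]. *)
Lemma homotopy_derivative_zero s : 0 < s <= 1 -> RInt (G s) 0 (2 * PI) = 0.
Proof.
  intro Hs. destruct segment_in_disk as [eta He]. pose proof (cond_pos eta).
  assert (Hd : forall t, Cmod (X s t, Y s t) < 1) by (intro t; apply He; lra).
  assert (HD : is_RInt (fun t => scal s (G s t)) 0 (2 * PI)
     (minus (B (X s (2 * PI)) (Y s (2 * PI))) (B (X s 0) (Y s 0)))).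
  { apply (is_RInt_derive (V := R_CompleteNormedModule) (fun t => B (X s t) (Y s t))).
    - intros t _. destruct (Hcr _ _ (Hd t)) as (_ & HB & _).
      replace (scal s (G s t)) with (- q (X s t) (Y s t) * (- s * r * sin (1 * t)) + p (X s t) (Y s t) * (s * r * cos (1 * t))).
      + now apply segment_derive_t.
      + unfold G, scal; simpl. unfold mult; simpl. ring.
    - intros t _. destruct (Hcr _ _ (Hd t)) as (_ & _ & Hp & Hq).
      assert (CX : continuous (fun t => X s t) t) by (apply (ex_derive_continuous (K := R_AbsRing) (V := R_NormedModule)); unfold X; auto_derive; auto).
      assert (CY : continuous (fun t => Y s t) t) by (apply (ex_derive_continuous (K := R_AbsRing) (V := R_NormedModule)); unfold Y; auto_derive; auto).
      apply (continuous_scal_r (K := R_AbsRing) (V := R_NormedModule)). unfold G.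
      apply (continuous_plus (V := R_NormedModule)); apply (continuous_mult (K := R_AbsRing));
        try (apply (ex_derive_continuous (K := R_AbsRing) (V := R_NormedModule)); auto_derive; auto; fail).
      + apply (continuous_comp_2 (fun t => X s t) (fun t => Y s t) p); auto. now apply continuity_2d_pt_filterlim in Hp.
      + apply (continuous_comp_2 (fun t => X s t) (fun t => Y s t) q); auto. now apply continuity_2d_pt_filterlim in Hq. }
  assert (HG : ex_RInt (G s) 0 (2 * PI)).
  { apply ex_RInt_ext with (fun t => scal (/ s) (scal s (G s t))).
    - intros t _. unfold scal; simpl. unfold mult; simpl. field. lra.
    - apply (ex_RInt_scal (V := R_CompleteNormedModule)). eexists; exact HD. }
  apply (is_RInt_unique (V := R_CompleteNormedModule) (fun t => scal s (G s t))) in HD. rewrite (RInt_scal (V := R_CompleteNormedModule)) in HD by auto.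
  assert (E : X s (2 * PI) = X s 0 /\ Y s (2 * PI) = Y s 0).
  { unfold X, Y. rewrite !Rmult_1_l, cos_2PI, sin_2PI, cos_0, sin_0. auto. }
  destruct E as [-> ->] in HD. unfold minus, plus, opp, scal in HD; simpl in HD. unfold mult in HD; simpl in HD.
  rewrite Rplus_opp_r in HD. apply Rmult_integral in HD. destruct HD; [lra|auto].
Qed.

Lemma homotopy_continuous s t : Cmod (X s t, Y s t) < 1 -> continuous (F s) t.
Proof.
  intro Hd. destruct (Hcr _ _ Hd) as (HA & HB & _).
  destruct (ccont_cauchy_kernel z0 r ltac:(lra) Hz t) as [K1 K2].
  apply continuous_ext with (fun t => A (X s t) (Y s t) * Re (cauchy_kernel z0 r t) - B (X s t) (Y s t) * Im (cauchy_kernel z0 r t)).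
  { intro. unfold F. symmetry. apply re_mult. }
  apply (continuous_minus (V := R_NormedModule)); apply (continuous_mult (K := R_AbsRing)); auto;
   apply (ex_derive_continuous (K := R_AbsRing) (V := R_NormedModule)); eexists; apply segment_derive_t; eauto.
Qed.

Lemma homotopy_RInt_derive s : 0 <= s <= 1 ->
  is_derive (fun s => RInt (F s) 0 (2 * PI)) s (RInt (G s) 0 (2 * PI)).
Proof.
  intro Hs. destruct segment_in_disk as [eta He]. pose proof (cond_pos eta) as He0.
  assert (Hnear : forall s', Rabs (s' - s) < eta -> forall t, Cmod (X s' t, Y s' t) < 1).
  { intros s' H t. apply He. apply Rabs_def2 in H. lra. }
  assert (Hd : forall t, Cmod (X s t, Y s t) < 1) by (intro t; apply He; lra).
  rewrite <- (RInt_ext (V := R_CompleteNormedModule) (fun t => Derive (fun u => F u t) s) (G s)).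
  2:{ intros t _. apply is_derive_unique. now apply homotopy_derive. }
  apply (is_derive_RInt_param F 0 (2 * PI) s).
  - exists eta. intros s' Hs' t _. exists (G s' t). now apply homotopy_derive, Hnear.
  - intros t _. destruct (Hcr _ _ (Hd t)) as (_ & _ & Hp & Hq).
    apply continuity_2d_pt_ext_loc with G.
    { exists eta. intros u v Hu _. symmetry. apply is_derive_unique. now apply homotopy_derive, Hnear. }
    assert (CX : continuity_2d_pt X s t).
    { apply continuity_2d_pt_plus; [apply continuity_2d_pt_const|].
      apply continuity_2d_pt_mult; [apply continuity_2d_pt_id1|].
      apply continuity_2d_pt_snd. apply (ex_derive_continuous (K := R_AbsRing) (V := R_NormedModule)). auto_derive; auto. }
    assert (CY : continuity_2d_pt Y s t).
    { apply continuity_2d_pt_plus; [apply continuity_2d_pt_const|].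
      apply continuity_2d_pt_mult; [apply continuity_2d_pt_id1|].
      apply continuity_2d_pt_snd. apply (ex_derive_continuous (K := R_AbsRing) (V := R_NormedModule)). auto_derive; auto. }
    apply continuity_2d_pt_plus; apply continuity_2d_pt_mult.
    + now apply continuity_2d_pt_comp.
    + apply continuity_2d_pt_snd. apply (ex_derive_continuous (K := R_AbsRing) (V := R_NormedModule)). auto_derive; auto.
    + now apply continuity_2d_pt_comp.
    + apply continuity_2d_pt_snd. apply (ex_derive_continuous (K := R_AbsRing) (V := R_NormedModule)). auto_derive; auto.
  - exists eta. intros s' Hs'. apply (ex_RInt_continuous (V := R_CompleteNormedModule)).
    intros t _. now apply homotopy_continuous, Hnear.
Qed.

(* Contracting the circle to z0 along segments does not change the Cauchy integral. *)
Lemma cauchy_formula :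
  RInt (fun t => Re ((A (r * cos (1 * t)) (r * sin (1 * t)), B (r * cos (1 * t)) (r * sin (1 * t))) *
     cauchy_kernel z0 r t)%C) 0 (2 * PI) = 2 * PI * A (fst z0) (snd z0).
Proof.
  etransitivity; [|exact (cauchy_kernel_mean (A (fst z0) (snd z0), B (fst z0) (snd z0)) z0 r ltac:(lra) Hz)].
  destruct (MVT_gen (fun s => RInt (F s) 0 (2 * PI)) 0 1 (fun _ => 0)) as [c [_ Hc]].
  - rewrite Rmin_left, Rmax_right by lra. intros s Hs.
    assert (H := homotopy_RInt_derive s ltac:(lra)). now rewrite homotopy_derivative_zero in H by lra.
  - rewrite Rmin_left, Rmax_right by lra. intros s Hs.
    apply continuity_pt_filterlim.
    exact (ex_derive_continuous (K := R_AbsRing) (V := R_NormedModule) (fun s => RInt (F s) 0 (2 * PI)) s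
      (ex_intro _ _ (homotopy_RInt_derive s Hs))).
  - rewrite Rmult_0_l in Hc. apply Rminus_diag_uniq in Hc.
    etransitivity; [|etransitivity; [exact Hc|]]; apply RInt_ext; intros t _; unfold F, X, Y; f_equal; f_equal.
    + f_equal; f_equal; ring.
    + f_equal; f_equal; ring.
Qed.
End CauchyHomotopy.

(** * From the Cauchy integral to power series of harmonic functions *)

Lemma cint_Cmod_le h K : ccont h -> (forall t, 0 <= t <= 2 * PI -> Cmod (h t) <= K) ->
  Cmod (cint h) <= 8 * PI * K.
Proof.
  intros Hh HK. pose proof PI_RGT_0 as Hpi.
  destruct (ccont_ex_RInt h 0 (2 * PI) Hh) as [I1 I2].
  assert (HIm : forall z, Rabs (Im z) <= Cmod z).
  { intros z. eapply Rle_trans; [apply Rmax_r|apply (Rmax_Cmod z)]. }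
  assert (Hb : forall f, ex_RInt f 0 (2 * PI) -> (forall t, 0 <= t <= 2 * PI -> Rabs (f t) <= K) -> Rabs (RInt f 0 (2 * PI)) <= 2 * PI * K).
  { intros f Hf HfK. replace (2 * PI * K) with ((2 * PI - 0) * K) by ring.
    apply abs_RInt_le_const; auto. lra. }
  eapply Rle_trans; [apply Cmod_le_2max|].
  replace (8 * PI * K) with (2 * (2 * (2 * PI * K))) by ring.
  assert (0 <= K) by (eapply Rle_trans; [apply Cmod_ge_0|apply (HK 0); lra]).
  assert (0 <= PI * K) by (apply Rmult_le_pos; lra).
  apply Rmult_le_compat_l; [lra|]. apply Rle_trans with (2 * PI * K); [|lra]. apply Rmax_lub.
  - apply Hb; auto. intros t Ht. eapply Rle_trans; [apply re_le_Cmod|auto].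
  - apply Hb; auto. intros t Ht. eapply Rle_trans; [apply HIm|auto].
Qed.

(** This is [- i g]. It makes [B] a real part, to which the Cauchy formula applies. *)
Lemma cr_pair_rotate A B p q : cr_pair A B p q ->
  cr_pair B (fun x y => - A x y) (fun x y => - q x y) p.
Proof.
  intros H x y Hd. destruct (H x y Hd) as (HA & HB & Hp & Hq).
  split; [exact HB|]. split; [|split; [now apply continuity_2d_pt_opp|exact Hp]].
  intro eps. eapply locally_2d_impl; [|exact (HA eps)]. apply locally_2d_forall. intros u v Huv.
  replace (- A u v - - A x y - (- p x y * (u - x) + - q x y * (v - y))) with (- (A u v - A x y - (p x y * (u - x) + q x y * (v - y)))) by ring.
  now rewrite Rabs_Ropp.
Qed.

Lemma cr_pair_circle_ccont A B p q r : cr_pair A B p q -> 0 < r < 1 ->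
  ccont (fun t => (A (r * cos (1 * t)) (r * sin (1 * t)), B (r * cos (1 * t)) (r * sin (1 * t)))).
Proof.
  intros Hcr Hr t.
  assert (Hd : Cmod (r * cos (1 * t), r * sin (1 * t)) < 1).
  { replace (r * cos (1 * t), r * sin (1 * t)) with (r * cis (1 * t))%C.
    - rewrite Cmod_r_cis; lra.
    - unfold cis, Cmult, RtoC; simpl. f_equal; ring. }
  assert (Hc : forall f fx fy, differentiable_pt_lim f (r * cos (1 * t)) (r * sin (1 * t)) fx fy ->
     continuous (fun t => f (r * cos (1 * t)) (r * sin (1 * t))) t).
  { intros f fx fy Hf. apply (ex_derive_continuous (K := R_AbsRing) (V := R_NormedModule)).
    exists (fx * (- r * sin (1 * t)) + fy * (r * cos (1 * t))). apply is_derive_Reals.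
    apply (derivable_pt_lim_comp_2d f (fun t => r * cos (1 * t)) (fun t => r * sin (1 * t))); auto;
    apply is_derive_Reals; auto_derive; auto; ring. }
  destruct (Hcr _ _ Hd) as (HA & HB & _). split; unfold Re, Im; cbn [fst snd]; eapply Hc; eauto.
Qed.

(** The coefficients are the Fourier coefficients of [g] on the circle divided by [r ^ n]. The
    Cauchy estimate is recorded because, after dilation by [r], it gives convergence on the whole
    unit disk. *)
Lemma cr_pair_series A B p q r : cr_pair A B p q -> 0 < r < 1 ->
  exists c K, (forall n, Cmod (c n) * r ^ n <= K) /\ forall x y, Cmod (x, y) < r ->
    A x y = hser c (x, y) /\ B x y = hser (fun n => - Ci * c n)%C (x, y).
Proof.
  intros Hcr Hr. pose proof PI_RGT_0 as Hpi.
  assert (Hrn : RtoC r <> 0) by (intro E; apply RtoC_inj in E; lra).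
  assert (Hpn : RtoC (2 * PI) <> 0) by (intro E; apply RtoC_inj in E; lra).
  set (g := fun t => (A (r * cos (1 * t)) (r * sin (1 * t)), B (r * cos (1 * t)) (r * sin (1 * t))) : C).
  assert (Hg : ccont g) by exact (cr_pair_circle_ccont A B p q r Hcr Hr).
  set (h := fun n t => (g t * cis (- INR n * t))%C).
  assert (Hh : forall n, ccont (h n)) by (intro n; apply ccont_mult; auto; apply ccont_cis).
  set (c := fun n => (cint (h n) / (2 * PI)%R / r ^ n)%C).
  assert (Hpow : forall n (z : C), (c n * z ^ n = / (2 * PI)%R * ((z / r) ^ n * cint (h n)))%C).
  { intros n z. unfold c, Cdiv. rewrite Cpow_mult_l, Cpow_inv by auto. ring. }
  assert (HA : forall x y, Cmod (x, y) < r -> A x y = hser c (x, y)).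
  { intros x y Hz. assert (S1 := cauchy_kernel_series g (x, y) r Hg ltac:(lra) Hz).
    apply is_series_unique in S1.
    assert (S2 := eq_trans S1 (cauchy_formula A B p q (x, y) r Hcr Hr Hz)).
    unfold hser. rewrite (Series_ext _ (fun n => / (2 * PI) * Re (((x, y) / r) ^ n * cint (h n))%C)).
    - rewrite Series_scal_l. unfold h. rewrite S2. cbn [fst snd]. field. lra.
    - intro n. rewrite Hpow, <- RtoC_inv by lra. apply re_scal_l. }
  assert (HB : forall x y, Cmod (x, y) < r -> B x y = hser (fun n => - Ci * c n)%C (x, y)).
  { intros x y Hz. assert (Hcr' := cr_pair_rotate _ _ _ _ Hcr).
    set (g' := fun t => (B (r * cos (1 * t)) (r * sin (1 * t)), - A (r * cos (1 * t)) (r * sin (1 * t))) : C).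
    assert (Hg' : ccont g') by exact (cr_pair_circle_ccont _ _ _ _ r Hcr' Hr).
    assert (S1 := cauchy_kernel_series g' (x, y) r Hg' ltac:(lra) Hz).
    apply is_series_unique in S1.
    assert (S2 := eq_trans S1 (cauchy_formula B (fun x y => - A x y) _ _ (x, y) r Hcr' Hr Hz)).
    unfold hser. rewrite (Series_ext _ (fun n => / (2 * PI) * Re (((x, y) / r) ^ n * cint (fun t => g' t * cis (- INR n * t)))%C)).
    - rewrite Series_scal_l, S2. cbn [fst snd]. field. lra.
    - intro n.
      assert (E : cint (fun t => g' t * cis (- INR n * t))%C = (- Ci * cint (h n))%C).
      { destruct (ccont_ex_RInt (h n) 0 (2 * PI) (Hh n)) as [I1 I2].
        assert (E : forall t, (g' t * cis (- INR n * t) = - Ci * h n t)%C).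
        { intro t. unfold h. rewrite Cmult_assoc. f_equal. unfold g', g, Ci, Copp, Cmult; simpl. f_equal; ring. }
        unfold cint.
        rewrite (RInt_ext (fun t => Re (g' t * cis (- INR n * t))%C) (fun t => Im (h n t))).
        2:{ intros t _. rewrite E. unfold Ci, Copp, Cmult, Re, Im; simpl. ring. }
        rewrite (RInt_ext (fun t => Im (g' t * cis (- INR n * t))%C) (fun t => opp (Re (h n t)))).
        2:{ intros t _. rewrite E. unfold Ci, Copp, Cmult, Re, Im; simpl. unfold opp; simpl. ring. }
        rewrite (RInt_opp (V := R_CompleteNormedModule)) by auto.
        assert (Hci : forall a b : R, (b, - a) = (- Ci * (a, b))%C).
        { intros a b. unfold Ci, Copp, Cmult; simpl. f_equal; ring. }
        apply Hci. }
      rewrite E. rewrite <- Cmult_assoc, Hpow, <- RtoC_inv by lra.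
      replace (- Ci * ((/ (2 * PI))%R * (((x, y) / r) ^ n * cint (h n))))%C with ((/ (2 * PI))%R * (((x, y) / r) ^ n * (- Ci * cint (h n))))%C by ring.
      apply re_scal_l. }
  destruct (continuity_ab_maj (fun t => Cmod (g t)) 0 (2 * PI)) as [tm [Hm _]]; [lra| |].
  { intros t _. apply continuity_pt_filterlim. now apply ccont_Cmod. }
  exists c, (8 * PI * Cmod (g tm) / (2 * PI)). split; auto.
  intro n. unfold c, Cdiv. rewrite !Cmod_mult, !Cmod_inv, Cmod_pow, !Cmod_R, !Rabs_pos_eq by (auto using Cpow_nz; lra).
  rewrite (Rmult_assoc _ (/ r ^ n)), Rinv_l, Rmult_1_r by (apply pow_nonzero; lra).
  apply Rmult_le_compat_r; [apply Rlt_le, Rinv_0_lt_compat; lra|].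
  apply cint_Cmod_le; auto. intros t Ht. unfold h. rewrite Cmod_mult, Cmod_cis, Rmult_1_r. auto.
Qed.

Lemma partials_differentiable f fx x y fy :
  locally_2d (fun u v => is_derive (fun t => f t v) u (fx u v)) x y ->
  is_derive (fun t => f x t) y fy -> continuity_2d_pt fx x y ->
  differentiable_pt_lim f x y (fx x y) fy.
Proof.
  intros H1 H2 H3. apply filterdiff_differentiable_pt_lim.
  apply locally_2d_locally in H1. apply continuity_2d_pt_filterlim in H3.
  exact (is_derive_filterdiff f x y fx fy H1 H2 H3).
Qed.

(** One Cauchy-Riemann equation is Laplace's equation, the other is the equality of mixed
    derivatives ([Schwarz]). *)
Lemma harmonic_cr_pair u : harmonic_on unit_disk u ->
  cr_pair (dx u) (fun x y => - dy u x y) (dx (dx u)) (dy (dx u)).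
Proof.
  intros Hu x y Hd.
  assert (Hloc : locally_2d (fun a b => Cmod (a, b) < 1) x y) by now apply locally_2d_disk.
  destruct (Hu x y Hd) as (_ & _ & _ & e4 & _ & e6 & _ & _ & _ & c1 & c2 & c3 & c4 & Hlap).
  assert (HS : dx (dy u) x y = dy (dx u) x y).
  { apply (Schwarz u x y); [|exact c3|exact c2].
    eapply locally_2d_impl; [|exact Hloc]. apply locally_2d_forall. intros a b Hab.
    destruct (Hu a b Hab) as (X1 & X2 & X3 & X4 & X5 & X6 & _). auto. }
  split; [|split; [|split; auto]].
  - apply (partials_differentiable (dx u) (dx (dx u))); auto.
    + eapply locally_2d_impl; [|exact Hloc]. apply locally_2d_forall. intros a b Hab.
      apply Derive_correct. apply (Hu a b Hab).
    + now apply Derive_correct.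
  - assert (D := partials_differentiable (dy u) (dx (dy u)) x y (dy (dy u) x y)).
    assert (D' : differentiable_pt_lim (dy u) x y (dx (dy u) x y) (dy (dy u) x y)).
    { apply D; auto.
      + eapply locally_2d_impl; [|exact Hloc]. apply locally_2d_forall. intros a b Hab.
        apply Derive_correct. apply (Hu a b Hab).
      + now apply Derive_correct. }
    intro eps. eapply locally_2d_impl; [|exact (D' eps)]. apply locally_2d_forall. intros a b Hab.
    replace (- dy u a b - - dy u x y - (- dy (dx u) x y * (a - x) + dx (dx u) x y * (b - y)))
      with (- (dy u a b - dy u x y - (dx (dy u) x y * (a - x) + dy (dy u) x y * (b - y)))).
    + now rewrite Rabs_Ropp.
    + rewrite HS. replace (dy (dy u) x y) with (- dx (dx u) x y) by lra. ring.
Qed.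

Lemma zero_derivative_const f x : (forall t, Rabs t <= Rabs x -> is_derive f t 0) -> f x = f 0.
Proof.
  intro H.
  assert (Hin : forall t, Rmin 0 x <= t <= Rmax 0 x -> Rabs t <= Rabs x).
  { intros t. unfold Rmin, Rmax, Rabs. repeat destruct Rle_dec; repeat destruct Rcase_abs; lra. }
  destruct (MVT_gen f 0 x (fun _ => 0)) as [c [_ Hc]].
  - intros t Ht. apply H, Hin. lra.
  - intros t Ht. apply continuity_pt_filterlim. apply (ex_derive_continuous (K := R_AbsRing) (V := R_NormedModule)).
    exists 0. now apply H, Hin.
  - lra.
Qed.

Lemma Cmod_le_compat (a b a' b' : R) : Rabs a <= Rabs a' -> Rabs b <= Rabs b' -> Cmod (a, b) <= Cmod (a', b').
Proof.
  intros H1 H2. unfold Cmod; cbn [fst snd]. apply sqrt_le_1_alt.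
  apply Rplus_le_compat; rewrite <- !Rsqr_pow2; now apply Rsqr_le_abs_1.
Qed.

(** The Cauchy formula expands [u_x - i u_y] in [|z| < r]. The series is integrated term by term and
    dilated, so that it represents [u(r z)] on the unit disk. *)
Lemma harmonic_series u r : harmonic_on unit_disk u -> 0 < r < 1 ->
  exists c, conv_disk c /\ Im (c 0%nat) = 0 /\
    forall x y, Cmod (x, y) < 1 -> u (r * x) (r * y) = hser c (x, y).
Proof.
  intros Hu Hr.
  destruct (cr_pair_series _ _ _ _ r (harmonic_cr_pair u Hu) Hr) as [c [K [HK Hc]]].
  assert (Hrn : RtoC r <> 0) by (intro E; apply RtoC_inj in E; lra).
  set (d := fun n => match n with O => RtoC (u 0 0) | S m => (r ^ S m * c m / INR (S m))%C end).
  assert (HINR : forall m, RtoC (INR (S m)) <> 0).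
  { intros m E. apply RtoC_inj in E. revert E. apply not_0_INR. lia. }
  assert (Hd' : forall n, cderiv d n = (r ^ S n * c n)%C).
  { intro n. unfold cderiv, d. specialize (HINR n). field. auto. }
  assert (Hd : conv_disk d).
  { apply conv_disk_bounded with (Rmax (Rabs (u 0 0)) K). intros [|n]; simpl d.
    - rewrite Cmod_R. apply Rmax_l.
    - eapply Rle_trans; [|apply Rmax_r]. eapply Rle_trans; [|apply (HK n)].
      change (Cmod (r ^ S n * c n / INR (S n)) <= Cmod (c n) * r ^ n).
      unfold Cdiv. rewrite !Cmod_mult, Cmod_inv, Cmod_pow, !Cmod_R, (Rabs_pos_eq r), (Rabs_pos_eq (INR _)) by (auto using pos_INR; lra).
      assert (0 <= r ^ n) by (apply pow_le; lra). pose proof (Cmod_ge_0 (c n)).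
      assert (0 < / INR (S n) <= 1).
      { split; [apply Rinv_0_lt_compat, lt_0_INR; lia|]. rewrite <- Rinv_1. apply Rinv_le_contravar; [lra|].
        change 1 with (INR 1). apply le_INR; lia. }
      assert (0 <= Cmod (c n) * r ^ n) by (now apply Rmult_le_pos).
      replace (r ^ S n * Cmod (c n) * / INR (S n)) with ((Cmod (c n) * r ^ n) * (r * / INR (S n))) by (simpl pow; ring).
      rewrite <- (Rmult_1_r (Cmod (c n) * r ^ n)) at 2. apply Rmult_le_compat_l; auto. nra. }
  assert (Hin : forall x y, Cmod (x, y) < 1 -> Cmod (r * x, r * y) < r).
  { intros x y Hxy. replace (r * x, r * y) with (r * (x, y))%C.
    - rewrite Cmod_mult, Cmod_R, Rabs_pos_eq by lra. nra.
    - unfold Cmult, RtoC; simpl. f_equal; ring. }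
  assert (Hscale : forall w x y, hser (fun n => w * cderiv d n)%C (x, y) = r * hser (fun n => w * c n)%C (r * x, r * y)).
  { intros w x y. unfold hser. rewrite <- Series_scal_l. apply Series_ext. intro n.
    rewrite Hd', <- re_scal_l. f_equal. replace ((r * x, r * y) : C) with (r * (x, y))%C.
    - rewrite Cpow_mult_l, Cpow_S. ring.
    - unfold Cmult, RtoC; simpl. f_equal; ring. }
  assert (Hscal : forall t : R, is_derive (fun t => r * t) t r) by (intro t; auto_derive; auto; ring).
  (* The difference has zero gradient and vanishes at 0. It is constant along the vertical and then
     the horizontal segment towards 0, both of which stay in the disk. *)
  set (v := fun x y => u (r * x) (r * y) - hser d (x, y)).
  assert (Vx : forall x y, Cmod (x, y) < 1 -> is_derive (fun t => v t y) x 0).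
  { intros x y Hxy. specialize (Hin x y Hxy). destruct (Hc _ _ Hin) as [E1 _].
    destruct (Hu (r * x) (r * y)) as (X1 & _); [unfold unit_disk; lra|].
    assert (D1 := is_derive_comp (fun t => u t (r * y)) (fun t => r * t) x _ _ (Derive_correct _ _ X1) (Hscal x)).
    assert (D2 := differentiable_pt_lim_is_derive_x _ _ _ _ _ (hser_differentiable d x y Hd Hxy)).
    assert (D3 := is_derive_minus (K := R_AbsRing) (V := R_NormedModule) _ _ _ _ _ D1 D2).
    replace 0 with (minus (scal r (Derive (fun t => u t (r * y)) (r * x))) (hser (cderiv d) (x, y))); [exact D3|].
    change (Derive (fun t => u t (r * y)) (r * x)) with (dx u (r * x) (r * y)). rewrite E1.
    rewrite (hser_ext (cderiv d) (fun n => 1 * cderiv d n)%C) by (intro; ring). rewrite Hscale.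
    rewrite (hser_ext (fun n => 1 * c n)%C c) by (intro; ring).
    unfold minus, plus, opp, scal; simpl. unfold mult; simpl. ring. }
  assert (Vy : forall x y, Cmod (x, y) < 1 -> is_derive (fun t => v x t) y 0).
  { intros x y Hxy. specialize (Hin x y Hxy). destruct (Hc _ _ Hin) as [_ E1].
    destruct (Hu (r * x) (r * y)) as (_ & X1 & _); [unfold unit_disk; lra|].
    assert (D1 := is_derive_comp (fun t => u (r * x) t) (fun t => r * t) y _ _ (Derive_correct _ _ X1) (Hscal y)).
    assert (D2 := differentiable_pt_lim_is_derive_y _ _ _ _ _ (hser_differentiable d x y Hd Hxy)).
    assert (D3 := is_derive_minus (K := R_AbsRing) (V := R_NormedModule) _ _ _ _ _ D1 D2).
    replace 0 with (minus (scal r (Derive (fun t => u (r * x) t) (r * y))) (hser (fun n => Ci * cderiv d n)%C (x, y))); [exact D3|].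
    change (Derive (fun t => u (r * x) t) (r * y)) with (dy u (r * x) (r * y)).
    assert (E2 : dy u (r * x) (r * y) = hser (fun n => Ci * c n)%C (r * x, r * y)).
    { rewrite <- (Ropp_involutive (dy u _ _)), E1. unfold hser. rewrite <- Series_opp. apply Series_ext.
      intro n. rewrite <- re_opp. f_equal. ring. }
    rewrite E2, Hscale. unfold minus, plus, opp, scal; simpl. unfold mult; simpl. ring. }
  exists d. split; [auto|]. split; [reflexivity|].
  intros x y Hxy. apply Rminus_diag_uniq. change (v x y = 0).
  rewrite (zero_derivative_const (fun t => v x t) y).
  2:{ intros t Ht. apply Vy. eapply Rle_lt_trans; [apply Cmod_le_compat|exact Hxy]; auto. lra. }
  assert (H0 : Rabs 0 <= Rabs y) by (rewrite Rabs_R0; apply Rabs_pos).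
  rewrite (zero_derivative_const (fun t => v t 0) x).
  2:{ intros t Ht. apply Vx. eapply Rle_lt_trans; [apply Cmod_le_compat|exact Hxy]; auto. }
  unfold v. rewrite !Rmult_0_r. change (0, 0) with (RtoC 0). rewrite hser_0. simpl. unfold Re, RtoC; simpl. ring.
Qed.

(** * Inscribed convex polygons *)

Definition dot (z v : C) : R := fst z * fst v + snd z * snd v.

(** The point is the last exit of the ray: at the supremum of the times spent in [D], openness
    excludes membership, while points of [D] come arbitrarily close. *)
Lemma boundary_ray (D : C -> Prop) (z v : C) : Defs.open_set D -> bounded_set D -> D z -> Cmod v = 1 ->
  exists t, 0 <= t /\ in_boundary D (z + t * v)%C.
Proof.
  intros HO [B HB] Hz Hv.
  set (E := fun t => 0 <= t /\ D (z + t * v)%C).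
  assert (E0 : E 0). { split; [lra|]. replace (z + 0 * v)%C with z by ring. auto. }
  destruct (completeness E) as [t0 [Hub Hlub]].
  - exists (B + Cmod z). intros t [Ht HD].
    assert (Cmod (t * v)%C = t) by (rewrite Cmod_mult, Hv, Cmod_R, Rabs_pos_eq; lra).
    pose proof (Cmod_triangle (z + t * v)%C (- z)%C) as H1. replace (z + t * v + - z)%C with (t * v)%C in H1 by ring.
    rewrite Cmod_opp in H1. specialize (HB _ HD). lra.
  - exists 0. exact E0.
  - assert (Ht0 : 0 <= t0) by (apply Hub; exact E0).
    exists t0. split; auto. split.
    + intro HD. destruct (HO _ HD) as [e [He Hball]].
      assert (X : E (t0 + e / 2)).
      { split; [lra|]. apply Hball. unfold dist2.
        replace (z + (t0 + e / 2)%R * v - (z + t0 * v))%C with ((e / 2)%R * v)%C by (rewrite RtoC_plus; ring).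
        rewrite Cmod_mult, Hv, Cmod_R, Rabs_pos_eq; lra. }
      specialize (Hub _ X). lra.
    + intros eps He. apply NNPP. intro Hn.
      assert (X : t0 <= t0 - eps / 2); [|lra].
      apply Hlub. intros t [Ht HD]. apply Rnot_lt_le. intro Hlt. apply Hn.
      exists (z + t * v)%C. split; auto. unfold dist2.
      assert (t <= t0) by (apply Hub; split; auto).
      replace (z + t * v - (z + t0 * v))%C with ((t - t0)%R * v)%C by (rewrite RtoC_minus; ring).
      rewrite Cmod_mult, Hv, Cmod_R, Rabs_left1; lra.
Qed.

(** By separation, [z] lies in the convex hull of [l]. The form with linear functionals is the one
    that width estimates use. *)
Definition dominated (l : list C) (z : C) : Prop := forall v, exists y, In y l /\ dot z v <= dot y v.

Lemma dominated_trans l l' z : dominated l z -> (forall y, In y l -> dominated l' y) -> dominated l' z.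
Proof.
  intros H H' v. destruct (H v) as [y [Hy1 Hy2]]. destruct (H' y Hy1 v) as [y' [Hy3 Hy4]].
  exists y'. split; auto. lra.
Qed.

(** Each point lies between two boundary points on the horizontal line through it, and a linear
    functional is at least as large at one of the two. *)
Lemma boundary_cover (D : C -> Prop) l : Defs.open_set D -> bounded_set D -> (forall z, In z l -> D z) ->
  exists X, (forall y, In y X -> in_boundary D y) /\ forall z, In z l -> dominated X z.
Proof.
  intros HO HB. induction l as [|z l IH]; intro Hl.
  - exists nil. simpl. tauto.
  - destruct IH as [X [HX1 HX2]]. { intros; apply Hl; now right. }
    assert (Hz : D z) by (apply Hl; now left).
    destruct (boundary_ray D z 1 HO HB Hz Cmod_1) as [t1 [Ht1 B1]].
    destruct (boundary_ray D z (- (1)) HO HB Hz) as [t2 [Ht2 B2]]. { rewrite Cmod_opp; apply Cmod_1. }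
    exists ((z + t1 * 1)%C :: (z + t2 * - (1))%C :: X). split.
    + intros y [<-|[<-|Hy]]; auto.
    + intros y [<-|Hy] v.
      * destruct (Rle_lt_dec 0 (fst v)).
        -- exists (z + t1 * 1)%C. split; [now left|]. unfold dot; simpl. nra.
        -- exists (z + t2 * - (1))%C. split; [right; now left|]. unfold dot; simpl. nra.
      * destruct (HX2 y Hy v) as [y' [Hy1 Hy2]]. exists y'. split; auto. now right; right.
Qed.

(** No point lies in the convex hull of the others, so all of them are vertices of the hull. *)
Definition irreducible (S : list C) : Prop :=
  forall y, In y S -> ~ forall v, exists y', In y' S /\ y' <> y /\ dot y v <= dot y' v.

(** A redundant point is removed and the argument repeated on a shorter list; the hull does not
    shrink, as domination is transitive. *)
Lemma irreducible_sublist X : exists S, incl S X /\ NoDup S /\ irreducible S /\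
  forall z, In z X -> dominated S z.
Proof.
  remember (length X) as n eqn:Hn. revert X Hn.
  induction n as [n IH] using (well_founded_induction Nat.lt_wf_0). intros X Hn.
  destruct (classic (irreducible X)) as [Hirr|Hred].
  - exists (nodup Ceq_dec X). split; [|split; [|split]].
    + intros y Hy. now apply nodup_In in Hy.
    + apply NoDup_nodup.
    + intros y Hy Hv. apply nodup_In in Hy. apply (Hirr y Hy). intro v.
      destruct (Hv v) as [y' [Hy' ?]]. apply nodup_In in Hy'. eauto.
    + intros z Hz v. exists z. split; [now apply nodup_In|lra].
  - apply not_all_ex_not in Hred. destruct Hred as [y Hy].
    apply imply_to_and in Hy. destruct Hy as [Hy Hdom]. apply NNPP in Hdom.
    set (X' := remove Ceq_dec y X).
    assert (Hlen : (length X' < n)%nat) by (subst n; now apply remove_length_lt).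
    destruct (IH _ Hlen X' eq_refl) as [S [HS1 [HS2 [HS3 HS4]]]].
    exists S. split; [|split; [auto|split; auto]].
    + intros z Hz. apply HS1 in Hz. apply in_remove in Hz. tauto.
    + intros z Hz. apply dominated_trans with X'; auto. intro v.
      destruct (Ceq_dec z y) as [->|Hne].
      * destruct (Hdom v) as [y' [H1 [H2 H3]]]. exists y'. split; auto. now apply in_in_remove.
      * exists z. split; [now apply in_in_remove|lra].
Qed.

Definition orient (a b c : C) : R := cross (b - a)%C (c - a)%C.

Lemma orient_formula a b c : orient a b c =
  (fst b - fst a) * (snd c - snd a) - (snd b - snd a) * (fst c - fst a).
Proof. unfold orient, cross; simpl. ring. Qed.

(** The equations make [a] a convex combination of [b], [c], [d], so no functional is strictly
    largest at [a]. The three points may coincide, which covers combinations of two. *)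
Lemma irreducible_not_combination S a b c d l m n : irreducible S ->
  In a S -> In b S -> In c S -> In d S -> b <> a -> c <> a -> d <> a ->
  0 <= l -> 0 <= m -> 0 <= n -> 0 < l + m + n ->
  l * (fst b - fst a) + m * (fst c - fst a) + n * (fst d - fst a) = 0 ->
  l * (snd b - snd a) + m * (snd c - snd a) + n * (snd d - snd a) = 0 -> False.
Proof.
  intros Hirr Ha Hb Hc Hd Nb Nc Nd Hl Hm Hn Hs E1 E2.
  apply (Hirr a Ha). intro v. apply NNPP. intro Hno.
  assert (H : forall y, In y S -> y <> a -> dot y v < dot a v).
  { intros y Hy Hne. apply Rnot_le_lt. intro. apply Hno. eauto. }
  assert (Hb' := H b Hb Nb). assert (Hc' := H c Hc Nc). assert (Hd' := H d Hd Nd).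
  assert (E : l * (dot b v - dot a v) + m * (dot c v - dot a v) + n * (dot d v - dot a v) = 0).
  { unfold dot. transitivity (fst v * (l * (fst b - fst a) + m * (fst c - fst a) + n * (fst d - fst a)) + snd v * (l * (snd b - snd a) + m * (snd c - snd a) + n * (snd d - snd a))).
    - ring.
    - rewrite E1, E2. ring. }
  assert (P : forall s t, 0 <= s -> t < 0 -> s * t <= 0 /\ (0 < s -> s * t < 0)).
  { intros s t Hs' Ht. split; [nra|intro; nra]. }
  destruct (P l (dot b v - dot a v)) as [P1 Q1]; try lra.
  destruct (P m (dot c v - dot a v)) as [P2 Q2]; try lra.
  destruct (P n (dot d v - dot a v)) as [P3 Q3]; try lra.
Qed.

Lemma irreducible_not_collinear S a b c : irreducible S -> In a S -> In b S -> In c S ->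
  a <> b -> a <> c -> b <> c -> orient a b c <> 0.
Proof.
  intros Hirr Ha Hb Hc Hab Hac Hbc. rewrite orient_formula. intro Ho.
  set (u1 := fst b - fst a) in *. set (u2 := snd b - snd a) in *.
  set (w1 := fst c - fst a) in *. set (w2 := snd c - snd a) in *.
  assert (Hu : 0 < u1 * u1 + u2 * u2).
  { assert (0 <= u1 * u1) by apply Rle_0_sqr. assert (0 <= u2 * u2) by apply Rle_0_sqr.
    destruct (Req_dec (u1 * u1 + u2 * u2) 0) as [E|E]; [|lra].
    exfalso. apply Hab. destruct a, b; unfold u1, u2 in *; cbn [fst snd] in *. f_equal; nra. }
  set (n := u1 * u1 + u2 * u2) in *. set (k := w1 * u1 + w2 * u2).
  assert (E1 : n * w1 = k * u1).
  { apply Rminus_diag_uniq. transitivity (- u2 * (u1 * w2 - u2 * w1)); [unfold n, k; ring|rewrite Ho; ring]. }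
  assert (E2 : n * w2 = k * u2).
  { apply Rminus_diag_uniq. transitivity (u1 * (u1 * w2 - u2 * w1)); [unfold n, k; ring|rewrite Ho; ring]. }
  assert (F1 : fst c - fst b = w1 - u1) by (unfold w1, u1; ring).
  assert (F2 : snd c - snd b = w2 - u2) by (unfold w2, u2; ring).
  (* Since [c - a = (k / n) (b - a)], the position of [k] relative to 0 and [n] tells which of the
     three points lies between the other two. *)
  destruct (Rle_lt_dec k 0) as [Hk|Hk].
  - apply (irreducible_not_combination S a b c c (- k) n 0); auto; try lra; fold u1 u2 w1 w2; lra.
  - destruct (Rle_lt_dec k n) as [Hkn|Hkn].
    + apply (irreducible_not_combination S c a b b (n - k) k 0); auto; try lra.
      * replace (fst a - fst c) with (- w1) by (unfold w1; ring). replace (fst b - fst c) with (u1 - w1) by lra. lra.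
      * replace (snd a - snd c) with (- w2) by (unfold w2; ring). replace (snd b - snd c) with (u2 - w2) by lra. lra.
    + apply (irreducible_not_combination S b a c c (k - n) n 0); auto; try lra.
      * rewrite F1. replace (fst a - fst b) with (- u1) by (unfold u1; ring). lra.
      * rewrite F2. replace (snd a - snd b) with (- u2) by (unfold u2; ring). lra.
Qed.

(** The orientations say that [a] is inside the triangle [b c d], and they are its barycentric
    weights up to scaling. *)
Lemma irreducible_not_inside S a b c d : irreducible S -> In a S -> In b S -> In c S -> In d S ->
  0 < orient a b c -> 0 < orient a c d -> 0 < orient a d b -> False.
Proof.
  intros Hirr Ha Hb Hc Hd H1 H2 H3.
  assert (N : forall x y, 0 < orient a x y -> x <> a /\ y <> a).
  { intros x y H. rewrite orient_formula in H. split; intros ->; revert H; rewrite !Rminus_diag; lra. }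
  destruct (N _ _ H1), (N _ _ H2).
  apply (irreducible_not_combination S a b c d (orient a c d) (orient a d b) (orient a b c)); auto; try lra;
  rewrite !orient_formula; ring.
Qed.

Lemma strongly_sorted_insert (A : Type) (P : A -> Prop) (R : A -> A -> Prop) x l :
  (forall a b c, P a -> P b -> P c -> R a b -> R b c -> R a c) -> P x -> List.Forall P l ->
  (forall y, In y l -> R x y \/ R y x) -> StronglySorted R l ->
  exists l', Permutation (x :: l) l' /\ StronglySorted R l'.
Proof.
  intros Htr Hx. induction l as [|y l IH]; intros HP Htot Hs.
  - exists (x :: nil). split; auto. repeat constructor.
  - inversion HP; subst. inversion Hs; subst.
    destruct (Htot y (or_introl eq_refl)) as [Hxy|Hyx].
    + exists (x :: y :: l). split; auto. constructor; auto. constructor; auto.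
      rewrite Forall_forall in *. intros z Hz. apply Htr with y; auto.
    + destruct IH as [l' [Hp Hs']]; auto. { intros; apply Htot; now right. }
      exists (y :: l'). split.
      * eapply perm_trans; [apply perm_swap|]. now apply perm_skip.
      * constructor; auto. rewrite Forall_forall in *. intros z Hz.
        apply (Permutation_in z (Permutation_sym Hp)) in Hz. destruct Hz as [<-|Hz]; auto.
Qed.

(** Transitivity is assumed only on [P]: the angular order around a vertex is not transitive on the
    whole plane, but it is among the points of an irreducible set. *)
Lemma strongly_sorted_permutation (A : Type) (P : A -> Prop) (R : A -> A -> Prop) l :
  (forall a b c, P a -> P b -> P c -> R a b -> R b c -> R a c) -> List.Forall P l ->
  (forall x y, P x -> P y -> x <> y -> R x y \/ R y x) -> NoDup l ->
  exists l', Permutation l l' /\ StronglySorted R l'.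
Proof.
  intros Htr HP Htot Hnd. induction l as [|x l IH].
  - exists nil. split; constructor.
  - inversion HP; subst. inversion Hnd; subst. destruct IH as [l1 [Hp Hs]]; auto.
    assert (HP1 : List.Forall P l1) by (eapply Permutation_Forall; eauto).
    destruct (strongly_sorted_insert A P R x l1) as [l2 [Hp2 Hs2]]; auto.
    + intros y Hy. rewrite Forall_forall in HP1. apply Htot; auto.
      intros ->. apply (Permutation_in _ (Permutation_sym Hp)) in Hy. auto.
    + exists l2. split; auto. eapply perm_trans; [apply perm_skip, Hp|auto].
Qed.

Lemma strongly_sorted_nth (A : Type) (R : A -> A -> Prop) l d i j : StronglySorted R l ->
  (i < j < length l)%nat -> R (nth i l d) (nth j l d).
Proof.
  intro Hs. revert i j. induction Hs as [|x l Hs IH Hf]; intros i j Hij; simpl in *; [lia|].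
  destruct j as [|j]; [lia|]. destruct i as [|i].
  - rewrite Forall_forall in Hf. apply Hf, nth_In. lia.
  - apply IH. lia.
Qed.

(* Sort the points of S by angle around one of them; since no point of S lies in the convex hull of
   the others, this is a convex polygon. *)
Lemma irreducible_polygon S : irreducible S -> NoDup S -> (3 <= length S)%nat ->
  exists n x, ccw_convex_polygon n x /\ (forall i, (i < n)%nat -> In (x i) S) /\
    forall y, In y S -> exists i, (i < n)%nat /\ x i = y.
Proof.
  intros Hirr Hnd Hlen. destruct S as [|a0 T]; [simpl in Hlen; lia|].
  set (S := a0 :: T) in *. inversion Hnd as [|? ? Ha0 HndT]; subst.
  assert (HS0 : In a0 S) by now left.
  assert (HST : forall b, In b T -> In b S) by (intros; now right).
  assert (Hne0 : forall b, In b T -> a0 <> b) by (intros b Hb ->; auto).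
  assert (Otot : forall b c, In b T -> In c T -> b <> c -> 0 < orient a0 b c \/ 0 < orient a0 c b).
  { intros b c Hb Hc Hbc. pose proof (irreducible_not_collinear S a0 b c Hirr HS0 (HST _ Hb) (HST _ Hc) (Hne0 _ Hb) (Hne0 _ Hc) Hbc) as H.
    rewrite !orient_formula in *. lra. }
  (* A failure of transitivity would put [a0] inside the triangle [b c d]. *)
  assert (Otr : forall b c d, In b T -> In c T -> In d T -> 0 < orient a0 b c -> 0 < orient a0 c d -> 0 < orient a0 b d).
  { intros b c d Hb Hc Hd H1 H2.
    destruct (Ceq_dec b d) as [->|Hbd]. { exfalso. rewrite orient_formula in H1, H2. lra. }
    destruct (Otot b d Hb Hd Hbd) as [|H3]; auto. exfalso.
    apply (irreducible_not_inside S a0 b c d); auto. }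
  destruct (strongly_sorted_permutation C (fun b => In b T) (fun b c => 0 < orient a0 b c) T Otr) as [T' [Hp Hs]]; auto.
  { now apply Forall_forall. }
  assert (HT' : forall b, In b T' -> In b T) by (intros b Hb; eapply Permutation_in; [apply Permutation_sym, Hp|auto]).
  assert (HlenT : length T' = length T) by (symmetry; now apply Permutation_length).
  assert (HndT' : NoDup T') by (eapply Permutation_NoDup; eauto).
  set (l := a0 :: T'). set (x := fun i => nth i l (RtoC 0)).
  assert (Hll : length l = Datatypes.S (length T')) by reflexivity.
  assert (Htriple : forall i j k, (i < j)%nat -> (j < k)%nat -> (k < length l)%nat -> 0 < orient (x i) (x j) (x k)).
  { intros i j k Hij Hjk Hk. unfold x, l in *. simpl in Hk.
    destruct k as [|k]; [lia|]. destruct j as [|j]; [lia|]. 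
    assert (Rjk : 0 < orient a0 (nth j T' (RtoC 0)) (nth k T' (RtoC 0))) by (apply (strongly_sorted_nth C (fun b c => 0 < orient a0 b c)); auto; lia).
    destruct i as [|i]; [exact Rjk|]. simpl.
    assert (Rij : 0 < orient a0 (nth i T' (RtoC 0)) (nth j T' (RtoC 0))) by (apply (strongly_sorted_nth C (fun b c => 0 < orient a0 b c)); auto; lia).
    set (b := nth i T' (RtoC 0)) in *. set (c := nth j T' (RtoC 0)) in *. set (d := nth k T' (RtoC 0)) in *.
    assert (Hb : In b T) by (apply HT', nth_In; lia). assert (Hc : In c T) by (apply HT', nth_In; lia).
    assert (Hd : In d T) by (apply HT', nth_In; lia).
    assert (Rik := Otr b c d Hb Hc Hd Rij Rjk).
    assert (Hbc : b <> c) by (intro E; rewrite E, orient_formula in Rij; lra).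
    assert (Hbd : b <> d) by (intro E; rewrite E, orient_formula in Rik; lra).
    assert (Hcd : c <> d) by (intro E; rewrite E, orient_formula in Rjk; lra).
    pose proof (irreducible_not_collinear S b c d Hirr (HST _ Hb) (HST _ Hc) (HST _ Hd) Hbc Hbd Hcd) as Hn0.
    (* Otherwise the turn at [c] is clockwise, and [c] lies inside the triangle [a0 b d]. *)
    apply Rnot_le_lt. intro Hle.
    apply (irreducible_not_inside S c a0 b d); auto; rewrite !orient_formula in *; lra. }
  exists (length l), x. split; [|split].
  - split; [unfold S in Hlen; simpl in Hlen; lia|].
    intros i k Hi Hk Hki Hki1.
    change (0 < orient (x i) (x ((i + 1) mod length l)%nat) (x k)).
    (* [orient] is invariant under cyclic rotation, so the closing edge and the vertices of index
       below the edge reduce to increasing triples. *)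
    destruct (Nat.eq_dec (i + 1) (length l)) as [E|E].
    + rewrite E, Nat.Div0.mod_same in *.
      replace (orient (x i) (x 0%nat) (x k)) with (orient (x 0%nat) (x k) (x i)) by (rewrite !orient_formula; ring).
      apply Htriple; lia.
    + rewrite Nat.mod_small in * by lia. destruct (Nat.lt_ge_cases k i) as [Hlt|Hge].
      * replace (orient (x i) (x (i + 1)%nat) (x k)) with (orient (x k) (x i) (x (i + 1)%nat)) by (rewrite !orient_formula; ring).
        apply Htriple; lia.
      * apply Htriple; lia.
  - intros i Hi. assert (H : In (x i) l) by now apply nth_In. destruct H as [<-|H]; auto.
  - intros y Hy. assert (Hy' : In y l).
    { destruct Hy as [<-|Hy]; [now left|right]. eapply Permutation_in; eauto. }
    destruct (In_nth l y (RtoC 0) Hy') as [i [Hi E]]. eauto.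
Qed.

(** Three non-collinear points do not fit in the hull of fewer than three. For two points the
    functional normal to their segment would be constant on [p], [p + e], [p + e Ci], hence zero,
    and the two points would be equal. *)
Lemma dominated_noncollinear S p e : 0 < e -> NoDup S -> dominated S p ->
  dominated S (p + e)%C -> dominated S (p + e * Ci)%C -> (3 <= length S)%nat.
Proof.
  intros He Hnd H1 H2 H3. destruct S as [|a [|b [|c S]]]; simpl; try lia; exfalso.
  - destruct (H1 0) as [y [[] _]].
  - assert (X : forall z v, dominated (a :: nil) z -> dot z v <= dot a v).
    { intros z v H. destruct (H v) as [y [[<-|[]] Hy]]. auto. }
    pose proof (X _ (1, 0) H1) as A1. pose proof (X _ (-1, 0) H1) as A2. 
    pose proof (X _ (1, 0) H2) as A3. pose proof (X _ (-1, 0) H2) as A4.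
    unfold dot in *. simpl in *. lra.
  - set (v1 := - (snd b - snd a)). set (v2 := fst b - fst a).
    assert (X : forall z, dominated (a :: b :: nil) z -> dot z (v1, v2) = dot a (v1, v2)).
    { intros z H.
      assert (Eab : dot b (v1, v2) = dot a (v1, v2)) by (unfold dot, v1, v2; simpl; ring).
      assert (Y : forall v, dot b v = dot a v -> dot z v <= dot a v).
      { intros v Ev. destruct (H v) as [y [[<-|[<-|[]]] Hy]]; lra. }
      pose proof (Y (v1, v2) Eab) as Y1. pose proof (Y (- v1, - v2)) as Y2.
      unfold dot in *. simpl in *. lra. }
    pose proof (X _ H1) as X1. pose proof (X _ H2) as X2. pose proof (X _ H3) as X3.
    unfold dot in X1, X2, X3. simpl in X1, X2, X3.
    assert (V1 : v1 = 0) by (assert (e * v1 = 0) by lra; apply Rmult_integral in H; lra).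
    assert (V2 : v2 = 0) by (assert (e * v2 = 0) by lra; apply Rmult_integral in H; lra).
    inversion Hnd as [|? ? Hni _]; subst. apply Hni. left.
    unfold v1, v2 in *. destruct a, b; simpl in *. f_equal; lra.
Qed.

Lemma inscribed_polygon (D : C -> Prop) p l : Defs.open_set D -> bounded_set D -> D p ->
  (forall z, In z l -> D z) ->
  exists n x, ccw_convex_polygon n x /\ (forall i, (i < n)%nat -> in_boundary D (x i)) /\
    forall z v, In z l -> exists i, (i < n)%nat /\ dot z v <= dot (x i) v.
Proof.
  intros HO HB Hp Hl. destruct (HO p Hp) as [e0 [He0 Hball]].
  set (e := e0 / 2). assert (He : 0 < e) by (unfold e; lra).
  assert (Hb : forall w, Cmod w = 1 -> D (p + e * w)%C).
  { intros w Hw. apply Hball. unfold dist2. replace (p + e * w - p)%C with (e * w)%C by ring.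
    rewrite Cmod_mult, Hw, Cmod_R, Rabs_pos_eq; unfold e; lra. }
  (* The small triangle at [p] is added to the values so that the hull has at least three vertices,
     even for an empty list. *)
  destruct (boundary_cover D (p :: (p + e)%C :: (p + e * Ci)%C :: l) HO HB) as [X [HX1 HX2]].
  { intros z [<-|[<-|[<-|Hz]]]; auto.
    - replace (p + e)%C with (p + e * 1)%C by ring. apply Hb, Cmod_1.
    - apply Hb. rewrite <- (Cmult_1_r Ci), Cmod_Ci_mult. apply Cmod_1. }
  destruct (irreducible_sublist X) as [S [HS1 [HS2 [HS3 HS4]]]].
  assert (HS : forall z, In z (p :: (p + e)%C :: (p + e * Ci)%C :: l) -> dominated S z).
  { intros z Hz. apply dominated_trans with X; auto. }
  destruct (irreducible_polygon S HS3 HS2) as [n [x [P1 [P2 P3]]]].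
  { apply (dominated_noncollinear S p e He HS2); apply HS; simpl; auto. }
  exists n, x. split; [auto|split].
  - intros i Hi. apply HX1, HS1, P2, Hi.
  - intros z v Hz. destruct (HS z ltac:(simpl; auto) v) as [y [Hy1 Hy2]].
    destruct (P3 y Hy1) as [i [Hi E]]. exists i. split; auto. now rewrite E.
Qed.

(** * Widths and averages of absolute projections *)

(** A closed walk covers the distance between two of its positions at least twice, once in each
    direction. *)
Lemma closed_walk_width (y : nat -> R) n i k : (i < n)%nat -> (k < n)%nat ->
  2 * (y i - y k) <= psum (fun j => Rabs (y ((j + 1) mod n)%nat - y j)) n.
Proof.
  assert (H : forall i k, (i <= k)%nat -> (k < n)%nat ->
    2 * Rabs (y i - y k) <= psum (fun j => Rabs (y ((j + 1) mod n)%nat - y j)) n).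
  { intros a b Hab Hb. destruct n as [|m]; [lia|]. cbn [psum].
    set (P := psum (fun j => Rabs (y ((j + 1) mod S m)%nat - y j))).
    assert (Hstep : forall s t, (s + t <= m)%nat -> Rabs (y (s + t)%nat - y s) <= P (s + t)%nat - P s).
    { intros s t. induction t; intro Hst.
      - rewrite Nat.add_0_r, !Rminus_diag, Rabs_R0. lra.
      - replace (s + S t)%nat with (S (s + t)) by lia. unfold P. cbn [psum]. fold (P (s + t)%nat) (P s).
        rewrite (Nat.mod_small (s + t + 1)) by lia. replace (s + t + 1)%nat with (S (s + t)) by lia.
        specialize (IHt ltac:(lia)). fold P.
        revert IHt. unfold Rabs. repeat destruct Rcase_abs; intros; lra. }
    rewrite (Nat.add_1_r m), Nat.Div0.mod_same.
    assert (A1 := Hstep 0%nat a ltac:(lia)). assert (A2 := Hstep a (b - a)%nat ltac:(lia)).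
    assert (A3 := Hstep b (m - b)%nat ltac:(lia)).
    replace (a + (b - a))%nat with b in A2 by lia. replace (b + (m - b))%nat with m in A3 by lia.
    simpl Nat.add in A1. replace (P 0%nat) with 0 in A1 by reflexivity.
    revert A1 A2 A3. unfold Rabs. repeat destruct Rcase_abs; intros; lra. }
  intros Hi Hk. destruct (Nat.le_ge_cases i k) as [Hle|Hle].
  - specialize (H i k Hle Hk). pose proof (Rle_abs (y i - y k)). lra.
  - specialize (H k i Hle Hi). rewrite Rabs_minus_sym in H. pose proof (Rle_abs (y i - y k)). lra.
Qed.

(** A nonnegative angle is asked for because [sum_abs_cos] reduces it by a natural number of
    steps. *)
Lemma cis_polar (E : C) : exists g, 0 <= g /\ E = (Cmod E * cis g)%C.
Proof.
  destruct (Req_dec (Cmod E) 0) as [H0|H0].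
  - exists 0. split; [lra|]. rewrite H0. apply Cmod_eq_0 in H0. rewrite H0. ring.
  - pose proof (Cmod_ge_0 E) as Hp. pose proof (Cmod2_alt E) as H2.
    set (s := Cmod E) in *. set (a := Re E / s). set (b := Im E / s).
    assert (Hab : a ^ 2 + b ^ 2 = 1).
    { unfold a, b. replace ((Re E / s) ^ 2 + (Im E / s) ^ 2) with ((Re E ^ 2 + Im E ^ 2) / s ^ 2) by (field; auto).
      rewrite <- H2. field. auto. }
    assert (Ha : -1 <= a <= 1) by nra.
    assert (HE : forall g, cos g = a -> sin g = b -> E = (s * cis g)%C).
    { intros g H3 H4. unfold cis. rewrite H3, H4. unfold a, b. destruct E as [e1 e2]. unfold Re, Im, Cmult, RtoC; cbn [fst snd]. f_equal; field; auto. }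
    pose proof (acos_bound a) as Hbd.
    assert (Hsq : sqrt (1 - Rsqr a) = Rabs b).
    { rewrite <- sqrt_Rsqr_abs. f_equal. unfold Rsqr. lra. }
    destruct (Rle_lt_dec 0 b) as [Hb|Hb].
    + exists (acos a). split; [lra|]. apply HE; [now apply cos_acos|].
      rewrite sin_acos by auto. rewrite Hsq. apply Rabs_pos_eq; auto.
    + exists (2 * PI - acos a). split; [pose proof PI_RGT_0; lra|]. apply HE.
      * replace (2 * PI - acos a) with (- acos a + 2 * INR 1 * PI) by (simpl; ring).
        rewrite cos_period, cos_neg. now apply cos_acos.
      * replace (2 * PI - acos a) with (- acos a + 2 * INR 1 * PI) by (simpl; ring).
        rewrite sin_period, sin_neg, sin_acos by auto. rewrite Hsq, Rabs_left by auto. ring.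
Qed.

(* The sum is invariant under [x -> x - PI / m], so all the cosines may be assumed nonnegative. *)
Lemma sum_abs_cos x m : (0 < m)%nat -> 0 <= x ->
  sin (PI / INR m / 2) * psum (fun j => Rabs (cos (x - INR j * (PI / INR m)))) m <= 1.
Proof.
  intros Hm Hx. pose proof PI_RGT_0 as Hpi.
  assert (HM : 0 < INR m) by now apply lt_0_INR.
  set (h := PI / INR m). assert (Hh : 0 < h) by (apply Rdiv_lt_0_compat; lra).
  assert (Hmh : INR m * h = PI) by (unfold h; field; lra).
  set (c := fun x => psum (fun j => Rabs (cos (x - INR j * h))) m).
  assert (Hshift : forall x, c (x - h) = c x).
  { intro y. unfold c.
    rewrite (psum_ext (fun j => Rabs (cos (y - h - INR j * h))) (fun j => Rabs (cos (y - INR (1 + j) * h)))).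
    2:{ intros j _. do 2 f_equal. rewrite plus_INR. simpl. ring. }
    assert (E1 := psum_add (fun j => Rabs (cos (y - INR j * h))) 1 m).
    assert (E2 := psum_add (fun j => Rabs (cos (y - INR j * h))) m 1).
    rewrite (Nat.add_comm 1 m), E2 in E1. cbn [psum] in E1. rewrite Nat.add_0_r in E1. change (INR 0) with 0 in E1.
    assert (E3 : Rabs (cos (y - INR m * h)) = Rabs (cos (y - 0 * h))).
    { rewrite Hmh. replace (y - 0 * h) with y by ring.
      rewrite <- (Rabs_Ropp (cos y)), <- neg_cos, <- (cos_period (y - PI) 1). do 2 f_equal. simpl. ring. }
    lra. }
  assert (Hshift' : forall k x, c (x - INR k * h) = c x).
  { induction k; intro y.
    - f_equal. simpl. ring.
    - rewrite <- (IHk y), <- (Hshift (y - INR k * h)). f_equal. rewrite S_INR. ring. }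
  (* In this window all the angles lie in [[- PI / 2, PI / 2]]; the absolute values drop and the
     telescoped sum is exactly [sin (y + h / 2)]. *)
  assert (Hbase : forall y, PI / 2 - h <= y <= PI / 2 -> sin (h / 2) * c y <= 1).
  { intros y Hy. unfold c.
    rewrite (psum_ext _ (fun j => cos (y + INR j * - h))).
    - assert (E := cos_arith_sum y (- h) m).
      replace (- h / 2) with (- (h / 2)) in E by field. rewrite sin_neg in E.
      replace (y + INR m * - h - - (h / 2)) with (y + h / 2 - PI) in E by lra.
      replace (y - - (h / 2)) with (y + h / 2) in E by ring.
      rewrite (sin_minus _ PI), cos_PI, sin_PI in E.
      pose proof (SIN_bound (y + h / 2)). lra.
    - intros j Hj. replace (y - INR j * h) with (y + INR j * - h) by ring. apply Rabs_pos_eq.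
      assert (0 <= INR j * h <= PI - h).
      { pose proof (pos_INR j). split; [apply Rmult_le_pos; lra|].
        rewrite <- Hmh. assert (INR j + 1 <= INR m) by (rewrite <- S_INR; apply le_INR; lia). nra. }
      apply cos_ge_0; lra. }
  fold (c x). change (sin (h / 2) * c x <= 1).
  assert (Hxp : c (x + 2 * PI) = c x).
  { rewrite <- (Hshift' (2 * m)%nat (x + 2 * PI)). f_equal. rewrite mult_INR. simpl. rewrite Rmult_assoc. lra. }
  (* Adding [2 PI] makes the number of steps of length [h] down to the window nonnegative. *)
  destruct (nfloor_ex ((x + 2 * PI - (PI / 2 - h)) / h)) as [k [K1 K2]].
  { apply Rmult_le_pos; [lra|]. apply Rlt_le, Rinv_0_lt_compat; auto. }
  rewrite <- Hxp, <- (Hshift' k). apply Hbase.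
  set (q := (x + 2 * PI - (PI / 2 - h)) / h) in *.
  assert (Hq : x + 2 * PI - (PI / 2 - h) = q * h) by (unfold q; field; lra).
  assert (INR k * h <= q * h) by (apply Rmult_le_compat_r; lra).
  assert (q * h <= (INR k + 1) * h) by (apply Rmult_le_compat_r; lra). lra.
Qed.

(** A discrete Cauchy-Crofton estimate: averaged over [m] directions of a half turn, the projections
    of a vector have length at most [|E| / (m sin (PI / (2 m)))], which tends to [2 |E| / PI]. *)
Lemma sum_abs_Re_roots (E : C) m : (0 < m)%nat ->
  sin (PI / INR m / 2) * psum (fun j => Rabs (Re (E * Cconj (cis (INR j * (PI / INR m))))%C)) m <= Cmod E.
Proof.
  intro Hm. destruct (cis_polar E) as [g [Hg HE]].
  rewrite (psum_ext _ (fun j => Cmod E * Rabs (cos (g - INR j * (PI / INR m))))).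
  - rewrite psum_scal_l. assert (H := sum_abs_cos g m Hm Hg). pose proof (Cmod_ge_0 E).
    rewrite <- Rmult_assoc, (Rmult_comm _ (Cmod E)), Rmult_assoc.
    rewrite <- (Rmult_1_r (Cmod E)) at 2. now apply Rmult_le_compat_l.
  - intros j _. rewrite HE at 1. rewrite Cconj_cis, <- Cmult_assoc, <- cis_plus, re_scal_l, Rabs_mult.
    rewrite Rabs_pos_eq by apply Cmod_ge_0. reflexivity.
Qed.

(** * Extremal maps *)

Lemma polygon_length_psum n x : (0 < n)%nat ->
  polygon_length n x = psum (fun i => dist2 (x ((i + 1) mod n)%nat) (x i)) n.
Proof.
  intro Hn. unfold polygon_length. rewrite <- psum_sum_f_R0. f_equal. lia.
Qed.

(* Pairing opposite directions turns the sum into a sum of widths of the polygon, each of which is at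
   most half the total variation of the boundary in that direction. *)
Lemma roots_polygon_bound (D : C -> Prop) p (f : nat -> C) (a b : C) m :
  Defs.open_set D -> bounded_set D -> D p -> (0 < m)%nat ->
  (forall j, (j < 2 * m)%nat -> D (f j)) ->
  (forall e1 e2 : R, Cmod (e1 * a + e2 * b)%C = Cmod (e1, e2)) ->
  exists n x, ccw_convex_polygon n x /\ (forall i, (i < n)%nat -> in_boundary D (x i)) /\
    sin (PI / INR m / 2) *
      psum (fun j => fst (f j) * Re (a * Cconj (cis (INR j * (2 * PI / INR (2 * m)))))%C +
                     snd (f j) * Re (b * Cconj (cis (INR j * (2 * PI / INR (2 * m)))))%C) (2 * m)
      <= polygon_length n x / 2.
Proof.
  intros HO HB Hp Hm Hf Hiso. pose proof PI_RGT_0 as Hpi.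
  assert (HM : 0 < INR m) by now apply lt_0_INR.
  assert (Hang : forall j, INR j * (2 * PI / INR (2 * m)) = INR j * (PI / INR m)).
  { intro j. rewrite mult_INR. simpl INR. field. lra. }
  set (u := fun j => (Re (a * Cconj (cis (INR j * (PI / INR m))))%C, Re (b * Cconj (cis (INR j * (PI / INR m))))%C) : C).
  destruct (inscribed_polygon D p (map f (seq 0 (2 * m))) HO HB Hp) as [n [x [Hpoly [Hbd Hdom]]]].
  { intros z Hz. apply in_map_iff in Hz. destruct Hz as [j [<- Hj]]. apply in_seq in Hj. apply Hf. lia. }
  exists n, x. split; [auto|split; [auto|]].
  assert (Hn : (0 < n)%nat) by (destruct Hpoly; lia).
  rewrite (psum_ext _ (fun j => dot (f j) (u j))).
  2:{ intros j _. unfold dot, u. cbn [fst snd]. now rewrite Hang. }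
  assert (Hopp : forall j, u (m + j)%nat = (- u j)%C).
  { intro j. unfold u. rewrite plus_INR.
    replace ((INR m + INR j) * (PI / INR m)) with (PI + INR j * (PI / INR m)) by (field; lra).
    assert (E : Cconj (cis (PI + INR j * (PI / INR m))) = (- Cconj (cis (INR j * (PI / INR m))))%C).
    { unfold cis, Cconj, Copp; cbn [fst snd]. rewrite (Rplus_comm PI), neg_cos, neg_sin. reflexivity. }
    rewrite E. unfold Copp at 3. cbn [fst snd]. rewrite <- !re_opp. f_equal; f_equal; ring. }
  assert (HDom : forall j, (j < 2 * m)%nat -> forall v, exists i, (i < n)%nat /\ dot (f j) v <= dot (x i) v).
  { intros j Hj v. apply Hdom. apply in_map. apply in_seq. lia. }
  assert (Hpair : forall j, (j < m)%nat -> dot (f j) (u j) + dot (f (m + j)%nat) (u (m + j)%nat) <=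
     psum (fun k => / 2 * Rabs (dot (x ((k + 1) mod n)%nat) (u j) - dot (x k) (u j))) n).
  { intros j Hj. rewrite Hopp.
    destruct (HDom j ltac:(lia) (u j)) as [i [Hi Hdi]].
    destruct (HDom (m + j)%nat ltac:(lia) (- u j)%C) as [k [Hk Hdk]].
    assert (W := closed_walk_width (fun k => dot (x k) (u j)) n i k Hi Hk).
    rewrite psum_scal_l. cbv beta in W.
    assert (E : dot (x k) (- u j)%C = - dot (x k) (u j)) by (unfold dot, Copp; cbn [fst snd]; ring). lra. }
  replace (2 * m)%nat with (m + m)%nat by lia. rewrite psum_add, <- psum_plus.
  assert (Hsin : 0 < sin (PI / INR m / 2)).
  { assert (0 < / INR m) by now apply Rinv_0_lt_compat.
    assert (/ INR m <= 1). { rewrite <- Rinv_1. apply Rinv_le_contravar; [lra|]. change 1 with (INR 1). apply le_INR; lia. }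
    apply sin_gt_0; unfold Rdiv; nra. }
  apply Rle_trans with (sin (PI / INR m / 2) * psum (fun j => psum (fun k => / 2 * Rabs (dot (x ((k + 1) mod n)%nat) (u j) - dot (x k) (u j))) n) m).
  { apply Rmult_le_compat_l; [lra|]. now apply psum_le. }
  rewrite psum_swap, <- psum_scal_l, polygon_length_psum by auto.
  replace (psum (fun i => dist2 (x ((i + 1) mod n)%nat) (x i)) n / 2) with
    (psum (fun i => / 2 * dist2 (x ((i + 1) mod n)%nat) (x i)) n) by (rewrite psum_scal_l; field).
  apply psum_le. intros k _.
  rewrite psum_scal_l, <- Rmult_assoc, (Rmult_comm (sin _) (/ 2)), Rmult_assoc.
  apply Rmult_le_compat_l; [lra|]. unfold dist2.
  set (e := (x ((k + 1) mod n)%nat - x k)%C).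
  (* The projections of the edge [e] on the directions [u j] are those of [fst e * a + snd e * b] on
     the roots of unity, and this vector has the length of [e]. *)
  rewrite (surjective_pairing e), <- Hiso.
  rewrite (psum_ext _ (fun j => Rabs (Re ((fst e * a + snd e * b) * Cconj (cis (INR j * (PI / INR m))))%C))).
  - now apply sum_abs_Re_roots.
  - intros j _. f_equal. rewrite Cmult_plus_distr_r, <- !Cmult_assoc, re_plus, !re_scal_l.
    unfold dot, u, e, Cminus, Cplus, Copp. cbn [fst snd]. ring.
Qed.

(* Since [d 1 = +- i c 1], the differential is [|c 1|] times an isometry, which is undone by [(a, b)]. *)
Lemma conformal_frame (c1 d1 : C) : (c1 * c1 + d1 * d1 = 0)%C ->
  exists a b : C, (forall e1 e2 : R, Cmod (e1 * a + e2 * b)%C = Cmod (e1, e2)) /\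
    Re (c1 * a)%C + Re (d1 * b)%C = 2 * Cmod c1.
Proof.
  intro H.
  assert (HCi : (Ci * Ci = - (1))%C) by (unfold Ci, Cmult, Copp, RtoC; simpl; f_equal; ring).
  assert (Hiso : forall (w s : C) (e1 e2 : R), Cmod w = 1 -> s = Ci \/ s = (- Ci)%C -> Cmod (w * (e1 + s * e2))%C = Cmod (e1, e2)).
  { intros w s e1 e2 Hw Hs. rewrite Cmod_mult, Hw, Rmult_1_l. unfold Cmod. f_equal.
    destruct Hs as [-> | ->]; unfold Ci, Copp, Cplus, Cmult, RtoC; cbn [fst snd]; ring. }
  assert (Hd : exists s, (s = Ci \/ s = (- Ci)%C) /\ (d1 = s * c1)%C).
  { assert (E : ((d1 - Ci * c1) * (d1 + Ci * c1) = 0)%C).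
    { transitivity (d1 * d1 - (Ci * Ci) * (c1 * c1))%C; [ring|]. rewrite HCi, <- H. ring. }
    assert (E' : (d1 - Ci * c1 = 0 \/ d1 + Ci * c1 = 0)%C).
    { apply NNPP. intro Hn. apply not_or_and in Hn. now apply (Cmult_neq_0 (d1 - Ci * c1)%C (d1 + Ci * c1)%C). }
    destruct E' as [E'|E'].
    - exists Ci. split; auto. transitivity (d1 - Ci * c1 + Ci * c1)%C; [ring|rewrite E'; ring].
    - exists (- Ci)%C. split; auto. transitivity (d1 + Ci * c1 - Ci * c1)%C; [ring|rewrite E'; ring]. }
  destruct Hd as [s [Hs ->]].
  assert (Hss : (s * Cconj s = 1)%C).
  { destruct Hs as [-> | ->]; unfold Ci, Cconj, Copp, Cmult, RtoC; simpl; f_equal; ring. }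
  assert (Hw : exists w, Cmod w = 1 /\ Re (c1 * w)%C = Cmod c1).
  { destruct (cis_polar c1) as [g [_ Hg]]. exists (cis (- g)). split; [apply Cmod_cis|].
    rewrite Hg at 1. rewrite <- Cmult_assoc, <- cis_plus, Rplus_opp_r, cis_0, Cmult_1_r. reflexivity. }
  destruct Hw as [w [Hw1 Hw2]].
  (* With [w] of modulus 1 turning [c1] to the positive axis, [Cconj s] cancels the factor [s] of
     [d1], and both products equal [|c1|]. *)
  exists w, (Cconj s * w)%C. split.
  - intros e1 e2. replace (e1 * w + e2 * (Cconj s * w))%C with (w * (e1 + Cconj s * e2))%C by ring.
    apply Hiso; auto. destruct Hs as [-> | ->]; [right|left]; unfold Ci, Cconj, Copp; simpl; f_equal; ring.
  - replace (s * c1 * (Cconj s * w))%C with (s * Cconj s * (c1 * w))%C by ring.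
    rewrite Hss, Cmult_1_l, Hw2. ring.
Qed.

Lemma adm_coef_perimeter D p c d : Defs.open_set D -> bounded_set D -> D p -> adm_coef D p c d ->
  Rbar_le (Cmod (c 1%nat)) (Rbar_mult (Finite (/ (2 * PI))) (Per D)).
Proof.
  intros HO HB Hp (Hc & Hd & HD & _ & Hconf & _). pose proof PI_RGT_0 as Hpi.
  destruct (conformal_frame _ _ Hconf) as [a [b [Hiso Hab]]].
  assert (Hub := proj1 (Lub_Rbar_correct (fun L => exists n x, ccw_convex_polygon n x /\
                      (forall i, (i < n)%nat -> in_boundary D (x i)) /\ L = polygon_length n x))).
  change (is_ub_Rbar (fun L => exists n x, ccw_convex_polygon n x /\
                      (forall i, (i < n)%nat -> in_boundary D (x i)) /\ L = polygon_length n x) (Per D)) in Hub.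
  assert (Hpos : 0 < / (2 * PI)) by (apply Rinv_0_lt_compat; lra).
  (* An infinite perimeter makes the bound trivial; minus infinity is excluded by the existence of
     an inscribed polygon. *)
  destruct (Per D) as [P| |].
  2:{ simpl. destruct (Rle_dec 0 (/ (2 * PI))) as [Hle|Hle]; [|lra].
      destruct (Rle_lt_or_eq_dec 0 (/ (2 * PI)) Hle); simpl; [auto|lra]. }
  2:{ exfalso. destruct (inscribed_polygon D p nil HO HB Hp) as [n [x [H1 [H2 _]]]]; [intros z []|].
      apply (Hub (polygon_length n x)). eauto. }
  simpl. apply Rle_trans with (1 * Cmod (c 1%nat)); [lra|].
  apply (continuity_le_left1 (fun r => r * Cmod (c 1%nat))).
  { apply continuity_pt_mult; [apply continuity_pt_id|]. apply continuity_pt_const. now intros ? ?. }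
  intros r Hr.
  assert (L1 := hser_average c r 1 a Hc ltac:(lra)). assert (L2 := hser_average d r 1 b Hd ltac:(lra)).
  assert (L := is_lim_seq_plus' _ _ _ _ L1 L2).
  assert (Ev : circle_pairing 1 (c 1%nat * r ^ 1) a + circle_pairing 1 (d 1%nat * r ^ 1) b = r * Cmod (c 1%nat)).
  { unfold circle_pairing. rewrite Cpow_1_r.
    replace (c 1%nat * r * a)%C with (r * (c 1%nat * a))%C by ring.
    replace (d 1%nat * r * b)%C with (r * (d 1%nat * b))%C by ring.
    rewrite !re_scal_l. replace (Cmod (c 1%nat)) with ((Re (c 1%nat * a)%C + Re (d 1%nat * b)%C) / 2) by lra. field. }
  rewrite Ev in L.
  (* Only even numbers of roots [S (2 k + 1) = 2 S k] are kept, so that each direction has its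
     opposite. *)
  assert (Lphi : filterlim (fun k => (2 * k + 1)%nat) eventually eventually).
  { intros Q [N HN]. exists N. intros k Hk. apply HN. lia. }
  apply (is_lim_seq_subseq _ _ _ Lphi) in L.
  set (y := fun k => PI / INR (S k) / 2).
  assert (Hy : forall k, 0 < y k).
  { intro k. unfold y. apply Rdiv_lt_0_compat; [|lra]. apply Rdiv_lt_0_compat; auto. apply lt_0_INR; lia. }
  assert (Ly : is_lim_seq y 0).
  { assert (X : is_lim_seq (fun k => PI / 2 * / INR (S k)) (PI / 2 * 0)).
    { apply is_lim_seq_mult'; [apply is_lim_seq_const|].
      assert (Hinf : is_lim_seq (fun k => INR (S k)) p_infty) by (apply (is_lim_seq_incr_1 INR), is_lim_seq_INR).
      apply (is_lim_seq_inv _ _ Hinf). discriminate. }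
    rewrite Rmult_0_r in X. eapply is_lim_seq_ext; [|exact X].
    intro k. unfold y. field. apply not_0_INR; lia. }
  (* The polygon bound carries [sin (y k)]. Since [2 (S k) y k = PI], multiplying the average by
     [sin (y k) / y k] gives [/ PI * sin (y k)] times the sum, with the same limit as the
     average. *)
  assert (Ls : is_lim_seq (fun k => sin (y k) / y k) 1).
  { apply (is_lim_comp_seq (fun x => sin x / x) y 0 1).
    - apply is_lim_sinc_0.
    - exists 0%nat. intros k _ E. injection E as E. specialize (Hy k). lra.
    - exact Ly. }
  assert (LL := is_lim_seq_mult' _ _ _ _ Ls L).
  rewrite Rmult_1_l in LL.
  change (Rbar_le (r * Cmod (c 1%nat)) (/ (2 * PI) * P)).
  refine (is_lim_seq_le _ (fun _ => / (2 * PI) * P) _ _ _ LL (is_lim_seq_const _)).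
  intro k. cbv beta.
  replace (S (2 * k + 1)) with (2 * S k)%nat by lia.
  rewrite <- Rmult_plus_distr_l, <- psum_plus.
  set (f := fun j => hmap c d (circle_pt r (2 * S k) j)).
  destruct (roots_polygon_bound D p f a b (S k) HO HB Hp ltac:(lia)) as [n [x [H1 [H2 H3]]]]; auto.
  { intros j _. apply HD. rewrite Cmod_circle_pt; lra. }
  assert (HL : polygon_length n x <= P) by (apply (Hub (polygon_length n x)); eauto).
  rewrite (psum_ext _ (fun j => fst (f j) * Re (a * Cconj (cis (INR j * (2 * PI / INR (2 * S k)))))%C +
                     snd (f j) * Re (b * Cconj (cis (INR j * (2 * PI / INR (2 * S k)))))%C)).
  2:{ intros j _. now rewrite !Cpow_1_r. }
  set (Sg := psum _ _) in *. fold (y k) in H3. specialize (Hy k).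
  assert (HN : 0 < INR (S k)) by (apply lt_0_INR; lia).
  replace (sin (y k) / y k * (/ INR (2 * S k) * Sg)) with (/ PI * (sin (y k) * Sg)).
  - replace (/ (2 * PI) * P) with (/ PI * (P / 2)) by (field; lra).
    apply Rmult_le_compat_l; [apply Rlt_le, Rinv_0_lt_compat; auto|]. lra.
  - rewrite mult_INR. change (INR 2) with (1 + 1). unfold y at 3. field. repeat split; lra.
Qed.

(** * Conformal differentials, and the passage between maps and coefficients *)

Lemma conformal_equations M : conformal M ->
  m11 M ^ 2 + m21 M ^ 2 = m12 M ^ 2 + m22 M ^ 2 /\ m11 M * m12 M + m21 M * m22 M = 0.
Proof.
  intros (s & a & b & c & d & Hs & E1 & E2 & E3 & -> & -> & -> & ->). split.
  - transitivity (s ^ 2 * (a * a + c * c)); [ring|]. rewrite E1, <- E2. ring.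
  - transitivity (s ^ 2 * (a * b + c * d)); [ring|]. rewrite E3. ring.
Qed.

Lemma equations_conformal M :
  m11 M ^ 2 + m21 M ^ 2 = m12 M ^ 2 + m22 M ^ 2 -> m11 M * m12 M + m21 M * m22 M = 0 -> conformal M.
Proof.
  destruct M as [a b c d]. simpl. intros E1 E2.
  set (s := sqrt (a ^ 2 + c ^ 2)).
  assert (Hs2 : s * s = a ^ 2 + c ^ 2) by (apply sqrt_sqrt; nra).
  assert (Hs : 0 <= s) by apply sqrt_pos.
  (* With scale 0 the matrix is zero and the identity serves as orthogonal factor. *)
  destruct (Req_dec s 0) as [H0|H0].
  - rewrite H0 in Hs2.
    assert (a = 0 /\ b = 0 /\ c = 0 /\ d = 0) as (-> & -> & -> & ->) by (repeat split; nra).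
    exists 0, 1, 0, 0, 1. simpl. repeat split; ring || lra.
  - exists s, (a / s), (b / s), (c / s), (d / s). simpl. split; auto.
    repeat split; try (field; auto).
    + replace (a / s * (a / s) + c / s * (c / s)) with ((a ^ 2 + c ^ 2) / (s * s)) by (field; auto).
      rewrite <- Hs2. field; auto.
    + replace (b / s * (b / s) + d / s * (d / s)) with ((b * (b * 1) + d * (d * 1)) / (s * s)) by (field; auto).
      rewrite <- E1, Hs2. field. rewrite <- Hs2. now apply Rmult_integral_contrapositive.
    + replace (a / s * (b / s) + c / s * (d / s)) with ((a * b + c * d) / (s * s)) by (field; auto).
      rewrite E2. field; auto.
Qed.

Lemma opnorm_conformal M : conformal M -> opnorm M = Finite (sqrt (m11 M ^ 2 + m21 M ^ 2)).
Proof.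
  intro H. destruct (conformal_equations M H) as [E1 E2].
  assert (Hv : forall v1 v2, v1 * v1 + v2 * v2 = 1 ->
     (m11 M * v1 + m12 M * v2) ^ 2 + (m21 M * v1 + m22 M * v2) ^ 2 = m11 M ^ 2 + m21 M ^ 2).
  { intros v1 v2 Hv. transitivity ((m11 M ^ 2 + m21 M ^ 2) * (v1 * v1) + (m12 M ^ 2 + m22 M ^ 2) * (v2 * v2) + 2 * v1 * v2 * (m11 M * m12 M + m21 M * m22 M)); [ring|].
    rewrite <- E1, E2. replace (v2 * v2) with (1 - v1 * v1) by lra. ring. }
  apply is_lub_Rbar_unique. split.
  - intros r (v1 & v2 & Hu & ->). rewrite Hv by auto. simpl. lra.
  - intros l Hl. apply Hl. exists 1, 0. split; [ring|]. rewrite Hv by ring. reflexivity.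
Qed.

(** The norm of the differential is the length of its first column [(u_x, v_x)], while [|c 1|] is
    the length of its first row [(u_x, u_y)]; this identifies the two. *)
Lemma orthogonal_columns_offdiag a b a' b' :
  a ^ 2 + a' ^ 2 = b ^ 2 + b' ^ 2 -> a * b + a' * b' = 0 -> b ^ 2 = a' ^ 2.
Proof.
  intros E1 E2.
  assert (X : (a ^ 2 + a' ^ 2) * (b ^ 2 - a' ^ 2) = 0).
  { transitivity (a ^ 2 * b ^ 2 + a' ^ 2 * (b ^ 2 - (a ^ 2 + a' ^ 2))); [ring|].
    rewrite E1. transitivity ((a * b) ^ 2 - (a' * b') ^ 2); [ring|].
    replace (a * b) with (- (a' * b')) by lra. ring. }
  apply Rmult_integral in X. destruct X as [X|X]; [|lra]. nra.
Qed.

Lemma adm_coef_admissible D p c d : adm_coef D p c d ->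
  admissible D p (hmap c d) /\ opnorm (df0 (hmap c d)) = Finite (Cmod (c 1%nat)).
Proof.
  intros (Hc & Hd & HD & H0 & Hconf & _).
  assert (F1 := f_equal fst Hconf). assert (F2 := f_equal snd Hconf).
  assert (Hcf : conformal (df0 (hmap c d))).
  { rewrite df0_hmap by auto. unfold Re, Im.
    unfold Cplus, Cmult, RtoC in F1, F2. cbn [fst snd] in F1, F2.
    apply equations_conformal; cbn [m11 m12 m21 m22]; lra. }
  split.
  - split; [split; [exact (hser_harmonic c Hc)|exact (hser_harmonic d Hd)]|].
    split; [exact HD|]. split; auto.
  - rewrite opnorm_conformal by auto. rewrite df0_hmap by auto. cbn [m11 m21]. unfold Cmod. do 2 f_equal.
    destruct (conformal_equations _ Hcf) as [E1 E2]. rewrite df0_hmap in E1, E2 by auto. cbn [m11 m12 m21 m22] in E1, E2.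
    rewrite <- (orthogonal_columns_offdiag _ _ _ _ E1 E2). unfold Re, Im. ring.
Qed.

Lemma series_partials u c r : (forall x y, Cmod (x, y) < 1 -> u (r * x) (r * y) = hser c (x, y)) ->
  conv_disk c -> ex_derive (fun t => u t 0) 0 -> ex_derive (fun t => u 0 t) 0 ->
  c 1%nat = (r * dx u 0 0, - (r * dy u 0 0)).
Proof.
  intros Hu Hc Hx Hy.
  assert (H0 : Cmod (0, 0) < 1). { change (0, 0) with (RtoC 0). rewrite Cmod_0. lra. }
  assert (D0 := hser_differentiable c 0 0 Hc H0).
  assert (Hscal : forall t : R, is_derive (fun t => r * t) t r) by (intro t; auto_derive; auto; ring).
  assert (Hloc := locally_2d_disk 0 0 1 H0). destruct Hloc as [e He].
  assert (V1 : hser (cderiv c) (0, 0) = Re (c 1%nat)).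
  { change (0, 0) with (RtoC 0). rewrite hser_0. unfold cderiv, Re, Im; simpl; ring. }
  assert (V2 : hser (fun n => Ci * cderiv c n)%C (0, 0) = - Im (c 1%nat)).
  { change (0, 0) with (RtoC 0). rewrite hser_0. unfold cderiv, Re, Im; simpl; ring. }
  assert (E1 : r * dx u 0 0 = Re (c 1%nat)).
  { rewrite <- V1. assert (Dx := differentiable_pt_lim_is_derive_x _ _ _ _ _ D0).
    assert (Hx' : ex_derive (fun t => u t 0) (r * 0)) by (rewrite Rmult_0_r; auto).
    assert (D1 := is_derive_comp (fun t => u t 0) (fun t => r * t) 0 _ _ (Derive_correct _ _ Hx') (Hscal 0)).
    rewrite Rmult_0_r in D1. apply is_derive_unique in D1. apply is_derive_unique in Dx.
    etransitivity; [symmetry; exact D1|]. etransitivity; [|exact Dx].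
    apply Derive_ext_loc. exists e. intros t Ht. rewrite <- Hu; [now rewrite Rmult_0_r|].
    apply He; [exact Ht|]. rewrite Rminus_diag, Rabs_R0. apply cond_pos. }
  assert (E2 : r * dy u 0 0 = - Im (c 1%nat)).
  { rewrite <- V2. assert (Dy := differentiable_pt_lim_is_derive_y _ _ _ _ _ D0).
    assert (Hy' : ex_derive (fun t => u 0 t) (r * 0)) by (rewrite Rmult_0_r; auto).
    assert (D1 := is_derive_comp (fun t => u 0 t) (fun t => r * t) 0 _ _ (Derive_correct _ _ Hy') (Hscal 0)).
    rewrite Rmult_0_r in D1. apply is_derive_unique in D1. apply is_derive_unique in Dy.
    etransitivity; [symmetry; exact D1|]. etransitivity; [|exact Dy].
    apply Derive_ext_loc. exists e. intros t Ht. rewrite <- Hu; [now rewrite Rmult_0_r|].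
    apply He; [|exact Ht]. rewrite Rminus_diag, Rabs_R0. apply cond_pos. }
  rewrite E1, E2, Ropp_involutive. apply surjective_pairing.
Qed.

(** The coefficients are those of the dilation [f(r z)], hence the factor [r] in its differential at
    0. *)
Lemma admissible_adm_coef D p f r : admissible D p f -> 0 < r < 1 ->
  exists c d, adm_coef D p c d /\ Cmod (c 1%nat) = r * sqrt (m11 (df0 f) ^ 2 + m21 (df0 f) ^ 2).
Proof.
  intros ((Hu & Hv) & HD & Hp & Hconf) Hr.
  destruct (harmonic_series _ r Hu Hr) as [c [Hc [Ic Ec]]].
  destruct (harmonic_series _ r Hv Hr) as [d [Hd [Id Ed]]].
  assert (H0 : unit_disk (0, 0)). { unfold unit_disk. change (0, 0) with (RtoC 0). rewrite Cmod_0. lra. }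
  assert (C1 : c 1%nat = (r * dx (re_part f) 0 0, - (r * dy (re_part f) 0 0))).
  { destruct (Hu 0 0 H0) as (X1 & X2 & _). now apply series_partials. }
  assert (D1 : d 1%nat = (r * dx (im_part f) 0 0, - (r * dy (im_part f) 0 0))).
  { destruct (Hv 0 0 H0) as (X1 & X2 & _). now apply series_partials. }
  assert (Hmap : forall z, Cmod z < 1 -> hmap c d z = f (r * z)%C).
  { intros [x y] Hz. unfold hmap. rewrite <- (Ec x y Hz), <- (Ed x y Hz). unfold re_part, im_part.
    rewrite <- surjective_pairing. f_equal. unfold Cmult, RtoC; simpl. f_equal; ring. }
  destruct (conformal_equations _ Hconf) as [E1 E2].
  unfold df0 in *. cbn [m11 m12 m21 m22] in *.
  exists c, d. split.
  - split; [auto|]. split; [auto|]. split; [|split; [|split; auto]].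
    + intros z Hz. rewrite Hmap by auto. apply HD. unfold unit_disk.
      rewrite Cmod_mult, Cmod_R, Rabs_pos_eq by lra. pose proof (Cmod_ge_0 z). nra.
    + rewrite Hmap by (rewrite Cmod_0; lra). rewrite Cmult_0_r. exact Hp.
    + rewrite C1, D1. unfold Cplus, Cmult, RtoC. cbn [fst snd].
      set (a := dx (re_part f) 0 0) in *. set (b := dy (re_part f) 0 0) in *.
      set (a' := dx (im_part f) 0 0) in *. set (b' := dy (im_part f) 0 0) in *. f_equal.
      * transitivity (r ^ 2 * (a ^ 2 + a' ^ 2 - (b ^ 2 + b' ^ 2))); [ring|]. rewrite E1. ring.
      * transitivity (- 2 * r ^ 2 * (a * b + a' * b')); [ring|]. rewrite E2. ring.
  - rewrite C1. unfold Cmod. cbn [fst snd].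
    set (a := dx (re_part f) 0 0) in *. set (b := dy (re_part f) 0 0) in *.
    set (a' := dx (im_part f) 0 0) in *. set (b' := dy (im_part f) 0 0) in *.
    rewrite <- (sqrt_pow2 r) at 3 by lra. rewrite <- sqrt_mult_alt by apply pow2_ge_0. f_equal.
    transitivity (r ^ 2 * (a ^ 2 + b ^ 2)); [ring|]. now rewrite (orthogonal_columns_offdiag a b a' b').
Qed.

(** The constant map shows that the supremum is over a nonempty set. *)
Lemma adm_coef_const D p : D p -> exists c d, adm_coef D p c d.
Proof.
  intro Hp.
  set (k := fun (a : R) n => match n with O => RtoC a | _ => RtoC 0 end).
  assert (Hk : forall a, conv_disk (k a)).
  { intro a. apply conv_disk_bounded with (Rabs a). intros [|n]; simpl k; [rewrite Cmod_R; lra|].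
    change (Cmod 0 <= Rabs a). rewrite Cmod_0. apply Rabs_pos. }
  assert (Hv : forall a z, hser (k a) z = a).
  { intros a z. unfold hser. rewrite (Series_ext _ (fun n => a * 0 ^ n)).
    - rewrite Series_scal_l, Series_geom by (rewrite Rabs_R0; lra). field.
    - intros [|n].
      + rewrite Cpow_0, Cmult_1_r. unfold k, Re, RtoC; simpl. ring.
      + unfold k. rewrite Cmult_0_l. unfold Re, RtoC; simpl. ring. }
  exists (k (fst p)), (k (snd p)).
  assert (Hm : forall z, hmap (k (fst p)) (k (snd p)) z = p).
  { intro z. unfold hmap. rewrite !Hv. symmetry. apply surjective_pairing. }
  split; [auto|]. split; [auto|]. split; [intros z _; now rewrite Hm|]. split; [auto|].
  split; [unfold k; ring|]. split; reflexivity.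
Qed.

Lemma adm_coef_max D p : Defs.open_set D -> bounded_set D -> convex_set D -> D p ->
  exists c d, adm_coef D p c d /\ forall c' d', adm_coef D p c' d' -> Cmod (c' 1%nat) <= Cmod (c 1%nat).
Proof.
  intros HO HB HC Hp.
  set (E := fun s => exists c d, adm_coef D p c d /\ s = Cmod (c 1%nat)).
  destruct (completeness E) as [m [Hub Hlub]].
  - destruct HB as [B HB]. exists (2 * B). intros s (c & d & H & ->). now apply (adm_coef_bound D p B c d).
  - destruct (adm_coef_const D p Hp) as (c & d & H). exists (Cmod (c 1%nat)), c, d. auto.
  - assert (Hseq : forall k : nat, exists cd : (nat -> C) * (nat -> C), adm_coef D p (fst cd) (snd cd) /\
       m - / (INR k + 1) < Cmod (fst cd 1%nat)).
    { intro k. apply NNPP. intro Hn.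
      assert (0 < / (INR k + 1)) by (apply Rinv_0_lt_compat; pose proof (pos_INR k); lra).
      assert (m <= m - / (INR k + 1)); [|lra].
      apply Hlub. intros s (c & d & Hcd & ->). apply Rnot_lt_le. intro. apply Hn. exists (c, d). auto. }
    apply choice in Hseq. destruct Hseq as [g Hg].
    destruct (adm_coef_compact D p (fun k => fst (g k)) (fun k => snd (g k)) m HO HB HC Hp) as (c & d & H & Hm).
    + intro k. apply Hg.
    + apply (is_lim_seq_le_le (fun k => m - / (INR k + 1)) _ (fun _ => m)).
      * intro k. destruct (Hg k) as [G1 G2]. split; [lra|]. apply Hub. now exists (fst (g k)), (snd (g k)).
      * replace (Finite m) with (Finite (m - 0)) by (f_equal; ring).
        apply is_lim_seq_minus'; [apply is_lim_seq_const|].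
        assert (Hinf : is_lim_seq (fun k => INR k + 1) p_infty).
        { eapply is_lim_seq_plus; [apply is_lim_seq_INR|apply is_lim_seq_const|reflexivity]. }
        apply (is_lim_seq_inv _ _ Hinf). discriminate.
      * apply is_lim_seq_const.
    + exists c, d. split; auto. intros c' d' H'. rewrite Hm. apply Hub. now exists c', d'.
Qed.

Theorem theorem2p1 (D : C -> Prop) (p : C) :
  is_domain D -> bounded_set D -> convex_set D -> D p ->
  (exists f, admissible D p f /\ opnorm (df0 f) = M_D D p) /\
  Rbar_le (M_D D p) (Rbar_mult (Finite (/ (2 * PI))) (Per D)).
Proof.
  intros [HO _] HB HC Hp.
  destruct (adm_coef_max D p HO HB HC Hp) as (c & d & Hcd & Hmax).
  destruct (adm_coef_admissible D p c d Hcd) as [Hadm Hop].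
  (* An arbitrary admissible map of norm [s] has dilations among the power series, so [r * s] is at
     most the maximum for all [r < 1], and then so is [s]. *)
  assert (HM : M_D D p = Finite (Cmod (c 1%nat))).
  { apply is_lub_Rbar_unique. split.
    - intros m (f & Hf & Hm). rewrite opnorm_conformal in Hm by apply Hf. injection Hm as <-.
      set (s := sqrt _). simpl. apply Rle_trans with (1 * s); [lra|].
      apply (continuity_le_left1 (fun r => r * s)).
      + apply continuity_pt_mult; [apply continuity_pt_id|]. apply continuity_pt_const. now intros ? ?.
      + intros r Hr. destruct (admissible_adm_coef D p f r Hf Hr) as (c' & d' & H' & E).
        eapply Rle_trans; [apply Req_le; symmetry; exact E|eauto].
    - intros l Hl. apply Hl. exists (hmap c d). auto. }
  split.
  - exists (hmap c d). rewrite HM. auto.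
  - rewrite HM. now apply adm_coef_perimeter with p d.
Qed.
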